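(* (i) For every $\boldsymbol{u}_h=\sum_{i\in\mathcal V}\mathsf U_i\varphi_i\in (P(\mathcal T_h))^{d+2}$ (with $\mathsf U_i\in\mathbb R^{d+2}$) one has $\int_D \boldsymbol{u}_h\,dx=\sum_{i\in\mathcal V}m_i\mathsf U_i$. (ii) Let $\mathsf U^n=(\mathsf U_i^n)_{i\in\mathcal V}$ be a collection of admissible states, i.e. $\mathsf U^n_i\in\mathcal A$ for all $i\in\mathcal V$. Let $\mathsf U^{n+1}=(\mathsf U_i^{n+1})_{i\in\mathcal V}$ be the update obtained after one forward-Euler step with limiting (as defined in the context), with time step $\tau_n=c_{\rm cfl}\,\min_{i\in\mathcal V}\big(-\tfrac{m_i}{2d^{L,n}_{ii}}\big)$. If $0<c_{\rm cfl}\le 1$, then $\mathsf U^{n+1}$ is admissible, i.e. $\mathsf U_i^{n+1}\in\mathcal A$ for all $i\in\mathcal V$, and $$\sum_{i\in\mathcal V}m_i\mathsf U_i^{n+1}+\tau_n\sum_{i\in\mathcal V^\partial}m_i^\partial\,\mathbb f(\mathsf U_i^n)\boldsymbol n_i=\sum_{i\in\mathcal V}m_i\mathsf U_i^n .$$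
   Context: **States and flux.** $D\subset\mathbb R^d$ is a bounded polyhedral domain with outward unit normal field $\boldsymbol n$ on $\partial D$. A state is $\boldsymbol u=(\rho,\boldsymbol m,E)^{T}\in\mathbb R\times\mathbb R^d\times\mathbb R=\mathbb R^{d+2}$; $\rho(\boldsymbol u),\boldsymbol m(\boldsymbol u),E(\boldsymbol u)$ denote its components; $\boldsymbol v=\boldsymbol m/\rho$; $e(\boldsymbol u)=E/\rho-\frac12\|\boldsymbol v\|^2$ is the specific internal energy; $\varepsilon(\boldsymbol u)=\rho e(\boldsymbol u)=E-\frac{\|\boldsymbol m\|^2}{2\rho}$. The pressure is $p(\boldsymbol u)=(\gamma-1)\rho e(\boldsymbol u)$, $\gamma>1$. Admissible set: $\mathcal A=\{\boldsymbol u\in\mathbb R^{d+2}: \rho>0,\ e(\boldsymbol u)>0\}$. Flux: $\mathbb f(\boldsymbol u)=(\boldsymbol m,\ \boldsymbol v\otimes\boldsymbol m+p(\boldsymbol u)\mathbb I_d,\ \boldsymbol v(E+p(\boldsymbol u)))^{T}\in\mathbb R^{(d+2)\times d}$, so $\mathbb f(\boldsymbol u)\boldsymbol w\in\mathbb R^{d+2}$ for $\boldsymbol w\in\mathbb R^d$. **Finite elements.** $\mathcal T_h$ is a mesh covering $D$ exactly; $P(\mathcal T_h)$ is a scalar continuous Lagrange finite element space with basis $\{\varphi_i\}_{i\in\mathcal V}$, $\varphi_i\ge0$, $\sum_{i\in\mathcal V}\varphi_i=1$. $\mathcal I(i)=\{j\in\mathcal V: |\mathrm{supp}\,\varphi_i\cap\mathrm{supp}\,\varphi_j|\ne0\}$,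 $\mathcal I^*(i)=\mathcal I(i)\setminus\{i\}$. $\mathcal V^\partial$ is the set of $i$ with $\varphi_i|_{\partial D}\not\equiv0$. Set $m_i=\int_D\varphi_i\,dx$, $m_{ij}=\int_D\varphi_i\varphi_j\,dx$, $\boldsymbol c_{ij}=\int_D\varphi_i\nabla\varphi_j\,dx$, $\boldsymbol n_{ij}=\boldsymbol c_{ij}/\|\boldsymbol c_{ij}\|$ (for $j\in\mathcal I^*(i)$, $\boldsymbol c_{ij}\neq 0$ being implicit), $b_{ij}=\delta_{ij}-m_{ij}/m_j$. For $i\in\mathcal V^\partial$: $m_i^\partial=\|\int_{\partial D}\varphi_i\boldsymbol n\,ds\|$ and $\boldsymbol n_i=\frac1{m_i^\partial}\int_{\partial D}\varphi_i\boldsymbol n\,ds$. **Forward-Euler step with limiting.** Given admissible $\mathsf U^n$ and a time step $\tau_n$: 1. *Low order.* $\lambda^{\max}(\mathsf U_L,\mathsf U_R,\boldsymbol w)$ is any upper bound on the maximum wave speed (in absolute value) in the Riemann problem for $\partial_t\boldsymbol q+\partial_x(\mathbb f(\boldsymbol q)\boldsymbol w)=0$ with left state $\mathsf U_L$ and right state $\mathsf U_R$. For $j\in\mathcal I^*(i)$, $d_{ij}^{L,n}=\max\big(\lambda^{\max}(\mathsf U^n_i,\mathsf U^n_j,\boldsymbol n_{ij})\|\boldsymbol c_{ij}\|,\ \lambda^{\max}(\mathsf U^n_j,\mathsf U^n_i,\boldsymbol n_{ji})\|\boldsymbol c_{ji}\|\big)$; $d_{ii}^{L,n}=-\sum_{j\in\mathcal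 I^*(i)}d_{ij}^{L,n}$. The low-order update $\mathsf U^{L,n+1}$ is defined by $m_i(\mathsf U_i^{L,n+1}-\mathsf U_i^n)=\tau_n\sum_{j\in\mathcal I(i)}\big(-\mathbb f(\mathsf U_j^n)\boldsymbol c_{ij}+d^{L,n}_{ij}(\mathsf U_j^n-\mathsf U_i^n)\big)$. Auxiliary states: $\overline{\mathsf U}_{ij}^n=\frac12(\mathsf U_i^n+\mathsf U_j^n)-\frac1{2d_{ij}^{L,n}}(\mathbb f(\mathsf U_j^n)-\mathbb f(\mathsf U_i^n))\boldsymbol c_{ij}$ for $j\in\mathcal I(i)$ (so $\overline{\mathsf U}_{ii}^n=\mathsf U_i^n$). 2. *High order.* With given numbers $\alpha_i\in[0,1]$, $d_{ij}^{H,n}=\frac{\alpha_i+\alpha_j}{2}d_{ij}^{L,n}$ for $j\in\mathcal I^*(i)$, and $\mathsf F_i^H=\sum_{j\in\mathcal I(i)}\big(-\mathbb f(\mathsf U^n_j)\boldsymbol c_{ij}+d_{ij}^{H,n}(\mathsf U^n_j-\mathsf U^n_i)\big)$. 3. *Limiting.* With $\lambda_i=(\mathrm{card}\,\mathcal I(i)-1)^{-1}$, for $j\in\mathcal I^*(i)$ set $\mathsf P_{ij}^n=\frac{\tau_n}{m_i\lambda_i}\big(b_{ij}\mathsf F_j^H-b_{ji}\mathsf F_i^H+(d_{ij}^{H,n}-d_{ij}^{L,n})(\mathsf U_j^n-\mathsf U_i^n)\big)$. Bounds: $\Psi_\flat(\mathsf U)=\rho(\mathsf U)$, $\Psi_\sharp(\mathsf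 U)=-\rho(\mathsf U)$, $\Phi(\mathsf U)=\varepsilon(\mathsf U)\rho(\mathsf U)^{-\gamma}$; $\Psi^{\min}_{\flat,i}=\min_{j\in\mathcal I(i)}\Psi_\flat(\overline{\mathsf U}^n_{ij})$, $\Psi^{\min}_{\sharp,i}=\min_{j\in\mathcal I(i)}\Psi_\sharp(\overline{\mathsf U}^n_{ij})$, $\Phi_i^{\min}=\min_{j\in\mathcal I(i)}\Phi(\mathsf U^n_j)$. For $j\in\mathcal I^*(i)$ let $\ell_j^i$ be the largest number in $[0,1]$ such that $\Psi_\flat(\mathsf U_i^{L,n+1}+\ell_j^i\mathsf P^n_{ij})\ge\Psi_{\flat,i}^{\min}$, $\Psi_\sharp(\mathsf U_i^{L,n+1}+\ell_j^i\mathsf P^n_{ij})\ge\Psi_{\sharp,i}^{\min}$, $\Phi(\mathsf U_i^{L,n+1}+\ell_j^i\mathsf P^n_{ij})\ge\Phi_i^{\min}$; set $\ell_{ij}=\min(\ell_j^i,\ell_i^j)$. The limited update is $\mathsf U_i^{n+1}=\mathsf U_i^{L,n+1}+\sum_{j\in\mathcal I^*(i)}\lambda_i\ell_{ij}\mathsf P_{ij}^n$. The limiting may be repeated a finite number of times, each time replacing $\mathsf U_i^{L,n+1}$ by $\sum_{j\in\mathcal I^*(i)}\lambda_i(\mathsf U_i^{L,n+1}+\ell_{ij}\mathsf P^n_{ij})$ and $\mathsf P_{ij}^n$ by $(1-\ell_{ij})\mathsf P_{ij}^n$ and recomputing the limiters with the same bounds. *)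

(* Defs.v *)
From HB Require Import structures.
From mathcomp Require Import all_boot all_order all_algebra.
From mathcomp Require Import all_classical all_reals all_analysis.

Set Implicit Arguments.
Unset Strict Implicit.
Unset Printing Implicit Defensive.
Import Order.TTheory GRing.Theory Num.Theory.
Import numFieldNormedType.Exports.
Local Open Scope classical_set_scope.
Local Open Scope ring_scope.

(* The canonical norm of 'rV[R]_n is the max norm, hence a separate Euclidean
   norm below; both induce the same topology. *)
Definition dot (R : realType) (n : nat) (x y : 'rV[R]_n) : R :=
  \sum_i x 0 i * y 0 i.

Definition enorm (R : realType) (n : nat) (x : 'rV[R]_n) : R :=
  Num.sqrt (dot x x).

Definition insert_coord (R : realType) (n : nat) (k : 'I_n.+1) (t : R)
    (y : 'rV[R]_n) : 'rV[R]_n.+1 :=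
  \row_j (if unlift k j is Some j' then y 0 j' else t).

(** Lebesgue measure on R^n, built on n-tuples (whose sigma-algebra is the
    product of the Borel ones) by iterating the product with the line. *)

Definition cons_pair (R : realType) (n : nat) (p : R * n.-tuple R) :
  n.+1.-tuple R := [the n.+1.-tuple R of p.1 :: p.2].

Lemma measurable_cons_pair (R : realType) (n : nat) :
  measurable_fun [set: R * n.-tuple R] (@cons_pair R n).
Proof.
by apply: measurable_cons; [exact: measurable_fst|exact: measurable_snd].
Qed.

Definition leb_cons (R : realType) (n : nat)
    (mu : {sigma_finite_measure set (n.-tuple R) -> \bar R}) :
  set (n.+1.-tuple R) -> \bar R :=
  pushforward (@lebesgue_measure R \x mu)%E (@cons_pair R n).

Section leb_cons_measure.
Context (R : realType) (n : nat).
Context (mu : {sigma_finite_measure set (n.-tuple R) -> \bar R}).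
Local Open Scope ereal_scope.

Let leb_cons0 : leb_cons mu set0 = 0.
Proof. by rewrite /leb_cons /pushforward preimage_set0 measure0. Qed.

Let leb_cons_ge0 A : 0 <= leb_cons mu A.
Proof. by rewrite /leb_cons /pushforward measure_ge0. Qed.

Let leb_cons_sigma_additive : semi_sigma_additive (leb_cons mu).
Proof.
move=> F mF tF mUF; rewrite /leb_cons /pushforward preimage_bigcup.
have mc := @measurable_cons_pair R n.
apply: measure_semi_sigma_additive.
- by move=> i; rewrite -[X in measurable X]setTI; exact: mc.
- apply/trivIsetP => /= i j _ _ ij; rewrite -preimage_setI.
  by move/trivIsetP : tF => /(_ _ _ _ _ ij) ->//; rewrite preimage_set0.
- by rewrite -preimage_bigcup -[X in measurable X]setTI; exact: mc.
Qed.

HB.instance Definition _ := isMeasure.Build _ _ _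
  (leb_cons mu) leb_cons0 leb_cons_ge0 leb_cons_sigma_additive.

Let leb_cons_sigma_finite : sigma_finite setT (leb_cons mu).
Proof.
have /sigma_finiteP[F [TF ndF Foo]] := sigma_finiteT (@lebesgue_measure R).
have /sigma_finiteP[G [TG ndG Goo]] := sigma_finiteT mu.
pose split_cons (t : n.+1.-tuple R) : R * n.-tuple R :=
  (thead t, [tuple of behead t]).
have msplit : measurable_fun setT split_cons.
  apply/measurable_fun_pairP; split; last exact: measurable_behead.
  exact: measurable_tnth.
have splitK : cancel split_cons (@cons_pair R n).
  by move=> t; rewrite [RHS]tuple_eta; apply/val_inj.
have consK : cancel (@cons_pair R n) split_cons.
  by move=> [x t]; congr pair; apply/val_inj.
exists (fun i => split_cons @^-1` (F i `*` G i)).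
  apply/esym/seteqP; split => // t _.
  have [i _ Fi] : (\bigcup_i F i) (split_cons t).1 by rewrite -TF.
  have [j _ Gj] : (\bigcup_i G i) (split_cons t).2 by rewrite -TG.
  exists (maxn i j) => //; split.
    by move: Fi; exact/subsetPset/ndF/leq_maxl.
  by move: Gj; exact/subsetPset/ndG/leq_maxr.
move=> i; have [mFi Fioo] := Foo i; have [mGi Gioo] := Goo i; split.
  by rewrite -[X in measurable X]setTI; apply: msplit => //; exact: measurableX.
rewrite /leb_cons /pushforward -comp_preimage (_ : _ \o _ = id); last first.
  by apply/funext => p /=; rewrite consK.
rewrite preimage_id product_measure1E//.
by rewrite lte_mul_pinfty// ge0_fin_numE.
Qed.

HB.instance Definition _ := Measure_isSigmaFinite.Build _ _ _
  (leb_cons mu) leb_cons_sigma_finite.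

End leb_cons_measure.

Section leb0_measure.
Context (R : realType).

Definition leb0 : set (0.-tuple R) -> \bar R := dirac [tuple].

HB.instance Definition _ := Measure.on leb0.

Let leb0_sigma_finite : sigma_finite setT leb0.
Proof.
apply: fin_num_fun_sigma_finite; first by rewrite measure0.
exact: fin_num_measure.
Qed.

HB.instance Definition _ := Measure_isSigmaFinite.Build _ _ _
  leb0 leb0_sigma_finite.

End leb0_measure.

Fixpoint leb (R : realType) (n : nat) :
    {sigma_finite_measure set (n.-tuple R) -> \bar R} :=
  match n with
  | 0 => @leb0 R
  | m.+1 => leb_cons (leb R m)
  end.

Definition vol (R : realType) (n : nat) (A : set 'rV[R]_n) : \bar R :=
  leb R n [set t | A (\row_i tnth t i)].

Definition integral_on (R : realType) (n : nat) (A : set 'rV[R]_n)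
    (f : 'rV[R]_n -> R) : R :=
  (\int[leb R n]_(t in [set t | A (\row_i tnth t i)]) f (\row_i tnth t i))%R.

Section geometry.
Context (R : realType) (d : nat).
(* The ambient space is R^n with n = d + 1, so that n ranges over n >= 1 and
   the hyperplanes have dimension d. *)
Local Notation n := d.+1.
Implicit Types (D : set 'rV[R]_n) (h : 'rV[R]_n * R) (g : 'rV[R]_n -> R).

(* A pair h = (a, b) stands for the hyperplane {x | a . x = b}. *)
Definition hyperplane h : set 'rV[R]_n := [set x | dot h.1 x = h.2].

Definition bdry D : set 'rV[R]_n := closure D `\` interior D.

Definition polyhedral_domain D : Prop :=
  [/\ D !=set0, open D, connected D, bounded_set D &
      exists hs : seq ('rV[R]_n * R),
        (forall h, h \in hs -> h.1 != 0) /\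
        bdry D `<=` [set x | exists2 h, h \in hs & hyperplane h x]].

(* nu is the outward unit normal at x when D coincides, near x, with the open
   half-space {y | nu . (y - x) < 0}; no normal exists on the edges. *)
Definition outward_normal D (x nu : 'rV[R]_n) : Prop :=
  enorm nu = 1 /\ \forall y \near x, D y <-> dot nu (y - x) < 0.

Definition bdry_face D h : set 'rV[R]_n :=
  [set x | [/\ bdry D x, hyperplane h x & outward_normal D x h.1]].

(* Surface integral over the part A of the hyperplane {a . x = b}, |a| = 1,
   seen as a graph over the coordinates other than the p-th one, where
   a_p != 0: ds = sqrt (1 + |grad|^2) dy = dy / |a_p|. The value does not
   depend on p. For d = 0 this is evaluation at a point. *)
Definition pivot (a : 'rV[R]_n) : 'I_n :=
  if [pick p | a 0 p != 0] is Some p then p else ord0.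

Definition graph_point h (y : 'rV[R]_d) : 'rV[R]_n :=
  let p := pivot h.1 in
  insert_coord p ((h.2 - dot h.1 (insert_coord p 0 y)) / h.1 0 p) y.

Definition hyperplane_integral h (A : set 'rV[R]_n) g : R :=
  `|h.1 0 (pivot h.1)|^-1 *
  integral_on [set y | A (graph_point h y)] (fun y => g (graph_point h y)).

(* int_{bdry D} g n ds. The sum is over the finitely many planes (with
   orientation) carrying a flat piece of the boundary; on bdry_face D h the
   outward unit normal is h.1. *)
Definition bdry_integral_normal D g : 'rV[R]_n :=
  \sum_(h \in [set h | bdry_face D h !=set0])
    hyperplane_integral h (bdry_face D h) g *: h.1.

(** Meshes and Lagrange finite elements *)

(* A cell is the polytope cut out by the half-spaces a . x <= b. *)
Definition cell (faces : seq ('rV[R]_n * R)) : set 'rV[R]_n :=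
  [set x | forall h, h \in faces -> dot h.1 x <= h.2].

Definition mesh_of D (T : finType) (faces : T -> seq ('rV[R]_n * R)) : Prop :=
  [/\ forall K, interior (cell (faces K)) !=set0,
      forall K L, K != L ->
        interior (cell (faces K)) `&` interior (cell (faces L)) = set0 &
      \bigcup_(K in [set: T]) cell (faces K) = closure D].

Definition continuously_differentiable (g : 'rV[R]_n -> R^o) : Prop :=
  (forall x, differentiable g x) /\ forall v, continuous ('D_v g).

Definition grad (g : 'rV[R]_n -> R^o) (x : 'rV[R]_n) : 'rV[R]_n :=
  \row_k 'D_(delta_mx 0 k) g x.

Section lagrange.
Context (D : set 'rV[R]_n) (T V : finType).
Context (faces : T -> seq ('rV[R]_n * R)).
Local Notation cl K := (cell (faces K)).

(* The local elements (K, P_K, nodes of K) in the sense of Ciarlet: P_K is a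
   space of functions that are C^1 up to the boundary of K, and every set of
   values at the nodes of K is interpolated by exactly one function of P_K.
   P_K also covers shape functions that are not polynomials, such as the
   images of polynomials under a non-affine map. *)
Definition lagrange_elements (node : V -> 'rV[R]_n)
    (P : T -> set ('rV[R]_n -> R)) : Prop :=
  [/\ injective node,
      forall i, closure D (node i),
      forall K f, P K f -> exists2 g : 'rV[R]_n -> R^o,
        continuously_differentiable g & forall x, cl K x -> f x = g x,
      forall K (a : R) f g, P K f -> P K g -> P K (fun x => a * f x + g x) &
      forall K (val : V -> R),
        (exists2 f, P K f & forall i, cl K (node i) -> f (node i) = val i) /\
        (forall f g, P K f -> P K g ->
           (forall i, cl K (node i) -> f (node i) = g (node i)) ->
           forall x, cl K x -> f x = g x)].

Definition fe_space (P : T -> set ('rV[R]_n -> R)) : set ('rV[R]_n -> R) :=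
  [set v | {within closure D, continuous v} /\
     forall K, exists2 f, P K f & forall x, cl K x -> v x = f x].

Definition lagrange_basis (node : V -> 'rV[R]_n)
    (P : T -> set ('rV[R]_n -> R)) (phi : V -> 'rV[R]_n -> R) : Prop :=
  lagrange_elements node P /\
  forall i, fe_space P (phi i) /\ forall j, phi i (node j) = (i == j)%:R.

Context (phi : V -> 'rV[R]_n -> R).

Definition mass (i : V) : R := integral_on D (phi i).

Definition mass2 (i j : V) : R := integral_on D (fun x => phi i x * phi j x).

(* The gradient is the elementwise one, defined in the interior of the cells,
   i.e. almost everywhere in D. *)
Definition cvec (i j : V) : 'rV[R]_n :=
  \row_k \sum_(K : T)
    integral_on (interior (cl K)) (fun x => phi i x * grad (phi j) x 0 k).

Definition supp (i : V) : set 'rV[R]_n :=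
  closure [set x | D x /\ phi i x != 0].

Definition stencil (i : V) : {set V} :=
  [set j | `[< vol (supp i `&` supp j) <> 0%E >]].

Definition bdry_dofs : {set V} :=
  [set i | `[< exists2 x, bdry D x & phi i x != 0 >]].

Definition bdry_mass (i : V) : R := enorm (bdry_integral_normal D (phi i)).

Definition bdry_normal (i : V) : 'rV[R]_n :=
  (bdry_mass i)^-1 *: bdry_integral_normal D (phi i).

End lagrange.
End geometry.

(** The Euler equations with a gamma law. A state is the row vector
    (rho, m, E) of R^(n+2). *)

Section euler.
Context (R : realType) (n : nat) (gamma : R).
Implicit Types (u : 'rV[R]_(1 + n + 1)) (w : 'rV[R]_n).

Definition rho u : R := lsubmx (lsubmx u) 0 0.
Definition mom u : 'rV[R]_n := rsubmx (lsubmx u).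
Definition energy u : R := rsubmx u 0 0.

Definition velocity u : 'rV[R]_n := (rho u)^-1 *: mom u.

Definition spec_energy u : R :=
  energy u / rho u - 2^-1 * enorm (velocity u) ^+ 2.

Definition internal_energy u : R := rho u * spec_energy u.

Definition pressure u : R := (gamma - 1) * rho u * spec_energy u.

Definition admissible : set 'rV[R]_(1 + n + 1) :=
  [set u | 0 < rho u /\ 0 < spec_energy u].

Definition flux u : 'M[R]_(1 + n + 1, n) :=
  col_mx (col_mx (mom u) ((velocity u)^T *m mom u + (pressure u)%:M))
         ((energy u + pressure u) *: velocity u).

(* The product of the matrix flux u with the vector w, as a row vector. *)
Definition flux_dot u w : 'rV[R]_(1 + n + 1) := w *m (flux u)^T.

Definition Phi u : R := internal_energy u * rho u `^ (- gamma).

(** The Riemann problem for dq/dt + d(f(q) w)/dx = 0 *)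

Definition spec_entropy u : R := (gamma - 1)^-1 * ln (Phi u).

(* The generalized (Harten) entropies are - rho h(s), with entropy flux
   - (m . w) h(s), for those h that make - rho h(s) convex. *)
Definition entropy_profile (h : R -> R^o) : Prop :=
  (forall s, derivable h s 1 /\ derivable (derive1 h) s 1) /\
  @convex_function R 'rV[R]_(1 + n + 1) admissible
    (fun u => - (rho u * h (spec_entropy u))).

Local Notation mu := (@lebesgue_measure R).

Definition state_integral (A : set R) (q : R -> 'rV[R]_(1 + n + 1)) :
  'rV[R]_(1 + n + 1) := \row_k (\int[mu]_(x in A) q x 0 k)%R.

Definition riemann_data (uL uR : 'rV[R]_(1 + n + 1)) (x : R) :=
  if x < 0 then uL else uR.

(* Q is the profile of a self-similar entropy solution q(x, t) = Q(x / t):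
   the conservation law and the entropy inequalities hold in integral form on
   all space-time rectangles [x1, x2] * [0, t]. The vacuum (state 0, where all
   fluxes vanish) is allowed inside the fan. *)
Definition riemann_solution (w : 'rV[R]_n) (uL uR : 'rV[R]_(1 + n + 1))
    (Q : R -> 'rV[R]_(1 + n + 1)) : Prop :=
  let q x t := Q (x / t) in
  [/\ forall k, measurable_fun setT (fun xi => Q xi 0 k),
      bounded_fun Q,
      forall xi, admissible (Q xi) \/ Q xi = 0,
      forall x1 x2 t, x1 < x2 -> 0 < t ->
        state_integral `[x1, x2] (q^~ t)
        - state_integral `[x1, x2] (riemann_data uL uR)
        + state_integral `[0, t] (fun s => flux_dot (q x2 s) w)
        - state_integral `[0, t] (fun s => flux_dot (q x1 s) w) = 0 &
      forall h, entropy_profile h ->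
        let eta u := - (rho u * h (spec_entropy u)) in
        let G u := - (dot (mom u) w * h (spec_entropy u)) in
        forall x1 x2 t, x1 < x2 -> 0 < t ->
        (\int[mu]_(x in `[x1, x2]) eta (q x t))%R
        - (\int[mu]_(x in `[x1, x2]) eta (riemann_data uL uR x))%R
        + (\int[mu]_(s in `[0%R, t]) G (q x2 s))%R
        - (\int[mu]_(s in `[0%R, t]) G (q x1 s))%R <= 0].

(* lam bounds the absolute value of all wave speeds of the Riemann problem:
   the waves of its entropy solution lie in the fan |x| <= lam t. The Riemann
   problem for a polytropic gas has such a solution for all admissible data;
   stating the bound existentially does not presuppose uniqueness. *)
Definition wave_speed_bound (w : 'rV[R]_n) (uL uR : 'rV[R]_(1 + n + 1))
    (lam : R) : Prop :=
  0 <= lam /\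
  exists2 Q, riemann_solution w uL uR Q &
    forall xi, (xi < - lam -> Q xi = uL) /\ (lam < xi -> Q xi = uR).

End euler.

(** The forward Euler step with limiting, for a given stencil N, lumped mass m,
    mass matrix mm, vectors c = c_ij, and wave speed estimate lmax. *)

Definition finmin (R : realType) (V : finType) (A : {set V}) (f : V -> R) : R :=
  inf [set f j | j in [set j | j \in A]].

Section scheme.
Context (R : realType) (n : nat) (gamma : R).
Context (lmax : 'rV[R]_(1 + n + 1) -> 'rV[R]_(1 + n + 1) -> 'rV[R]_n -> R).
Context (V : finType) (N : V -> {set V}).
Context (m : V -> R) (mm : V -> V -> R) (c : V -> V -> 'rV[R]_n).
Context (alpha : V -> R) (U : V -> 'rV[R]_(1 + n + 1)).

Definition Nstar (i : V) : {set V} := N i :\ i.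

Definition unit_cvec (i j : V) : 'rV[R]_n := (enorm (c i j))^-1 *: c i j.

Definition bcoef (i j : V) : R := (i == j)%:R - mm i j / m j.

Definition dL_offdiag (i j : V) : R :=
  Num.max (lmax (U i) (U j) (unit_cvec i j) * enorm (c i j))
          (lmax (U j) (U i) (unit_cvec j i) * enorm (c j i)).

Definition dL (i j : V) : R :=
  if i == j then - \sum_(k in Nstar i) dL_offdiag i k else dL_offdiag i j.

Definition time_step (cfl : R) : R :=
  cfl * finmin [set: V]%SET (fun i => - (m i / (2 * dL i i))).

Context (tau : R).

Definition low_order (i : V) : 'rV[R]_(1 + n + 1) :=
  U i + (tau / m i) *: \sum_(j in N i)
    (- flux_dot gamma (U j) (c i j) + dL i j *: (U j - U i)).

Definition bar_state (i j : V) : 'rV[R]_(1 + n + 1) :=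
  2^-1 *: (U i + U j) -
  (2 * dL i j)^-1 *:
    (flux_dot gamma (U j) (c i j) - flux_dot gamma (U i) (c i j)).

(* Only the values of dH off the diagonal matter. *)
Definition dH (i j : V) : R := (alpha i + alpha j) / 2 * dL i j.

Definition FH (i : V) : 'rV[R]_(1 + n + 1) :=
  \sum_(j in N i) (- flux_dot gamma (U j) (c i j) + dH i j *: (U j - U i)).

Definition lambda (i : V) : R := (#|N i|%:R - 1)^-1.

Definition P0 (i j : V) : 'rV[R]_(1 + n + 1) :=
  (tau / (m i * lambda i)) *:
    (bcoef i j *: FH j - bcoef j i *: FH i
     + (dH i j - dL i j) *: (U j - U i)).

Definition rho_min (i : V) : R := finmin (N i) (fun j => rho (bar_state i j)).

Definition neg_rho_min (i : V) : R :=
  finmin (N i) (fun j => - rho (bar_state i j)).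

Definition Phi_min (i : V) : R := finmin (N i) (fun j => Phi gamma (U j)).

(* The pair W, P below is (U^L, P^n) and its successive replacements. *)
Section limiter.
Context (W : V -> 'rV[R]_(1 + n + 1)) (P : V -> V -> 'rV[R]_(1 + n + 1)).

(* The one-sided limiter l^i_j: the set is a closed subinterval of [0, 1]
   containing 0, so that its supremum is its largest element. *)
Definition one_sided_limiter (i j : V) : R :=
  sup [set l | let u := W i + l *: P i j in
    [/\ 0 <= l <= 1, rho_min i <= rho u, neg_rho_min i <= - rho u &
        Phi_min i <= Phi gamma u]].

Definition limiter (i j : V) : R :=
  Num.min (one_sided_limiter i j) (one_sided_limiter j i).

Definition limited (i : V) : 'rV[R]_(1 + n + 1) :=
  W i + \sum_(j in Nstar i) (lambda i * limiter i j) *: P i j.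

Definition relimit_base (i : V) : 'rV[R]_(1 + n + 1) :=
  \sum_(j in Nstar i) lambda i *: (W i + limiter i j *: P i j).

Definition relimit_correction (i j : V) : 'rV[R]_(1 + n + 1) :=
  (1 - limiter i j) *: P i j.

End limiter.

Fixpoint limited_after (r : nat) (W : V -> 'rV[R]_(1 + n + 1))
    (P : V -> V -> 'rV[R]_(1 + n + 1)) : V -> 'rV[R]_(1 + n + 1) :=
  if r is r'.+1
  then limited_after r' (relimit_base W P) (relimit_correction W P)
  else limited W P.

(* The update U^(n+1) when the limiting is repeated r times after the first. *)
Definition euler_step (r : nat) : V -> 'rV[R]_(1 + n + 1) :=
  limited_after r low_order P0.

End scheme.

(* Main.v *)
Require Import Defs.
From HB Require Import structures.
From mathcomp Require Import all_boot all_order all_algebra.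
From mathcomp Require Import all_classical all_reals all_analysis.
From mathcomp Require Import measurable_realfun ring lra zify.

(** Conservation. The limiting only exchanges antisymmetric quantities between
    neighbours, so the balance reduces to sum_i c_ij = int_{bdry D} phi_j n ds.
    This is a divergence theorem for a continuous, piecewise C^1 function on a
    mesh of polytopes. Integrating the k-th derivative along the lines parallel
    to e_k leaves, by the fundamental theorem of calculus, the values at the end
    points of the intervals cut out by the cells. For almost every line no two of
    the finitely many planes involved are met at the same point; then the end
    points of adjacent cells cancel and the others are exactly the points of the
    flat pieces of the boundary, counted with the sign of n_k. Fubini turns their
    sum into the surface integral, whose value does not depend on the coordinate
    that is eliminated.

    Admissibility. The admissible set is an intersection of open half-spaces
    {rho > 0}, {E - v.m + |v|^2 rho / 2 > 0}, so it is enough to follow positive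
    linear forms. An auxiliary state is the mean of the Riemann fan over its
    opening, hence admissible unless the fan is vacuum almost everywhere, which
    the balance laws exclude. The low-order update is a convex combination of
    auxiliary states, and the limited state one of points W_i + l P_ij, each
    admissible because the bounds keep these linear forms away from 0. *)

Set Implicit Arguments.
Unset Strict Implicit.
Unset Printing Implicit Defensive.
Import Order.TTheory GRing.Theory Num.Theory.
Import numFieldNormedType.Exports.
Local Open Scope classical_set_scope.
Local Open Scope ring_scope.

(** * Lebesgue measure on row vectors *)

(** The cells in [mesh_of] only have disjoint interiors and cover the closure of [D]. They need not
    match face to face, so boundary terms cannot be paired facet by facet and are cancelled point by
    point on lines instead. [polyhedral_domain] also lets [D] lie on both sides of a piece of its
    boundary: no outward normal exists there, and the end points of the cells on the two sides
    cancel as in the interior.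

    [riemann_solution] offers integral balances on rectangles and nothing about traces at the edges
    of the fan. Linear forms are the tool that fits: they commute with integrals and convex
    combinations and, being affine along a segment, pass to the supremum that defines a limiter.
    Rows and columns of [c] play different roles: sum_j c_ij = 0 turns fluxes into flux differences
    and so into auxiliary states, while sum_i c_ij produces the boundary term.

    Division by 0 yields 0. If some m_i or d_ii vanishes, the time step is therefore 0 and the
    update changes nothing; otherwise all m_i are positive, but single d_ij may still be 0. *)

Definition rowt (R : realType) (n : nat) (t : n.-tuple R) : 'rV[R]_n :=
  \row_i tnth t i.

(** [leb] is built on tuples by adding a coordinate in front; the divergence theorem slices along
    the k-th axis, hence this version of [cons_pair] for any position. *)
Definition ins_tuple (R : realType) (n : nat) (k : 'I_n.+1)
    (p : R * n.-tuple R) : n.+1.-tuple R :=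
  [tuple insert_coord k p.1 (rowt p.2) 0 j | j < n.+1].

Lemma rowt_ins (R : realType) n (k : 'I_n.+1) (p : R * n.-tuple R) :
  rowt (ins_tuple k p) = insert_coord k p.1 (rowt p.2).
Proof. by apply/rowP => j; rewrite !mxE tnth_mktuple mxE. Qed.

Lemma rowt_inj (R : realType) n : injective (@rowt R n).
Proof.
move=> s t st; apply/eq_from_tnth => i.
by have := congr1 (fun r : 'rV_n => r 0 i) st; rewrite !mxE.
Qed.

Lemma measurable_ins_tuple (R : realType) n (k : 'I_n.+1) :
  measurable_fun [set: measurableTypeR R * n.-tuple R] (ins_tuple k).
Proof.
apply/measurable_fun_tnthP => i.
rewrite (_ : _ \o _ = fun p : R * n.-tuple R =>
  if unlift k i is Some j then tnth p.2 j else p.1); last first.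
  apply/funext => p /=; rewrite tnth_mktuple mxE.
  by case: unlift => // j; rewrite mxE.
case: unliftP => [j|] _; last exact: measurable_fst.
exact: measurableT_comp (measurable_tnth j) measurable_snd.
Qed.

Lemma ins_tuple0 (R : realType) n (p : R * n.-tuple R) :
  ins_tuple ord0 p = cons_pair p.
Proof.
apply/eq_from_tnth => i; rewrite tnth_mktuple mxE.
case: unliftP => [j ->|->]; last by rewrite (tnth_nth 0).
by rewrite mxE !(tnth_nth 0) /=.
Qed.

(** The commutation behind the induction in [tonelli_ins]: inserting beyond the head leaves the head
    alone. *)
Lemma ins_tuple_lift0 (R : realType) n (k : 'I_n.+1) (s r : R) (y : n.-tuple R) :
  ins_tuple (lift ord0 k) (s, cons_pair (r, y)) =
  cons_pair (r, ins_tuple k (s, y)).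
Proof.
rewrite -!ins_tuple0; apply/rowt_inj; rewrite !rowt_ins.
rewrite /=.
apply/rowP => i; rewrite !mxE.
case: (unliftP ord0 i) => [j ->|->].
  rewrite mxE.
  case: (unliftP k j) => [j' ->|->].
    rewrite (_ : lift ord0 (lift k j') = lift (lift ord0 k) (lift ord0 j')).
      by rewrite liftK mxE liftK.
    by apply/val_inj; rewrite /= /bump /=; lia.
  by rewrite unlift_none.
rewrite (_ : ord0 = lift (lift ord0 k) (ord0 : 'I_n.+1)).
  by rewrite liftK mxE unlift_none.
by apply/val_inj.
Qed.

(** * Tonelli and Fubini with an arbitrary coordinate singled out *)

Section tonelli.
Context (R : realType).
Local Open Scope ereal_scope.
Local Notation mu := (@lebesgue_measure R).

Lemma tonelli_cons n (f : n.+1.-tuple R -> \bar R) :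
  measurable_fun [set: n.+1.-tuple R] f -> (forall t, 0 <= f t) ->
  \int[leb R n.+1]_t f t =
  \int[leb R n]_y \int[mu]_s f (cons_pair (s, y)).
Proof.
move=> mf f0; have mc : measurable_fun [set: measurableTypeR R * n.-tuple R] (@cons_pair R n).
  exact: measurable_cons_pair.
have := ge0_integral_pushforward mc (mu \x leb R n) measurableT mf (fun t _ => f0 t).
rewrite preimage_setT fubini_tonelli2; last 2 first.
- exact: measurableT_comp mf mc.
- by move=> p; exact: f0.
by move=> <-; exact: eq_measure_integral.
Qed.

(** Induction on [n]: after the head is split off, the induction hypothesis extracts coordinate [j]
    of the tail, and it remains to exchange two one-dimensional integrals. *)
Lemma tonelli_ins n (k : 'I_n.+1) (f : n.+1.-tuple R -> \bar R) :
  measurable_fun [set: n.+1.-tuple R] f -> (forall t, 0 <= f t) ->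
  \int[leb R n.+1]_t f t =
  \int[leb R n]_y \int[mu]_s f (ins_tuple k (s, y)).
Proof.
elim: n => [|n IHn] in k f *; move=> mf f0.
  rewrite ord1 tonelli_cons//; apply: eq_integral => y _.
  by apply: eq_integral => s _; rewrite ins_tuple0.
case: (unliftP ord0 k) => [j ->|->]; last first.
  rewrite tonelli_cons//; apply: eq_integral => y _.
  by apply: eq_integral => s _; rewrite ins_tuple0.
rewrite tonelli_cons//.
have mfc : measurable_fun setT (f \o @cons_pair R n.+1).
  by apply: measurableT_comp => //; exact: measurable_cons_pair.
rewrite (IHn j); last 2 first.
- exact: (@measurable_fun_fubini_tonelli_G _ _ (measurableTypeR R) 
    (n.+1.-tuple R) R mu (f \o @cons_pair R n.+1) mfc (fun x => f0 _)).
- by move=> t; apply: integral_ge0.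
have mfi : measurable_fun [set: measurableTypeR R * n.+1.-tuple R]
    (f \o ins_tuple (lift ord0 j)).
  exact: measurableT_comp mf (measurable_ins_tuple _).
rewrite tonelli_cons; last 2 first.
- exact: (@measurable_fun_fubini_tonelli_G _ _ (measurableTypeR R)
    (n.+1.-tuple R) R mu (f \o ins_tuple (lift ord0 j)) mfi (fun x => f0 _)).
- by move=> t; apply: integral_ge0.
apply: eq_integral => y _.
pose g (p : measurableTypeR R * measurableTypeR R) :=
  f (cons_pair (p.1, ins_tuple j (p.2, y))).
have mg : measurable_fun setT g.
  apply: (measurableT_comp mf).
  have mc : measurable_fun [set: measurableTypeR R * n.+1.-tuple R]
      (@cons_pair R n.+1) by exact: measurable_cons_pair.
  apply: (measurableT_comp mc).
  apply/measurable_fun_pairP; split; first exact: measurable_fst.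
  apply: (measurableT_comp (measurable_ins_tuple _)).
  apply/measurable_fun_pairP; split; first exact: measurable_snd.
  exact: measurable_cst.
have := @fubini_tonelli _ _ _ _ _ mu mu g mg (fun _ => f0 _).
rewrite /g /= => <-.
by apply: eq_integral => s _; apply: eq_integral => r _; rewrite ins_tuple_lift0.
Qed.

(** Tonelli applied to indicators. It exhibits [leb] as the image of a product measure for every
    coordinate, so that Fubini for signed functions follows by transport. *)
Lemma leb_insE n (k : 'I_n.+1) (A : set (n.+1.-tuple R)) : measurable A ->
  leb R n.+1 A = pushforward (mu \x leb R n) (ins_tuple k) A.
Proof.
move=> mA; rewrite -[in LHS](setIT A) -integral_indic//.
have mf : measurable_fun [set: n.+1.-tuple R] (fun t => (\1_A t)%:E : \bar R).
  by apply/measurable_EFinP; exact: measurable_indic.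
rewrite (tonelli_ins k)//.
have mi := @measurable_ins_tuple R n k.
transitivity (\int[mu \x leb R n]_p (\1_A (ins_tuple k p))%:E).
  rewrite fubini_tonelli2; last 2 first.
  - exact: measurableT_comp mf mi.
  - by move=> p; rewrite lee_fin.
  by [].
rewrite /pushforward -[in RHS](setIT (_ @^-1` _)) -integral_indic//.
by rewrite -[_ @^-1` _]setTI; exact: mi.
Qed.

Lemma fubini_ins n (k : 'I_n.+1) (f : n.+1.-tuple R -> \bar R) :
  (leb R n.+1).-integrable setT f ->
  (leb R n).-integrable setT (fun y => \int[mu]_s f (ins_tuple k (s, y))) /\
  \int[leb R n.+1]_t f t =
  \int[leb R n]_y \int[mu]_s f (ins_tuple k (s, y)).
Proof.
move=> intf; have mf := measurable_int _ intf.
have mi := @measurable_ins_tuple R n k.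
have mfi := measurableT_comp mf mi.
have mafi : measurable_fun [set: measurableTypeR R * n.-tuple R]
    (abse \o (f \o ins_tuple k)).
  exact: measurableT_comp.
have fin : \int[leb R n]_y \int[mu]_s `|f (ins_tuple k (s, y))| < +oo.
  rewrite -(tonelli_ins k (f := abse \o f))//.
    by move/integrableP : intf => [_].
    exact: measurableT_comp mf.
  by move=> t; exact: abse_ge0.
have intfi : (mu \x leb R n).-integrable setT (f \o ins_tuple k).
  apply/integrableP; split; first exact: mfi.
  apply: le_lt_trans fin; rewrite le_eqVlt; apply/orP; left; apply/eqP.
  exact: (@fubini_tonelli2 _ _ _ _ _ mu (leb R n) _ mafi (fun=> abse_ge0 _)).
have mG := measurable_fubini_G intfi.
split.
  apply/integrableP; split => //; apply: le_lt_trans fin.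
  apply: ge0_le_integral => //.
  - exact: measurableT_comp mG.
  - exact: (@measurable_fun_fubini_tonelli_G _ _ (measurableTypeR R)
      (n.-tuple R) R mu (abse \o (f \o ins_tuple k)) mafi
      (fun=> abse_ge0 _)).
  - move=> y _; apply: le_abse_integral => //.
    exact: measurable_fun_pair1 mfi.
apply: eq_trans; last exact/esym/(integral21_prod_meas1 intfi).
have := integral_pushforward mi mf intfi measurableT; rewrite preimage_setT => <-.
by apply: eq_measure_integral => A mA _; exact: leb_insE.
Qed.

End tonelli.

(** * Boxes, open sets and volumes *)

Section rows.
Context (R : realType).
Local Notation mu := (@lebesgue_measure R).

Lemma open_box n (A : set 'rV[R]_n) (x : 'rV[R]_n) : open A -> A x ->
  exists2 e : R, 0 < e & forall y : 'rV[R]_n, (forall i, `|y 0 i - x 0 i| < e) -> A y.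
Proof.
move=> oA Ax; have /nbhs_ballP[e e0 eA] : nbhs x A by exact: open_nbhs_nbhs.
exists e => // y yx; apply: eA; split => // i j; rewrite ord1 /ball/=.
by rewrite distrC; exact: yx.
Qed.

Lemma row_norm_lt n (x : 'rV[R]_n) (e : R) : `|x| < e -> forall i, `|x 0 i| < e.
Proof.
move=> xe i; have : ball (0 : 'rV[R]_n) e x.
  by rewrite mx_norm_ball /ball_ /= sub0r normrN.
by move=> [_ /(_ 0 i)]; rewrite /ball/= mxE sub0r normrN.
Qed.

Lemma measurable_box n (x : 'I_n -> R) (e : R) :
  measurable [set t : n.-tuple R | forall i, `|tnth t i - x i| < e].
Proof.
rewrite (_ : [set t : n.-tuple R | _] =
    \bigcap_i (fun t : n.-tuple R => tnth t i) @^-1` [set r | `|r - x i| < e]).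
  apply: fin_bigcap_measurable => // i _.
  rewrite -[_ @^-1` _]setTI; apply: measurable_tnth => //.
  rewrite (_ : [set r | _] = ball (x i) e); last first.
    by apply/seteqP; split => r; rewrite /= /ball/= distrC.
  exact: measurable_ball.
by apply/seteqP; split => t /= h i; [move=> _|]; exact: h.
Qed.

(** The sigma-algebra on tuples is a product of Borel ones, while [open] refers to the topology of
    matrices; the link is that an open set is a countable union of boxes with rational centre and
    radius. *)
Lemma open_measurable_row n (A : set 'rV[R]_n) : open A ->
  measurable [set t : n.-tuple R | A (rowt t)].
Proof.
move=> oA.
pose F (q : 'rV[rat]_n * rat) : set (n.-tuple R) :=
  [set t | (forall i, `|tnth t i - ratr (q.1 0 i)| < ratr q.2) /\
    forall y : 'rV[R]_n, (forall i, `|y 0 i - ratr (q.1 0 i)| < ratr q.2) -> A y].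
rewrite (_ : [set t | _] = \bigcup_q F q).
  apply: countable_bigcupT_measurable => [|q]; first exact: countableP.
  rewrite /F.
  have [h|h] := pselect (forall y : 'rV[R]_n,
    (forall i, `|y 0 i - ratr (q.1 0 i)| < ratr q.2) -> A y).
    rewrite (_ : [set t | _] =
      [set t : n.-tuple R | forall i, `|tnth t i - ratr (q.1 0 i)| < ratr q.2]).
      exact: (@measurable_box n (fun i => ratr (q.1 0 i)) (ratr q.2)).
    by apply/seteqP; split => [t []|t].
  rewrite (_ : [set t | _] = set0); first exact: measurable0.
  by apply/seteqP; split => // t [_ /h].
apply/seteqP; split => [t /= At|t [q _ [tq]]]; last first.
  by apply => i; rewrite mxE; exact: tq.
have [e e0 eA] := open_box oA At.
(* With [r < e / 2] and a rational centre within [r] of [t], the box of radius [r] contains [t] and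
   stays in the box of radius [e] about [t]. *)
have [r] := @rat_in_itvoo R 0 (e / 2) ltac:(lra).
rewrite in_itv/= => /andP[r0 re].
have q_ (i : 'I_n) : exists q : rat, `|ratr q - tnth t i| < ratr r.
  have [q] := @rat_in_itvoo R (tnth t i - ratr r) (tnth t i + ratr r) ltac:(lra).
  by rewrite in_itv/= => qi; exists q; rewrite ltr_distl.
pose q := \row_i xget 0 [set q : rat | `|ratr q - tnth t i| < ratr r].
have qP i : `|ratr (q 0 i) - tnth t i| < ratr r.
  by rewrite mxE; case: xgetP => [_ -> //|/(_ _)]; have [z hz] := q_ i; move=> /(_ z).
exists (q, r) => //; split => [i /=|y yq /=]; first by rewrite distrC.
apply: eA => i; rewrite mxE.
rewrite -(subrKA (ratr (q 0 i))) (le_lt_trans (ler_normD _ _))//.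
by have := qP i; have := yq i; rewrite /=; lra.
Qed.

Lemma leb_box n (x : 'I_n -> R) (e : R) : 0 < e ->
  leb R n [set t : n.-tuple R | forall i, `|tnth t i - x i| < e] =
  ((e *+ 2) ^+ n)%:E.
Proof.
move=> e0; elim: n => [|n IHn] in x *.
  rewrite /= /leb0 diracE mem_set ?expr0// => -[]//.
rewrite (leb_insE ord0); last exact: measurable_box.
rewrite /pushforward.
rewrite (_ : _ @^-1` _ = ball (x ord0) e `*`
  [set t : n.-tuple R | forall i, `|tnth t i - x (lift ord0 i)| < e]); last first.
  apply/seteqP; split => -[s t] /= h.
    split => [|i]; first by have := h ord0;
      rewrite tnth_mktuple mxE unlift_none /ball/= distrC.
    by have := h (lift ord0 i); rewrite tnth_mktuple mxE liftK mxE.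
  move=> i; rewrite tnth_mktuple mxE; case: unliftP => [j ->|->].
    by rewrite mxE; exact: h.2.
  by have := h.1; rewrite /ball/= distrC.
rewrite product_measure1E//=; last exact: measurable_box.
  by rewrite (lebesgue_measure_ball _ (ltW e0)) IHn exprS EFinM.
exact: measurable_ball.
Qed.

Lemma open_vol_gt0 n (A : set 'rV[R]_n) : open A -> A !=set0 -> (0 < vol A)%E.
Proof.
move=> oA [x Ax]; have [e e0 eA] := open_box oA Ax.
apply: (@lt_le_trans _ _ ((e *+ 2) ^+ n)%:E).
  by rewrite lte_fin exprn_gt0// mulrn_wgt0.
rewrite -(leb_box (x 0) e0) /vol; apply: le_measure; rewrite ?inE.
- exact: measurable_box.
- exact: open_measurable_row.
- by move=> t h; apply: eA => i; rewrite mxE; exact: h.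
Qed.

Lemma bounded_vol_fin n (A : set 'rV[R]_n) : open A -> bounded_set A ->
  (vol A < +oo)%E.
Proof.
move=> oA [M [_ MA]].
have M1 : M < `|M| + 1 by rewrite (le_lt_trans (ler_norm _))// ltrDl.
apply: (@le_lt_trans _ _ (((`|M| + 2) *+ 2) ^+ n)%:E); last exact: ltry.
have M2 : 0 < `|M| + 2 by rewrite ltr_wpDl.
rewrite -(leb_box (fun=> 0) M2) /vol; apply: le_measure; rewrite ?inE.
- exact: open_measurable_row.
- exact: measurable_box.
move=> t /= /(MA _ M1) h i; rewrite subr0.
have := @row_norm_lt _ (rowt t) (`|M| + 2); move=> /(_ _ i); rewrite mxE; apply.
by apply: (le_lt_trans h); lra.
Qed.

End rows.

Lemma insert_at (R : realType) n (k : 'I_n.+1) (t : R) (y : 'rV[R]_n) :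
  insert_coord k t y 0 k = t.
Proof. by rewrite mxE unlift_none. Qed.

Lemma insert_lift (R : realType) n (k : 'I_n.+1) (t : R) (y : 'rV[R]_n) j :
  insert_coord k t y 0 (lift k j) = y 0 j.
Proof. by rewrite mxE liftK. Qed.

(** [p'] and [k'] are the positions of [p] and [k] once the other one is removed. *)
Lemma insertC (R : realType) n (p k : 'I_n.+2) (p' k' : 'I_n.+1) (u s : R)
    (z : 'rV[R]_n) : k = lift p k' -> p = lift k p' ->
  insert_coord p u (insert_coord k' s z) = insert_coord k s (insert_coord p' u z).
Proof.
move=> kE pE; apply/rowP => j.
case: (unliftP p j) => [j1|] jE.
  rewrite {1}jE insert_lift.
  case: (unliftP k' j1) => [j2|] j1E; last first.
    by rewrite jE j1E insert_at -kE insert_at.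
  rewrite j1E insert_lift.
  case: (unliftP k j) => [i1|] iE; last first.
    move: (congr1 val jE) (congr1 val j1E) (congr1 val kE) (congr1 val iE).
    by rewrite /= /bump; lia.
  rewrite iE insert_lift.
  case: (unliftP p' i1) => [i2|] i1E; last first.
    move: (congr1 val jE) (congr1 val iE) (congr1 val pE) (congr1 val i1E).
    by rewrite /= /bump; lia.
  rewrite i1E insert_lift; congr (z 0 _); apply/val_inj.
  move: (congr1 val jE) (congr1 val j1E) (congr1 val kE) (congr1 val iE)
    (congr1 val pE) (congr1 val i1E).
  by rewrite /= /bump; lia.
by rewrite jE insert_at pE insert_lift insert_at.
Qed.

(** * Affine change of variable on the line *)

Section affine_line.
Context (R : realType).
Local Notation mu := (@lebesgue_measure R).

Lemma measurable_affine (c e : R) :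
  measurable_fun [set: measurableTypeR R]
    (fun u : R => c * u + e : measurableTypeR R).
Proof.
suff : measurable_fun [set: R] (fun u : R => c * u + e) by [].
apply: continuous_measurable_fun => x; apply: cvgD; last exact: cvg_cst.
by apply: cvgM; [exact: cvg_cst|exact: cvg_id].
Qed.

(** Both sides are measures in [A], so uniqueness of Lebesgue measure reduces the claim to intervals
    []x, y]]; for [c < 0] the preimage is closed at the other end, with the same length. *)
Lemma lebesgue_affine (c e : R) (c0 : c != 0) (A : set (measurableTypeR R)) :
  measurable A ->
  mu A = (`|c|%:E * mu ((fun u : R => (c * u + e)%R) @^-1` A))%E.
Proof.
move=> mA.
have c1 : 0 <= `|c| by [].
have mphi := measurable_affine c e.
pose pm := measure_function_pushforward__canonical__measure_function_Measure mu mphi.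
rewrite (@lebesgue_measure_unique R (mscale (NngNum c1) pm))// => X [[x y] /= xy <-{X}].
rewrite /mscale/= /pushforward lebesgue_measure_itv.
have [cp|cn|c00] := ltgtP c 0; last by rewrite c00 eqxx in c0.
- rewrite (_ : _ @^-1` _ = `[(y - e) / c, (x - e) / c[%classic); last first.
    apply/seteqP; split => u /=; rewrite !in_itv/= => /andP[xu uy].
      by rewrite ler_ndivrMr// ltr_ndivlMr//; apply/andP; split; lra.
    rewrite ler_ndivrMr// in xu; rewrite ltr_ndivlMr// in uy.
    by apply/andP; split; lra.
  rewrite lebesgue_measure_itv/= !lte_fin ltr_nM2r ?invr_lt0// ltrD2r.
  case: ifP => _; last by rewrite mule0.
  rewrite -!EFinB -EFinM ltr0_norm//; congr (_%:E).
  by field.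
- rewrite (_ : _ @^-1` _ = `](x - e) / c, (y - e) / c]%classic); last first.
    apply/seteqP; split => u /=; rewrite !in_itv/= => /andP[xu uy].
      by rewrite ler_pdivlMr// ltr_pdivrMr//; apply/andP; split; lra.
    rewrite ler_pdivlMr// in uy; rewrite ltr_pdivrMr// in xu.
    by apply/andP; split; lra.
  rewrite lebesgue_measure_itv/= !lte_fin ltr_pM2r ?invr_gt0// ltrD2r.
  case: ifP => _; last by rewrite mule0.
  rewrite -!EFinB -EFinM gtr0_norm//; congr (_%:E).
  by field.
Qed.

Lemma ge0_integral_affine (c e : R) (g : measurableTypeR R -> \bar R) :
  c != 0 -> measurable_fun setT g -> (forall s, 0 <= g s)%E ->
  (\int[mu]_s g s = `|c|%:E * \int[mu]_u g ((c * u + e)%R))%E.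
Proof.
move=> c0 mg g0; have mphi := measurable_affine c e.
have c1 : 0 <= `|c| by [].
pose pm := measure_function_pushforward__canonical__measure_function_Measure mu mphi.
transitivity (\int[mscale (NngNum c1) pm]_s g s)%E.
  by apply: eq_measure_integral => A mA _; exact: lebesgue_affine.
rewrite ge0_integral_mscale//; congr (_ * _)%E.
by have := ge0_integral_pushforward mphi mu measurableT mg (fun t _ => g0 t).
Qed.

End affine_line.

Section rows.
Context (R : realType).
Local Notation mu := (@lebesgue_measure R).

Lemma dot_continuous n (a : 'rV[R]_n) : continuous (fun x : 'rV[R]_n => dot a x : R).
Proof.
apply: (@continuous_big R _ _ _ xpredT _ 'rV[R]_n (index_enum 'I_n)
  (fun i x => a 0 i * x 0 i)) => [|i _ x]; first by move=> p; apply: cvgD; [exact: cvg_fst|exact: cvg_snd].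
by apply: continuousM; [exact: cst_continuous|exact: coord_continuous].
Qed.

Lemma dot_insert n (k : 'I_n.+1) (a : 'rV[R]_n.+1) (t : R) (y : 'rV[R]_n) :
  dot a (insert_coord k t y) = a 0 k * t + dot (\row_j a 0 (lift k j)) y.
Proof.
rewrite /dot (bigD1_ord k)//= insert_at; congr (_ + _).
by apply: eq_bigr => i _; rewrite insert_lift mxE.
Qed.

Definition null_rows n (A : set 'rV[R]_n) : Prop :=
  (leb R n).-negligible [set t | A (rowt t)].

(** Each line in a direction [k] with a_k != 0 meets the plane in one point; for [a = 0] the set is
    empty. *)
Lemma null_affine n (a : 'rV[R]_n) (b : R) : (a != 0) || (b != 0) ->
  null_rows [set y | dot a y = b].
Proof.
move=> ab; rewrite /null_rows.
have [a0|a0] := eqVneq a 0.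
  rewrite (_ : [set t | _] = set0); first exact: negligible_set0.
  apply/seteqP; split => // t /=; rewrite a0 /dot big1.
    by move=> b0; move: ab; rewrite a0 eqxx -b0 eqxx.
  by move=> i _; rewrite mxE mul0r.
have [k ak] : exists k, a 0 k != 0.
  apply/existsP; rewrite -[X in is_true X]negbK negb_exists; apply/negP => /forallP h.
  by move/eqP: a0; apply; apply/rowP => i; rewrite mxE; apply/eqP; rewrite -[_ == _]negbK h.
case: n => [|n] in a ab a0 k ak *; first by case: (k) => [].
have mA : measurable [set t : n.+1.-tuple R | [set y | dot a y = b] (rowt t)].
  rewrite -[X in measurable X]setCK; apply: measurableC.
  apply: (@open_measurable_row R n.+1 (~` [set y | dot a y = b])).
  apply: closed_openC.
  exact: (closed_comp (fun x _ => @dot_continuous _ a x) (@closed_eq R b)).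
exists [set t : n.+1.-tuple R | [set y | dot a y = b] (rowt t)]; split => //.
rewrite -[X in leb _ _ X](setIT _) -integral_indic//.
rewrite (tonelli_ins k)//; last by apply/measurable_EFinP; exact: measurable_indic.
apply: integral0_eq => y _; rewrite (_ : (fun s => _) = (fun s : R =>
  (\1_([set (b - dot (\row_j a 0 (lift k j)) (rowt y)) / a 0 k]) s)%:E)); last first.
  apply/funext => s; congr (_%:E); rewrite !indicE; congr ((nat_of_bool _)%:R).
  apply/idP/idP; rewrite !inE /= rowt_ins/= dot_insert.
    by move=> <-; rewrite addrK mulrC mulKf.
  by move=> ->; rewrite mulrC divfK// subrK.
rewrite integral_indic//= setIT; exact: lebesgue_measure_set1.
Qed.

End rows.

Section rows_integral.
Context (R : realType).
Local Notation mu := (@lebesgue_measure R).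

Definition rint n (f : 'rV[R]_n -> R) : R := (\int[leb R n]_t f (rowt t))%R.

Definition rintegrable n (f : 'rV[R]_n -> R) : Prop :=
  (leb R n).-integrable setT (fun t => (f (rowt t))%:E).

Lemma integral_onE n (A : set 'rV[R]_n) (f : 'rV[R]_n -> R) :
  integral_on A f = rint (f \_ A).
Proof.
rewrite /integral_on Rintegral_mkcond /rint; apply: eq_Rintegral => t _.
by rewrite !patchE.
Qed.

Lemma eq_rint n (f g : 'rV[R]_n -> R) : f =1 g -> rint f = rint g.
Proof. by move=> fg; apply: eq_Rintegral => t _; exact: fg. Qed.

Lemma rintegrable_sum n (I : Type) (s : seq I) (f : I -> 'rV[R]_n -> R) :
  (forall i, rintegrable (f i)) -> rintegrable (fun x => \sum_(i <- s) f i x).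
Proof.
move=> fi; rewrite /rintegrable.
under eq_fun do rewrite -sumEFin.
by apply: integrable_sum => // i _; exact: fi.
Qed.

Lemma rint_sum n (I : Type) (s : seq I) (f : I -> 'rV[R]_n -> R) :
  (forall i, rintegrable (f i)) ->
  rint (fun x => \sum_(i <- s) f i x) = \sum_(i <- s) rint (f i).
Proof.
move=> fi; elim: s => [|i s IHs].
  rewrite big_nil /rint.
  under eq_Rintegral do rewrite big_nil.
  by rewrite /Rintegral integral0.
rewrite big_cons -IHs /rint -RintegralD//.
- by apply: eq_Rintegral => t _; rewrite big_cons.
- exact: fi.
- exact: rintegrable_sum.
Qed.

Lemma rintegrableZ n (c : R) (f : 'rV[R]_n -> R) :
  rintegrable f -> rintegrable (fun x => c * f x).
Proof.
by move=> fi; rewrite /rintegrable; under eq_fun do rewrite EFinM; exact: integrableZl.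
Qed.

Lemma rintZ n (c : R) (f : 'rV[R]_n -> R) :
  rintegrable f -> rint (fun x => c * f x) = c * rint f.
Proof. by move=> fi; rewrite /rint RintegralZl. Qed.

Lemma eq_rint_ae n (f g : 'rV[R]_n -> R) : rintegrable f -> rintegrable g ->
  null_rows [set x | f x <> g x] -> rint f = rint g.
Proof.
move=> fi gi fg; rewrite /rint /Rintegral; congr fine.
apply: ae_eq_integral => //; [exact: measurable_int fi|exact: measurable_int gi|].
apply: negligibleS fg => t /= h fgt; apply: h => _.
by rewrite fgt.
Qed.

(** [Rintegral] takes [fine] of an extended integral, so a slice with infinite integral is read as
    0. Such slices form a null set, which reconciles the real statement with [fubini_ins]. *)
Lemma rint_fubini n (k : 'I_n.+1) (f : 'rV[R]_n.+1 -> R) : rintegrable f ->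
  let g y := (\int[mu]_s f (insert_coord k s y))%R in
  rintegrable g /\ rint f = rint g.
Proof.
move=> fi g; have [Gi GE] := fubini_ins k fi.
set G := (G in _.-integrable _ G) in Gi GE.
have gG : (fun t => (g (rowt t))%:E) = (fun t => (fine (G t))%:E).
  apply/funext => t; congr (_%:E); rewrite /g /G /Rintegral; congr fine.
  by apply: eq_integral => s _; rewrite rowt_ins.
have mG := measurable_int _ Gi.
have mfG : measurable_fun setT (fun t => (fine (G t))%:E).
  apply/measurable_EFinP; exact: measurableT_comp.
have aeG : ae_eq (leb R n) setT G (fun t => (fine (G t))%:E).
  have := integrable_ae measurableT Gi; apply: filterS => t /= h _.
  by rewrite fineK// h.
split.
  rewrite /rintegrable gG; apply/integrableP; split => //.
  rewrite -(@ae_eq_integral _ _ _ _ _ (fun t => `|(fine (G t))%:E|)%E (abse \o G))//.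
  - by move/integrableP : Gi => [].
  - exact: measurableT_comp.
  - exact: measurableT_comp.
  - by apply: filterS aeG => t /= h /h ->.
rewrite /rint /Rintegral GE; congr fine; rewrite gG.
exact: ae_eq_integral.
Qed.

Lemma continuous_measurable_row n (A : set 'rV[R]_n) (f : 'rV[R]_n -> R) :
  open A -> (forall x, A x -> {for x, continuous f}) ->
  measurable_fun [set t : n.-tuple R | A (rowt t)] (fun t => f (rowt t)).
Proof.
move=> oA cf mA; apply: (measurability _ (RGenOpens.measurableE R)) => //.
move=> _ [_ [a [b ->] <-]].
apply: (@open_measurable_row R n (A `&` f @^-1` `]a, b[)).
rewrite openE => x [Ax fx].
apply: filterI; first by apply: open_nbhs_nbhs.
by apply: cf => //; apply: open_nbhs_nbhs; split => //; exact: interval_open.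
Qed.

Lemma rintegrable_patch n (A : set 'rV[R]_n) (f : 'rV[R]_n -> R) (M : R) :
  open A -> bounded_set A -> (forall x, A x -> {for x, continuous f}) ->
  (forall x, A x -> `|f x| <= M) -> rintegrable (f \_ A).
Proof.
move=> oA bA cf fM; rewrite /rintegrable.
have mA := open_measurable_row oA.
suff : (leb R n).-integrable [set t : n.-tuple R | A (rowt t)] (fun t => (f (rowt t))%:E).
  move=> /(integrable_mkcond _ mA); rewrite (_ : _ \_ _ = fun t => ((f \_ A) (rowt t))%:E)//.
  apply/funext => t; rewrite !patchE.
  have -> : (t \in [set t : n.-tuple R | A (rowt t)]) = (rowt t \in A).
    by apply/idP/idP; rewrite !inE.
  by case: ifP.
apply: measurable_bounded_integrable => //.
- exact: bounded_vol_fin.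
- exact: continuous_measurable_row.
- exists M; split; first exact: num_real.
  by move=> y My t At; exact: le_trans (fM _ At) (ltW My).
Qed.

End rows_integral.

(** * Planes as graphs over a coordinate plane *)

Section graphs.
Context (R : realType).
Local Notation mu := (@lebesgue_measure R).

(** [graph_point] with an arbitrary eliminated coordinate instead of the pivot. *)
Definition graph_at d (k : 'I_d.+1) (h : 'rV[R]_d.+1 * R) (y : 'rV[R]_d) : 'rV[R]_d.+1 :=
  insert_coord k ((h.2 - dot h.1 (insert_coord k 0 y)) / h.1 0 k) y.

Lemma dot_graph_at d (k : 'I_d.+1) (h : 'rV[R]_d.+1 * R) (y : 'rV[R]_d) : h.1 0 k != 0 ->
  dot h.1 (graph_at k h y) = h.2.
Proof.
by move=> hk; rewrite /graph_at !dot_insert mulr0 add0r mulrC divfK// subrK.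
Qed.

Lemma hyperplane_insert d (k : 'I_d.+1) (h : 'rV[R]_d.+1 * R) t (y : 'rV[R]_d) : h.1 0 k != 0 ->
  dot h.1 (insert_coord k t y) = h.2 -> insert_coord k t y = graph_at k h y.
Proof.
move=> hk; rewrite /graph_at !dot_insert mulr0 add0r => <-.
by rewrite addrK mulrC mulKf.
Qed.

Lemma insert_coord_inj d (k : 'I_d.+1) (y : 'rV[R]_d) : injective (insert_coord k ^~ y).
Proof. by move=> s t /(congr1 (fun x : 'rV[R]_d.+1 => x 0 k)); rewrite !insert_at. Qed.

(* The same plane, possibly with the opposite orientation. *)
Definition same_plane d (h h' : 'rV[R]_d.+1 * R) : Prop :=
  exists2 c, c != 0 & h' = (c *: h.1, c * h.2).

(** On the graph of [h] the equation of [h'] becomes affine in [y]; it degenerates only if [h'] is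
    [c] times [h], with [c] the ratio of the k-th coefficients. *)
Lemma null_graph_at d (k : 'I_d.+1) (h h' : 'rV[R]_d.+1 * R) :
  h.1 0 k != 0 -> h'.1 != 0 -> ~ same_plane h h' ->
  null_rows [set y | dot h'.1 (graph_at k h y) = h'.2].
Proof.
move=> hk h'0 hh'; pose c := h'.1 0 k / h.1 0 k.
pose a := \row_j h'.1 0 (lift k j) - c *: \row_j h.1 0 (lift k j).
have := @null_affine R d a (h'.2 - c * h.2); rewrite /null_rows => H.
apply: negligibleS (H _) => [t /=|].
  rewrite /graph_at !dot_insert mulr0 add0r /a => <-.
  rewrite [X in X = _](_ : _ = dot (\row_j h'.1 0 (lift k j)) (rowt t) -
     c * dot (\row_j h.1 0 (lift k j)) (rowt t)); first by rewrite /c; field.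
  rewrite /dot mulr_sumr -sumrB; apply: eq_bigr => i _; rewrite !mxE; ring.
apply/contraT; rewrite negb_or !negbK => /andP[/eqP a0 /eqP b0]; exfalso; apply: hh'.
have h'E : h'.1 = c *: h.1.
  apply/rowP => j; case: (unliftP k j) => [i ->|->]; rewrite mxE; last by rewrite divfK.
  by have /rowP/(_ i) := a0; rewrite !mxE => /eqP; rewrite subr_eq0 => /eqP.
exists c; first by apply: contra_neq h'0 => c0; rewrite h'E c0 scale0r.
by apply/eqP; rewrite [X in X == _]surjective_pairing xpair_eqE h'E eqxx -subr_eq0 b0 eqxx.
Qed.

(* The surface element dy / |a_k| does not depend on the coordinate k that is
   eliminated: the two eliminations differ by an affine change of one variable. *)
Lemma ge0_integral_graph_at d (k p : 'I_d.+1) (h : 'rV[R]_d.+1 * R) (F : 'rV[R]_d.+1 -> \bar R) :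
  h.1 0 k != 0 -> h.1 0 p != 0 -> (forall x, 0 <= F x)%E ->
  measurable_fun [set: d.-tuple R] (fun t => F (graph_at k h (rowt t))) ->
  measurable_fun [set: d.-tuple R] (fun t => F (graph_at p h (rowt t))) ->
  (`|h.1 0 k|^-1%:E * \int[leb R d]_t F (graph_at k h (rowt t)) =
   `|h.1 0 p|^-1%:E * \int[leb R d]_t F (graph_at p h (rowt t)))%E.
Proof.
move=> hk hp F0 mk mp.
have [->//|kp] := eqVneq k p.
case: d => [|d] in k p h F hk hp F0 mk mp kp *; first by move: kp; rewrite !ord1.
case: (unliftP p k) kp => [k' kE|->]; last by rewrite eqxx.
case: (unliftP k p) => [p' pE|->]; last by rewrite eqxx.
move=> _.
have mfib (q : 'I_d.+2) (q' : 'I_d.+1) :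
    measurable_fun [set: d.+1.-tuple R] (fun t => F (graph_at q h (rowt t))) ->
    measurable_fun [set: measurableTypeR R * d.-tuple R]
      (fun u => F (graph_at q h (rowt (ins_tuple q' u)))).
  by move=> mq; exact: (measurableT_comp mq (measurable_ins_tuple q')).
have Ek := tonelli_ins p' mk (fun t => F0 _).
have Ep := tonelli_ins k' mp (fun t => F0 _).
cbv beta in Ek, Ep; rewrite Ek Ep {Ek Ep}.
have mk' := mfib k p' mk; have mp' := mfib p k' mp.
have mGk := @measurable_fun_fubini_tonelli_G _ _ _ _ _ mu _ mk' (fun=> F0 _).
have mGp := @measurable_fun_fubini_tonelli_G _ _ _ _ _ mu _ mp' (fun=> F0 _).
have Z (q : R) (G : d.-tuple R -> \bar R) : measurable_fun setT G ->
    (forall t, 0 <= G t)%E -> 0 <= q ->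
    (q%:E * \int[leb R d]_t G t = \int[leb R d]_t (q%:E * G t))%E.
  by move=> mG G0 q0; rewrite ge0_integralZl_EFin.
have hk0 : 0 <= `|h.1 0 k|^-1 by rewrite invr_ge0.
have hp0 : 0 <= `|h.1 0 p|^-1 by rewrite invr_ge0.
have Zk := Z _ _ mGk (fun t => integral_ge0 _ (fun s _ => F0 _)) hk0.
have Zp := Z _ _ mGp (fun t => integral_ge0 _ (fun s _ => F0 _)) hp0.
rewrite /fubini_G in Zk Zp; cbv beta in Zk, Zp; rewrite Zk Zp {Zk Zp}.
apply: eq_integral => t _.
(* With the other coordinates [z] fixed, a point of the plane satisfies x_p = c x_k + e. *)
pose c := - (h.1 0 k / h.1 0 p).
pose z := rowt t.
pose e := (h.2 - dot h.1 (insert_coord p 0 (insert_coord k' 0 z))) / h.1 0 p.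
have c0 : c != 0 by rewrite oppr_eq0 mulf_neq0// invr_eq0.
have mg : measurable_fun [set: measurableTypeR R]
    (fun u => F (graph_at k h (rowt (ins_tuple p' (u, t))))).
  exact: measurable_fun_pair1 mk'.
rewrite (ge0_integral_affine e c0 mg)// muleA -EFinM.
have -> : `|h.1 0 k|^-1 * `|c| = `|h.1 0 p|^-1.
  by rewrite /c normrN normrM normfV mulrA mulVf ?normr_eq0// mul1r.
congr (_ * _)%E; apply: eq_integral => s _; congr F.
rewrite !rowt_ins/= -/z.
have -> : c * s + e = (h.2 - dot h.1 (insert_coord p 0 (insert_coord k' s z))) / h.1 0 p.
  rewrite /c /e !(dot_insert p) !(dot_insert k') !mxE -kE; by field.
set u := (X in insert_coord p' X z).
transitivity (insert_coord p u (insert_coord k' s z)) => //.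
rewrite (insertC u s z kE pE); apply/esym/hyperplane_insert => //.
by rewrite -(insertC u s z kE pE); exact: dot_graph_at.
Qed.

End graphs.

(** * Lines through a polytopal mesh *)

(** For a positive slope the bound on [S] bounds [sup S]; for a negative one the value at [sup S]
    lies below the value at any point of [S]. It serves both for the ends of a slice of a cell and
    for the limiter. *)
Lemma affine_sup_le (R : realType) (S : set R) (A B C : R) :
  S !=set0 -> has_ubound S -> (forall t, S t -> A * t + B <= C) ->
  A * sup S + B <= C.
Proof.
move=> [t0 S0] uS h; have [A0|A0] := leP 0 A.
  have [A00|An0] := eqVneq A 0; first by have := h _ S0; rewrite A00 !mul0r.
  have Ap : 0 < A by rewrite lt_def An0.
  suff : sup S <= (C - B) / A by rewrite ler_pdivlMr//; lra.
  apply: ge_sup; first by exists t0.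
  by move=> t /h; rewrite ler_pdivlMr//; lra.
have : t0 <= sup S by apply: ub_le_sup.
have := h _ S0; nra.
Qed.

Lemma affine_inf_le (R : realType) (S : set R) (A B C : R) :
  S !=set0 -> has_lbound S -> (forall t, S t -> A * t + B <= C) ->
  A * inf S + B <= C.
Proof.
move=> [t0 S0] lS h; rewrite /inf mulrN -mulNr.
apply: affine_sup_le.
- by exists (- t0), t0.
- by apply/has_lb_ubN.
- by move=> _ [t /h tS <-]; rewrite mulrNN.
Qed.

Lemma near_seq (T : topologicalType) (I : eqType) (s : seq I) (x : T)
    (Q : I -> T -> Prop) :
  (forall i, i \in s -> \forall z \near x, Q i z) ->
  \forall z \near x, forall i, i \in s -> Q i z.
Proof.
elim: s => [|i s IHs] h; first by near=> z => i; rewrite in_nil.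
have h1 := h i (mem_head _ _).
have h2 := IHs (fun j js => h j (mem_behead (s := i :: s) js)).
near=> z => j; rewrite in_cons => /orP[/eqP ->|js].
  by near: z.
by move: j js; near: z.
Unshelve. all: end_near. Qed.

Lemma seq_eps (R : realType) (I : eqType) (s : seq I) (Q : I -> R -> Prop) :
  (forall i, i \in s -> exists2 e, 0 < e & forall r, 0 <= r <= e -> Q i r) ->
  exists2 e, 0 < e & forall r, 0 <= r <= e -> forall i, i \in s -> Q i r.
Proof.
elim: s => [|i s IHs] h; first by exists 1.
have [e e0 he] := h i (mem_head _ _).
have [f f0 hf] := IHs (fun j js => h j (mem_behead (s := i :: s) js)).
exists (Num.min e f); first by rewrite lt_min e0.
move=> r /andP[r0]; rewrite le_min => /andP[re rf] j.
by rewrite in_cons => /orP[/eqP ->|js]; [apply: he; rewrite r0|apply: hf => //; rewrite r0].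
Qed.

Section dot.
Context (R : realType) (n : nat).
Implicit Types x y z a : 'rV[R]_n.

Lemma dotDr a x y : dot a (x + y) = dot a x + dot a y.
Proof. by rewrite /dot -big_split; apply: eq_bigr => i _; rewrite mxE mulrDr. Qed.

Lemma dotZr a c x : dot a (c *: x) = c * dot a x.
Proof. by rewrite /dot mulr_sumr; apply: eq_bigr => i _; rewrite mxE mulrCA. Qed.

Lemma dotC x y : dot x y = dot y x.
Proof. by apply: eq_bigr => i _; rewrite mulrC. Qed.

Lemma dotZl a c x : dot (c *: a) x = c * dot a x.
Proof. by rewrite dotC dotZr dotC. Qed.

Lemma dotNr a x : dot a (- x) = - dot a x.
Proof. by rewrite -scaleN1r dotZr mulN1r. Qed.

Lemma dotBr a x y : dot a (x - y) = dot a x - dot a y.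
Proof. by rewrite dotDr dotNr. Qed.

Lemma dotBl a x y : dot (x - y) a = dot x a - dot y a.
Proof. by rewrite dotC dotBr !(dotC a). Qed.

Lemma dot0r a : dot a 0 = 0.
Proof. by rewrite -(scale0r 0) dotZr mul0r. Qed.

Lemma dot_ge0 x : 0 <= dot x x.
Proof. by apply: sumr_ge0 => i _; rewrite -expr2 sqr_ge0. Qed.

Lemma dot_gt0 x : x != 0 -> 0 < dot x x.
Proof.
move=> x0; rewrite lt_def dot_ge0 andbT; apply: contra_neq x0 => /eqP.
rewrite psumr_eq0 => [/allP h|i _]; last by rewrite -expr2 sqr_ge0.
apply/rowP => i; rewrite mxE.
by have := h i (mem_index_enum _); rewrite /= mulf_eq0 orbb => /eqP.
Qed.

Lemma sqr_enorm x : enorm x ^+ 2 = dot x x.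
Proof. by rewrite sqr_sqrtr// dot_ge0. Qed.

Lemma enorm_ge0 x : 0 <= enorm x. Proof. exact: sqrtr_ge0. Qed.

Lemma enorm_gt0 x : x != 0 -> 0 < enorm x.
Proof. by move=> x0; rewrite sqrtr_gt0 dot_gt0. Qed.

Lemma enormZ c x : enorm (c *: x) = `|c| * enorm x.
Proof.
by rewrite /enorm dotZl dotZr mulrA -expr2 sqrtrM ?sqr_ge0// sqrtr_sqr.
Qed.

Lemma enorm_normalize x : x != 0 -> enorm ((enorm x)^-1 *: x) = 1.
Proof.
move=> x0; rewrite enormZ normfV ger0_norm ?enorm_ge0// mulVf//.
by rewrite gt_eqF// enorm_gt0.
Qed.

Lemma nbhs_line x v (U : set 'rV[R]_n) : nbhs x U ->
  exists2 e : R, 0 < e & forall r, `|r| <= e -> U (x + r *: v).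
Proof.
move=> Ux.
have : \forall r \near (0 : R), U (x + r *: v).
  have cf : continuous (fun r : R => x + r *: v).
    move=> r; apply: cvgD; first exact: cvg_cst.
    by apply: cvgZ; [exact: cvg_id|exact: cvg_cst].
  by have := cf 0 U; rewrite /= scale0r addr0; apply.
move=> /nbhs_ballP[e /= e0 he]; exists (e / 2); first by rewrite divr_gt0.
move=> r re; apply: he; rewrite /ball/= sub0r normrN.
by apply: le_lt_trans re _; rewrite gtr_pMr// invf_lt1// ltr1n.
Qed.

End dot.

Section cells.
Context (R : realType) (d : nat).
Local Notation n := d.+1.
Implicit Types (h : 'rV[R]_n * R) (fs : seq ('rV[R]_n * R)).

Lemma insert_addr (k : 'I_n) (t s : R) (y : 'rV[R]_d) :
  insert_coord k (t + s) y = insert_coord k t y + s *: delta_mx 0 k.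
Proof.
apply/rowP => j; rewrite !mxE eqxx/=; case: unliftP => [i ->|->].
  by rewrite eq_sym (negbTE (neq_lift _ _)) mulr0 addr0.
by rewrite eqxx mulr1.
Qed.

Lemma dot_insert_addr h (k : 'I_n) (t s : R) (y : 'rV[R]_d) :
  dot h.1 (insert_coord k (t + s) y) = dot h.1 (insert_coord k t y) + s * h.1 0 k.
Proof. by rewrite !dot_insert; ring. Qed.

Lemma near_dot_lt h x : dot h.1 x < h.2 -> nbhs x [set z | dot h.1 z < h.2].
Proof.
move=> hx; apply: (@dot_continuous _ _ h.1 x [set r | r < h.2]).
by apply: open_nbhs_nbhs; split => //; exact: open_lt.
Qed.

Lemma near_dot_neq h x : dot h.1 x != h.2 -> nbhs x [set z | dot h.1 z != h.2].
Proof.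
move=> hx; apply: (@dot_continuous _ _ h.1 x [set r | r != h.2]).
by apply: open_nbhs_nbhs; split => //; exact: open_neq.
Qed.

Lemma cell_closed fs : closed (cell fs).
Proof.
rewrite (_ : cell fs = \bigcap_(h in [set` fs]) [set x | dot h.1 x <= h.2]).
  apply: closed_bigI => h _.
  exact: (closed_comp (fun x _ => @dot_continuous _ _ h.1 x) (@closed_le R h.2)).
by apply/seteqP; split => x hx h; exact: hx.
Qed.

Lemma cell_interior_lt fs h x : interior (cell fs) x -> h \in fs -> h.1 != 0 ->
  dot h.1 x < h.2.
Proof.
move=> xK hfs h0; have := interior_subset xK => /(_ h hfs) hx.
rewrite lt_neqAle hx andbT; apply/negP => /eqP xE.
have [e e0 /(_ e) he] := nbhs_line h.1 xK.
have := he ltac:(by rewrite gtr0_norm) h hfs.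
rewrite dotDr dotZr xE; have := dot_gt0 h0; nra.
Qed.

(** A face with zero normal may occur in the list; it is a constant inequality, true everywhere as
    soon as it is true at [x]. *)
Lemma lt_cell_interior fs x : cell fs x ->
  (forall h, h \in fs -> h.1 != 0 -> dot h.1 x < h.2) -> interior (cell fs) x.
Proof.
move=> cx hx; rewrite /interior/=.
apply: (@near_seq _ _ fs x (fun h z => dot h.1 z <= h.2)) => h hfs.
have [h0|h0] := eqVneq h.1 0.
  near=> z; have := cx h hfs; rewrite h0 /dot.
  by rewrite !big1// => i _; rewrite mxE mul0r.
apply: filterS (_ : nbhs x [set z | dot h.1 z < h.2]) => [z|]; first exact: ltW.
apply: near_dot_lt; exact: hx.
Unshelve. all: end_near. Qed.

End cells.

Section line.
Context (R : realType) (d : nat) (k : 'I_d.+1) (y : 'rV[R]_d).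
Local Notation n := d.+1.
Local Notation X t := (insert_coord k t y).
Implicit Types (h : 'rV[R]_n * R) (fs : seq ('rV[R]_n * R)).

(* No line of the family lies in a plane of the list or meets two of them at
   the same point. *)
Definition generic_line fs : Prop := forall t h h', h \in fs -> h' \in fs ->
  h.1 != 0 -> h'.1 != 0 -> dot h.1 (X t) = h.2 -> dot h'.1 (X t) = h'.2 ->
  h.1 0 k != 0 /\ same_plane h h'.

Lemma generic_lineS fs fs' : {subset fs <= fs'} ->
  generic_line fs' -> generic_line fs.
Proof. by move=> ss g t h h' /ss hf /ss hf'; exact: g. Qed.

(** If no tight face rises in the direction [s], all inequalities survive a short step: tight ones
    do not increase and slack ones have room. *)
Lemma line_exit fs (s t : R) : cell fs (X t) ->
  (forall e, 0 < e -> ~ cell fs (X (t + s * e))) ->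
  exists h, [/\ h \in fs, h.1 != 0, dot h.1 (X t) = h.2 & 0 < s * h.1 0 k].
Proof.
move=> ct hs; apply: contrapT => hn.
have [|e e0 he] := @seq_eps R _ fs (fun h r => dot h.1 (X (t + s * r)) <= h.2).
  move=> h hf; have := ct h hf; rewrite le_eqVlt => /orP[/eqP tight|gap].
    exists 1 => // r /andP[r0 _]; rewrite dot_insert_addr tight gerDl.
    have [h0|h0] := eqVneq h.1 0; first by rewrite h0 mxE mulr0.
    suff : s * h.1 0 k <= 0 by nra.
    by rewrite leNgt; apply/negP => sh; apply: hn; exists h.
  have g0 : 0 < h.2 - dot h.1 (X t) by rewrite subr_gt0.
  have q0 : 0 < `|s * h.1 0 k| + 1 by rewrite ltr_wpDl.
  (* The slack over a strict bound of the slope; adding 1 keeps the denominator positive. *)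
  exists ((h.2 - dot h.1 (X t)) / (`|s * h.1 0 k| + 1)); first by rewrite divr_gt0.
  move=> r /andP[r0]; rewrite ler_pdivlMr// dot_insert_addr.
  have := ler_norm (s * h.1 0 k); nra.
by apply: (hs e e0) => h hf; apply: he => //; rewrite ltW//=.
Qed.

(** On a generic line a slice is empty or a nondegenerate interval. The empty slice is encoded by
    [ab.1 = ab.2], which makes its two end point terms cancel. *)
Lemma line_cell fs : interior (cell fs) !=set0 -> bounded_set (cell fs) ->
  generic_line fs ->
  exists ab : R * R,
    [/\ ab.1 <= ab.2,
        forall t, interior (cell fs) (X t) <-> ab.1 < t < ab.2,
        ab.1 < ab.2 -> forall t, cell fs (X t) <-> ab.1 <= t <= ab.2 &
        ab.1 = ab.2 -> forall t, ~ cell fs (X t)].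
Proof.
move=> [x0 x0K] [M [_ bM]] gen.
have [[t0 ct0]|nc] := pselect (exists t, cell fs (X t)); last first.
  exists (0, 0) => /=; split => //; last by move=> _ t ct; apply: nc; exists t.
    move=> t; split; last by move=> /andP[? ?]; lra.
    by move=> /interior_subset ct; case: nc; exists t.
  by rewrite ltxx.
pose S := [set t | cell fs (X t)].
have S0 : S !=set0 by exists t0.
have SM t : S t -> `|t| < `|M| + 2.
  move=> St; have XM : `|X t| <= `|M| + 1.
    by apply: bM => //; rewrite (le_lt_trans (ler_norm _))// ltrDl.
  have XM2 : `|X t| < `|M| + 2 by lra.
  by have := row_norm_lt XM2 k; rewrite insert_at.
have uS : has_ubound S by exists (`|M| + 2) => t /SM; have := ler_norm t; lra.
have lS : has_lbound S.
  by exists (- (`|M| + 2)) => t /SM; rewrite ltr_norml => /andP[]; lra.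
pose a := inf S; pose b := sup S.
have Sb : S b.
  move=> h hf; rewrite dot_insert; apply: affine_sup_le => // t St.
  by rewrite -dot_insert; exact: St.
have Sa : S a.
  move=> h hf; rewrite dot_insert; apply: affine_inf_le => // t St.
  by rewrite -dot_insert; exact: St.
have Sab t : S t <-> a <= t <= b.
  split=> [St|/andP[at_ tb] h hf].
    by rewrite ge_inf//= ub_le_sup.
  have := Sa h hf; have := Sb h hf; rewrite !dot_insert.
  have [h0|h0] := leP 0 (h.1 0 k); nra.
(* If the slice were one point, the line would leave through two faces of opposite slopes;
   genericity puts both in one plane, with [c < 0], and the cell would have no interior. *)
have ab : a < b.
  have : a <= b by have := (Sab a).1 Sa => /andP[].
  rewrite le_eqVlt => /orP[/eqP abE|//]; exfalso.
  have [||h [hf h0 hE hk]] := @line_exit fs 1 b => //.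
    by move=> e e0 /Sab; rewrite mul1r => /andP[_]; lra.
  have [||h' [h'f h'0 h'E h'k]] := @line_exit fs (-1) b => //.
    by move=> e e0 /Sab; rewrite -abE => /andP[+ _]; lra.
  have [_ [c c0 h'h]] := gen b h h' hf h'f h0 h'0 hE h'E.
  have := cell_interior_lt x0K hf h0; have := cell_interior_lt x0K h'f h'0.
  move: h'k; rewrite h'h/= mxE dotZl mul1r in hk * => ck l1 l2.
  have : c < 0 by nra.
  by nra.
have int t : interior (cell fs) (X t) <-> a < t < b.
  split=> [tK|/andP[at_ tb]].
    have [e e0 he] := nbhs_line (delta_mx 0 k) tK.
    have /Sab/andP[_ h1] : S (t + e).
      by rewrite /S/= insert_addr; apply: he; rewrite gtr0_norm.
    have /Sab/andP[h2 _] : S (t + - e).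
      by rewrite /S/= insert_addr; apply: he; rewrite normrN gtr0_norm.
    by apply/andP; split; lra.
  apply: lt_cell_interior; first by apply/Sab; rewrite !ltW.
  move=> h hf h0; have St : S t by apply/Sab; rewrite !ltW.
  (* A face tight strictly between the ends has nonzero slope by genericity, so it would be violated
     at one of them. *)
  rewrite lt_neqAle (St h hf) andbT; apply/negP => /eqP hE.
  have [hk _] := gen t h h hf hf h0 h0 hE hE.
  have := Sa h hf; have := Sb h hf; move: hE; rewrite !dot_insert.
  by have [hp|hn|hz] := ltgtP (h.1 0 k) 0; [nra|nra|rewrite hz eqxx in hk].
exists (a, b) => /=; split => //; first exact: ltW.
by move=> abE; move: ab; rewrite abE ltxx.
Qed.

End line.

(** * Cells on the two sides of a point of a generic line *)

Section boundary.
Context (R : realType) (d : nat) (k : 'I_d.+1) (y : 'rV[R]_d).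
Local Notation n := d.+1.
Local Notation X t := (insert_coord k t y).
Context (D : set 'rV[R]_n) (T : finType) (faces : T -> seq ('rV[R]_n * R))
  (hs : seq ('rV[R]_n * R)).
Hypotheses (oD : open D) (bD : bounded_set D) (meshD : mesh_of D faces)
  (hs0 : forall h, h \in hs -> h.1 != 0)
  (bdryhs : bdry D `<=` [set x | exists2 h, h \in hs & hyperplane h x]).
Implicit Types (h : 'rV[R]_n * R).
Local Notation cl K := (cell (faces K)).

Definition mesh_planes : seq ('rV[R]_n * R) :=
  hs ++ flatten [seq faces K | K <- enum T].

Hypothesis gen : generic_line k y mesh_planes.

Lemma faces_mesh_planes K h : h \in faces K -> h \in mesh_planes.
Proof.
move=> hK; rewrite mem_cat; apply/orP; right; apply/flatten_mapP.
by exists K => //; rewrite mem_enum.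
Qed.

Lemma cell_closure K x : cl K x -> closure D x.
Proof. by case: meshD => _ _ <- cK; exists K. Qed.

Lemma closure_cell x : closure D x -> exists K, cl K x.
Proof. by case: meshD => _ _ <- [K _ cK]; exists K. Qed.

Lemma closure_bounded : bounded_set (closure D).
Proof.
case: bD => M [Mr MD]; exists M; split => // r Mr' x cx.
have cb : closed [set z : 'rV[R]_n | `|z| <= r].
  exact: (closed_comp (fun x _ => @norm_continuous _ _ x) (@closed_le R r)).
have sDB : D `<=` [set z : 'rV[R]_n | `|z| <= r] by move=> z Dz; exact: MD.
by have := closure_subset sDB cx; rewrite -((closure_id _).1 cb).
Qed.

Lemma cell_bounded K : bounded_set (cl K).
Proof.
by case: closure_bounded => M [Mr MD]; exists M; split => // r /MD h x /cell_closure; exact: h.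
Qed.

Lemma mesh_line K : exists ab : R * R,
    [/\ ab.1 <= ab.2,
        forall t, interior (cl K) (X t) <-> ab.1 < t < ab.2,
        ab.1 < ab.2 -> forall t, cl K (X t) <-> ab.1 <= t <= ab.2 &
        ab.1 = ab.2 -> forall t, ~ cl K (X t)].
Proof.
apply: line_cell; first by case: meshD => + _ _; apply.
  exact: cell_bounded.
by apply: generic_lineS gen; exact: faces_mesh_planes.
Qed.

(** For [s = 1] or [s = -1] the cell occupies the line just after or just before [t]; by convexity a
    single [e] is enough. *)
Definition side (s : R) (K : T) (t : R) : Prop :=
  cl K (X t) /\ exists2 e, 0 < e & cl K (X (t + s * e)).

Lemma side_le s K t e r : cl K (X t) -> cl K (X (t + s * e)) -> 0 <= r <= e ->
  cl K (X (t + s * r)).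
Proof.
move=> c1 c2 /andP[r0 re] h hK; have := c1 h hK; have := c2 h hK.
rewrite !dot_insert_addr ![s * _]mulrC -!mulrA; set q := s * _.
by have [q0|q0] := leP 0 q; nra.
Qed.

Lemma cell_side s K t : s = 1 \/ s = -1 -> cl K (X t) ->
  ~ side s K t -> side (- s) K t.
Proof.
move=> s1 ct ns; split=> //.
have [ab [ab1 _ ab2 ab3]] := mesh_line K.
have abl : ab.1 < ab.2.
  by rewrite lt_neqAle ab1 andbT; apply/eqP => /ab3/(_ t).
have /andP[at_ tb] := (ab2 abl t).1 ct.
have [s1E|s1E] := s1; rewrite s1E in ns *.
  have [tb'|bt] := ltP t ab.2.
    exfalso; apply: ns; split=> //; exists (ab.2 - t); first by rewrite subr_gt0.
    by apply/(ab2 abl); rewrite mul1r addrC subrK ab1 lexx.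
  exists (t - ab.1); first by rewrite subr_gt0; apply: lt_le_trans bt.
  by apply/(ab2 abl); rewrite mulN1r opprB addrC subrK lexx.
have [at'|ta] := ltP ab.1 t.
  exfalso; apply: ns; split=> //; exists (t - ab.1); first by rewrite subr_gt0.
  by apply/(ab2 abl); rewrite mulN1r opprB addrC subrK ab1 lexx.
exists (ab.2 - t); first by rewrite subr_gt0; apply: le_lt_trans abl.
by apply/(ab2 abl); rewrite opprK mul1r addrC subrK lexx ab1.
Qed.

(* Cells on the same side of t overlap. *)
Lemma side_inj s K L t : s = 1 \/ s = -1 -> side s K t -> side s L t -> K = L.
Proof.
move=> s1 [cK [e e0 eK]] [cL [f f0 fL]]; apply/eqP/contraT => KL; exfalso.
have [ab [ab1 abi ab2 ab3]] := mesh_line K.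
have [uv [uv1 uvi uv2 uv3]] := mesh_line L.
have abl : ab.1 < ab.2.
  by rewrite lt_neqAle ab1 andbT; apply/eqP => /ab3/(_ t).
have uvl : uv.1 < uv.2.
  by rewrite lt_neqAle uv1 andbT; apply/eqP => /uv3/(_ t).
case: meshD => _ /(_ K L KL) /seteqP[+ _] _.
have /(ab2 abl) /andP[a1 a2] := cK; have /(uv2 uvl) /andP[u1 u2] := cL.
have /(ab2 abl) /andP[a3 a4] := eK; have /(uv2 uvl) /andP[u3 u4] := fL.
(* Half of the minimum keeps the test point strictly inside both slices. *)
pose r := Num.min e f / 2.
have m0 : 0 < Num.min e f by rewrite lt_min e0 f0.
have me : Num.min e f <= e by rewrite ge_min lexx.
have mf : Num.min e f <= f by rewrite ge_min lexx orbT.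
move=> /(_ (X (t + s * r))); apply.
rewrite {}/r; move: (Num.min e f) m0 me mf => r r0 re rf.
split; [apply/abi; move: a1 a2 a3 a4|apply/uvi; move: u1 u2 u3 u4];
  clear - r0 re rf s1; case: s1 => -> *; apply/andP; split; lra.
Qed.

(** A cell on that side would put points of the closure of [D], hence points of [D], in the open
    half-space where [nu] excludes them. *)
Lemma outward_side s t nu K : s = 1 \/ s = -1 ->
  outward_normal D (X t) nu -> 0 < s * nu 0 k -> ~ side s K t.
Proof.
move=> s1 [_ nuD] sn [cK [e e0 eK]].
have [e1 e10 he1] := nbhs_line (delta_mx 0 k) (nbhs_interior nuD).
pose r := Num.min e e1.
have r0 : 0 < r by rewrite lt_min e0 e10.
have re : r <= e by rewrite ge_min lexx.
have re1 : r <= e1 by rewrite ge_min lexx orbT.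
have cr : cl K (X (t + s * r)) by apply: side_le cK eK _; rewrite ltW.
have /cell_closure clD := cr.
have sr : `|s * r| <= e1.
  by rewrite normrM (gtr0_norm r0); case: s1 => ->; rewrite ?normrN normr1 mul1r.
have := he1 _ sr; rewrite -insert_addr => nbU.
have nbP : nbhs (X (t + s * r)) [set z | dot nu (z - X t) > 0].
  have dN z : dot (- nu) z = - dot nu z by rewrite -scaleN1r dotZl mulN1r.
  apply: filterS (@near_dot_lt _ _ (- nu, - dot nu (X t)) (X (t + s * r)) _).
    by move=> z /=; rewrite dN dotBr; lra.
  rewrite /= dN (@dot_insert_addr _ _ (nu, 0))/=; nra.
have [z [Dz [/= zU zP]]] := clD _ (filterI nbU nbP).
by move: zP; have /zU := Dz; lra.
Qed.

(** The test point [x + e *: (nu - nu')] is on the outer side for [nu] and on the inner side for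
    [nu']. *)
Lemma outward_normal_unique x nu nu' :
  outward_normal D x nu -> outward_normal D x nu' -> nu = nu'.
Proof.
move=> [nu1 Hn] [nu'1 Hn']; apply/eqP/contraT => nn.
have w0 : nu - nu' != 0 by rewrite subr_eq0.
have [e e0 he] := nbhs_line (nu - nu') (filterI Hn Hn').
have [/= [h1 _] [_ h4]] := he e ltac:(by rewrite gtr0_norm).
have E1 : dot nu nu = 1 by rewrite -sqr_enorm nu1 expr1n.
have E2 : dot nu' nu' = 1 by rewrite -sqr_enorm nu'1 expr1n.
have := dot_gt0 w0; rewrite dotBl !dotBr E1 E2 (dotC nu' nu) => c1.
rewrite addrAC subrr add0r !dotZr !dotBr E1 E2 (dotC nu' nu) in h1 h4.
have /h1 : D (x + e *: (nu - nu')) by apply: h4; nra.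
by rewrite ltNge mulr_ge0//; lra.
Qed.

(** Both orientations are kept because [hs] does not say on which side [D] lies; [undup] is there
    because proportional entries of [hs] coincide after normalisation. *)
Definition unit_planes : seq ('rV[R]_n * R) :=
  undup ([seq ((enorm h.1)^-1 *: h.1, (enorm h.1)^-1 * h.2) | h <- hs] ++
         [seq (- (enorm h.1)^-1 *: h.1, - (enorm h.1)^-1 * h.2) | h <- hs]).

Lemma same_plane_unit h (nu : 'rV[R]_n) (b : R) : h \in hs ->
  enorm nu = 1 -> same_plane (nu, b) h -> (nu, b) \in unit_planes.
Proof.
move=> hin nu1 [c c0 hE]; rewrite mem_undup mem_cat.
have hn : enorm h.1 = `|c| by rewrite hE/= enormZ nu1 mulr1.
have [cp|cn|cz] := ltgtP c 0; last by rewrite cz eqxx in c0.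
  apply/orP; right; apply/mapP; exists h => //.
  rewrite hn ltr0_norm// hE/= invrN opprK !scalerA mulrA mulVf//.
  by rewrite scale1r mul1r.
apply/orP; left; apply/mapP; exists h => //.
rewrite hn gtr0_norm// hE/= !scalerA mulrA mulVf//.
by rewrite scale1r mul1r.
Qed.

Lemma unit_plane_same h : h \in unit_planes ->
  enorm h.1 = 1 /\ exists2 g, g \in hs & same_plane h g.
Proof.
rewrite mem_undup mem_cat => /orP[] /mapP[g gh ->] /=.
  split; first by rewrite enorm_normalize// hs0.
  have g0 := enorm_gt0 (hs0 gh); exists g => //; exists (enorm g.1); first by rewrite gt_eqF.
  by rewrite /= scalerA mulrA divff ?gt_eqF// scale1r mul1r; case: (g).
split; first by rewrite scaleNr -scaleN1r enormZ normrN normr1 mul1r enorm_normalize// hs0.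
have g0 := enorm_gt0 (hs0 gh); exists g => //; exists (- enorm g.1).
  by rewrite oppr_eq0 gt_eqF.
by rewrite /= scalerA mulrA mulrNN divff ?gt_eqF// scale1r mul1r; case: (g).
Qed.

(* If the mesh ends at t, only one cell touches that point and, by genericity,
   only one plane; hence D is a half-space there. *)
Lemma sides_outward s t K : s = 1 \/ s = -1 ->
  side (- s) K t -> (forall L, ~ side s L t) ->
  exists nu : 'rV[R]_n, [/\ bdry_face D (nu, dot nu (X t)) (X t), 0 < s * nu 0 k &
    (nu, dot nu (X t)) \in unit_planes].
Proof.
move=> s1 sK nS; have [cK _] := sK.
have sN1 : - s = 1 \/ - s = -1 by case: s1 => ->; [right|left; rewrite opprK].
have onlyK L : cl L (X t) -> L = K.
  by move=> cL; apply: (@side_inj (- s) L K t) => //; exact: cell_side.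
have [h [hK h0 hE hk]] : exists h, [/\ h \in faces K, h.1 != 0,
    dot h.1 (X t) = h.2 & 0 < s * h.1 0 k].
  by apply: line_exit => // e e0 ce; apply: (nS K); split => //; exists e.
have hH := faces_mesh_planes hK.
have [x0 x0K] : interior (cl K) !=set0 by case: meshD => + _ _; apply.
(* The other cells are closed and miss [X t], so near it the closure of [D] is contained in [K]. *)
have nK : \forall z \near X t, closure D z -> cl K z.
  have : \forall z \near X t, forall L, L \in enum T -> cl L z -> L = K.
    apply: near_seq => L _.
    have [cL|ncL] := pselect (cl L (X t)).
      by near=> z => _; exact: onlyK.
    have : nbhs (X t) (~` cl L).
      by apply: open_nbhs_nbhs; split => //; apply/closed_openC/cell_closed.
    by apply: filterS => z /= nz /nz.
  apply: filterS => z hz /closure_cell[L cL].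
  by rewrite -(hz L _ cL) ?mem_enum.
(* Near [X t] the single inequality [h] describes [K]: slack faces stay slack, and a tight one is a
   multiple of [h], a positive one because of the interior point [x0]. *)
have nh : \forall z \near X t, dot h.1 z <= h.2 -> cl K z.
  suff : \forall z \near X t, forall h', h' \in faces K ->
      dot h.1 z <= h.2 -> dot h'.1 z <= h'.2.
    by apply: filterS => z hz hz' h' h'K; exact: hz.
  apply: near_seq => h' h'K.
  have [h'0|h'0] := eqVneq h'.1 0.
    near=> z => _; have := cK h' h'K; rewrite h'0 /dot.
    by rewrite !big1// => i _; rewrite mxE mul0r.
  have := cK h' h'K; rewrite le_eqVlt => /orP[/eqP tight|lt]; last first.
    by apply: filterS (near_dot_lt lt) => z /= + _; exact: ltW.
  have [_ [c c0 h'E]] := gen hH (faces_mesh_planes h'K) h0 h'0 hE tight.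
  near=> z => hz; rewrite h'E/= dotZl.
  have := cell_interior_lt x0K hK h0; have := cell_interior_lt x0K h'K h'0.
  rewrite h'E/= dotZl => l1 l2; suff c1 : 0 < c by nra.
  rewrite ltNge; apply/negP => cn; nra.
have nU : \forall z \near X t, closure D z <-> dot h.1 z <= h.2.
  by apply: filterS2 nK nh => z nKz nhz; split => [/nKz|/nhz]; [exact|exact: cell_closure].
have cD : closure D (X t) := cell_closure cK.
have nlt x : nbhs x D -> (\forall z \near x, closure D z <-> dot h.1 z <= h.2) ->
    dot h.1 x < h.2.
  move=> Dx Ux; have [e e0 he] := nbhs_line h.1 (filterI Dx Ux).
  have [Dxe [/(_ (subset_closure Dxe)) + _]] := he e ltac:(by rewrite gtr0_norm).
  have [Dx0 [/(_ (subset_closure Dx0)) + _]] := he 0 ltac:(by rewrite normr0 ltW).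
  rewrite scale0r addr0 dotDr dotZr; have := dot_gt0 h0; nra.
have bX : bdry D (X t).
  split => // iD; have := nlt (X t) iD nU.
  by rewrite hE ltxx.
(* So far only the closure of [D] is a half-space, and [D] itself could be slit. This is excluded
   because its boundary near [X t] stays in the plane of [h]. *)
have nb : \forall z \near X t, bdry D z -> dot h.1 z = h.2.
  have : \forall z \near X t, forall g, g \in hs -> hyperplane g z -> dot h.1 z = h.2.
    apply: near_seq => g ghs.
    have [gE|gN] := eqVneq (dot g.1 (X t)) g.2; last first.
      by apply: filterS (near_dot_neq gN) => z /= /eqP gz /gz.
    have gH : g \in mesh_planes by rewrite mem_cat ghs.
    have [_ [c c0 gh]] := gen hH gH h0 (hs0 ghs) hE gE.
    near=> z; rewrite /hyperplane gh/= dotZl => /(mulfI c0)//.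
  by apply: filterS => z hz /bdryhs[g ghs gz]; exact: hz gz.
have nD : \forall z \near X t, D z <-> dot h.1 z < h.2.
  apply: filterS3 (nbhs_interior nU) nU nb => z nUz [_ Uz] bz; split => [Dz|hz].
    by apply: nlt => //; exact: open_nbhs_nbhs.
  apply: contrapT => nDz; suff hz' : dot h.1 z = h.2 by rewrite hz' ltxx in hz.
  by apply: bz; split; [exact/Uz/ltW|move=> /interior_subset].
have e0 := enorm_gt0 h0.
pose nu := (enorm h.1)^-1 *: h.1.
have nu1 : enorm nu = 1 by exact: enorm_normalize.
exists nu; split.
- split => //; split=> //=; apply: filterS nD => z ->.
  rewrite dotBr !dotZl hE -mulrBr pmulr_rlt0 ?invr_gt0// subr_lt0//.
- by rewrite mxE mulrCA mulr_gt0// invr_gt0.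
- have [g ghs gz] := bdryhs bX.
  have gH : g \in mesh_planes by rewrite mem_cat ghs.
  have [_ [c c0 gh]] := gen hH gH h0 (hs0 ghs) hE gz.
  apply: (same_plane_unit ghs) => //; exists (c * enorm h.1).
    by rewrite mulf_neq0// gt_eqF.
  by rewrite gh/= dotZl hE /nu scalerA mulfK ?gt_eqF// mulrA mulfK ?gt_eqF//.
Unshelve. all: end_near. Qed.

Lemma sum_indicator_uniq (I : finType) (Q : pred I) :
  (forall i j, Q i -> Q j -> i = j) ->
  \sum_i (Q i)%:R = ([exists i, Q i])%:R :> R.
Proof.
move=> Quniq; have [/existsP[i Qi]|/existsPn nQ] := boolP [exists i, Q i].
  rewrite (bigD1 i)//= Qi big1 ?addr0// => j ji.
  by case: (boolP (Q j)) => // Qj; rewrite (Quniq _ _ Qj Qi) eqxx in ji.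
by rewrite big1// => i _; rewrite (negbTE (nQ i)).
Qed.

Lemma sum_delta (s : seq R) (b : R) (F : R -> R) : uniq s -> b \in s ->
  \sum_(t <- s) (t == b)%:R * F t = F b.
Proof.
move=> us bs; rewrite (bigD1_seq b)//= eqxx mul1r big1 ?addr0// => t /negbTE ->.
by rewrite mul0r.
Qed.

(** Turns end points into occupation of the left and of the right of [t], the form in which cells
    can be compared; both sides vanish for [a = b]. *)
Lemma ends_indicator (a b t : R) : a <= b ->
  (t == b)%:R - (t == a)%:R = (a < t <= b)%R%:R - (a <= t < b)%R%:R :> R.
Proof.
move=> ab; have [tb|bt|tb] := ltgtP t b; have [ta|at_|ta] := ltgtP t a;
  by rewrite /= ?subrr ?subr0 //; exfalso; move: ab; lra.
Qed.

Context (ab : T -> R * R).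
Hypothesis abP : forall K,
    [/\ (ab K).1 <= (ab K).2,
        forall t, interior (cl K) (X t) <-> (ab K).1 < t < (ab K).2,
        (ab K).1 < (ab K).2 -> forall t, cl K (X t) <-> (ab K).1 <= t <= (ab K).2 &
        (ab K).1 = (ab K).2 -> forall t, ~ cl K (X t)].

Lemma side_right K t : side 1 K t <-> (ab K).1 <= t < (ab K).2.
Proof.
have [ab1 _ ab2 ab3] := abP K; split.
  move=> [ct [e e0 ce]].
  have abl : (ab K).1 < (ab K).2.
    by rewrite lt_neqAle ab1 andbT; apply/eqP => /ab3/(_ t).
  move: ct ce => /(ab2 abl)/andP[? ?] /(ab2 abl)/andP[? ?]; apply/andP; lra.
move=> /andP[at_ tb]; have abl := le_lt_trans at_ tb.
split; first by apply/(ab2 abl); rewrite at_ ltW.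
exists ((ab K).2 - t); first by rewrite subr_gt0.
by apply/(ab2 abl); rewrite mul1r addrC subrK ab1 lexx.
Qed.

Lemma side_left K t : side (-1) K t <-> (ab K).1 < t <= (ab K).2.
Proof.
have [ab1 _ ab2 ab3] := abP K; split.
  move=> [ct [e e0 ce]].
  have abl : (ab K).1 < (ab K).2.
    by rewrite lt_neqAle ab1 andbT; apply/eqP => /ab3/(_ t).
  move: ct ce => /(ab2 abl)/andP[? ?] /(ab2 abl)/andP[? ?]; apply/andP; lra.
move=> /andP[at_ tb]; have abl := lt_le_trans at_ tb.
split; first by apply/(ab2 abl); rewrite tb ltW.
exists (t - (ab K).1); first by rewrite subr_gt0.
by apply/(ab2 abl); rewrite mulN1r opprB addrC subrK ab1 lexx.
Qed.

Lemma unit_plane_normal_neq0 h t : h \in unit_planes -> hyperplane h (X t) ->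
  h.1 0 k != 0.
Proof.
move=> /unit_plane_same[_ [g ghs [c c0 gE]]] hX.
have gX : dot g.1 (X t) = g.2 by rewrite gE/= dotZl hX.
have gH : g \in mesh_planes by rewrite mem_cat ghs.
have [] := gen gH gH (hs0 ghs) (hs0 ghs) gX gX.
by rewrite {1}gE/= mxE mulf_eq0 negb_or c0.
Qed.

(** At most one cell occupies the left of [t], and at most one the right. If both sides or neither
    are occupied, the sum is 0 and there is no face; if only one is, [X t] lies on a face whose
    outward normal points to the free side. *)
Lemma mesh_ends_normal t :
  \sum_K ((t == (ab K).2)%:R - (t == (ab K).1)%:R) =
  \sum_(h <- unit_planes) Num.sg (h.1 0 k) * (`[< bdry_face D h (X t) >])%:R.
Proof.
have one1 : (1 : R) = 1 \/ (1 : R) = -1 by left.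
have oneN : (-1 : R) = 1 \/ (-1 : R) = -1 by right.
pose L := [exists K, (ab K).1 < t <= (ab K).2].
pose Q := [exists K, (ab K).1 <= t < (ab K).2].
transitivity (L%:R - Q%:R : R).
  rewrite -!sum_indicator_uniq -?sumrB; last 2 first.
  - by move=> K K' /side_right h /side_right h'; exact: side_inj h h'.
  - by move=> K K' /side_left h /side_left h'; exact: side_inj h h'.
  by apply: eq_bigr => K _; apply: ends_indicator; have [] := abP K.
have [[h [hu hX]]|nh] := pselect (exists h, h \in unit_planes /\ bdry_face D h (X t)).
  have [bX hp outw] := hX.
  have -> : \sum_(h' <- unit_planes) Num.sg (h'.1 0 k) * (`[< bdry_face D h' (X t) >])%:R
      = Num.sg (h.1 0 k).
    rewrite (bigD1_seq h)//= ?undup_uniq//; have /asboolP -> := hX.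
    rewrite mulr1 big1 ?addr0// => h' h'h; case: asboolP; rewrite ?mulr0// => -[_ hp' out'].
    exfalso; move/eqP: h'h; apply.
    have e1 := outward_normal_unique outw out'.
    rewrite [LHS]surjective_pairing [RHS]surjective_pairing -e1.
    by rewrite -hp -hp' -e1.
  have hk := unit_plane_normal_neq0 hu hp.
  have [K cK] := closure_cell bX.1.
  have [hn|hpos|hz] := ltgtP (h.1 0 k) 0; last by rewrite hz eqxx in hk.
    have nS L' : ~ side (-1) L' t by apply: (outward_side oneN outw); lra.
    have -> : L = false by apply/existsP => -[L' /side_left]; exact: nS.
    have -> : Q = true.
      apply/existsP; exists K; apply/side_right; rewrite -[1]opprK.
      by apply: cell_side => //; exact: nS.
    by rewrite ltr0_sg// sub0r.
  have nS L' : ~ side 1 L' t by apply: (outward_side one1 outw); lra.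
  have -> : Q = false by apply/existsP => -[L' /side_right]; exact: nS.
  have -> : L = true.
    apply/existsP; exists K; apply/side_left.
    by apply: cell_side => //; exact: nS.
  by rewrite gtr0_sg// subr0.
rewrite [RHS]big_seq big1 => [|h hu]; last first.
  by case: asboolP; rewrite ?mulr0// => hX; case: nh; exists h.
apply/eqP; rewrite subr_eq0; apply/eqP; congr ((nat_of_bool _)%:R).
apply/idP/idP => /existsP[K].
  move=> /side_left sK; apply: contrapT => nQ; apply: nh.
  have [L' /side_right h|nu [bf _ un]] := @sides_outward 1 t K one1 sK.
    by apply: nQ; apply/existsP; exists L'.
  by exists (nu, dot nu (X t)).
move=> /side_right sK; apply: contrapT => nL; apply: nh.
have [|L' /side_left h|nu [bf _ un]] := @sides_outward (-1) t K oneN.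
- by rewrite opprK.
- by apply: nL; apply/existsP; exists L'.
- by exists (nu, dot nu (X t)).
Qed.

Lemma sum_mesh_ends (f : 'rV[R]_n -> R) :
  \sum_K (f (X (ab K).2) - f (X (ab K).1)) =
  \sum_(h <- unit_planes) Num.sg (h.1 0 k) * (f \_ (bdry_face D h)) (graph_at k h y).
Proof.
pose th h := (h.2 - dot h.1 (insert_coord k 0 y)) / h.1 0 k.
(* A finite list of all parameters at which either side can be nonzero, so that the identity at a
   single [t] may be summed. *)
pose pts := undup ([seq (ab K).1 | K <- enum T] ++ [seq (ab K).2 | K <- enum T] ++
  [seq th h | h <- unit_planes]).
have up : uniq pts by exact: undup_uniq.
have p1 K : (ab K).1 \in pts.
  rewrite mem_undup mem_cat; apply/orP; left.
  by apply/mapP; exists K => //; rewrite mem_enum.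
have p2 K : (ab K).2 \in pts.
  rewrite mem_undup !mem_cat; apply/orP; right; apply/orP; left.
  by apply/mapP; exists K => //; rewrite mem_enum.
transitivity (\sum_(t <- pts) (\sum_K ((t == (ab K).2)%:R - (t == (ab K).1)%:R)) * f (X t)).
  under [RHS]eq_bigr do rewrite mulr_suml.
  rewrite exchange_big/=; apply: eq_bigr => K _.
  under eq_bigr do rewrite mulrBl.
  rewrite sumrB (sum_delta (fun t => f (X t)) up (p2 K)).
  by rewrite (sum_delta (fun t => f (X t)) up (p1 K)).
under eq_bigr do rewrite mesh_ends_normal mulr_suml.
rewrite exchange_big/= big_seq [RHS]big_seq; apply: eq_bigr => h hu.
have [hk|hk] := eqVneq (h.1 0 k) 0.
  by rewrite hk sgr0 mul0r big1// => t _; rewrite !mul0r.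
have pt : th h \in pts.
  rewrite mem_undup !mem_cat; apply/orP; right; apply/orP; right.
  by apply/mapP; exists h.
have xg : X (th h) = graph_at k h y by [].
rewrite (bigD1_seq (th h))//= big1 ?addr0; last first.
  move=> t tth; case: asboolP => [[_ /(hyperplane_insert hk) + _]|].
    by rewrite -xg => /insert_coord_inj tE; rewrite tE eqxx in tth.
  by rewrite mulr0 mul0r.
rewrite xg -mulrA; congr (_ * _); rewrite patchE.
by case: asboolP => bf; [rewrite mem_set// mul1r|rewrite memNset// mul0r].
Qed.

End boundary.

(** * The divergence theorem *)

Section line_calculus.
Context (R : realType) (d : nat) (k : 'I_d.+1).
Local Notation n := d.+1.
Local Notation mu := (@lebesgue_measure R).

Lemma row_norm_le m (x : 'rV[R]_m) (e : R) : 0 < e -> (forall i, `|x 0 i| < e) ->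
  `|x| < e.
Proof.
move=> e0 xe; have : ball (0 : 'rV[R]_m) e x.
  by split => // i j; rewrite /ball/= mxE sub0r normrN ord1.
by rewrite mx_norm_ball /ball_ /= sub0r normrN.
Qed.

Lemma derive_line (g : 'rV[R]_n -> R^o) (y : 'rV[R]_d) (s : R) :
  differentiable g (insert_coord k s y) ->
  derivable (fun t : R => g (insert_coord k t y)) s 1 /\
  derive1 (fun t : R => g (insert_coord k t y)) s =
    'D_(delta_mx 0 k) g (insert_coord k s y).
Proof.
move=> dg.
have E : (fun h : R => h^-1 *: (((fun t : R => g (insert_coord k t y)) \o shift s) (h *: 1)
      - g (insert_coord k s y))) =
    (fun h : R => h^-1 *: ((g \o shift (insert_coord k s y)) (h *: delta_mx 0 k)
      - g (insert_coord k s y))).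
  apply/funext => h; rewrite /= [h *: 1 + s]addrC.
  by rewrite -[h *: 1]/(h * 1) mulr1 insert_addr (addrC _ (insert_coord k s y)).
split; last by rewrite derive1E /derive E.
by rewrite /derivable E; exact: diff_derivable.
Qed.

Lemma insert_continuous (y : 'rV[R]_d) : continuous (fun s : R => insert_coord k s y).
Proof.
rewrite (_ : (fun s => _) = fun s : R => insert_coord k 0 y + s *: delta_mx 0 k).
  move=> s; apply: cvgD; first exact: cvg_cst.
  by apply: cvgZ; [exact: cvg_id|exact: cvg_cst].
by apply/funext => s; rewrite -insert_addr add0r.
Qed.

Lemma integral_line (g : 'rV[R]_n -> R^o) (y : 'rV[R]_d) (a b : R) :
  continuously_differentiable g -> a < b ->
  (\int[mu]_(s in `]a, b[) ('D_(delta_mx 0 k) g (insert_coord k s y)))%R =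
  g (insert_coord k b y) - g (insert_coord k a y).
Proof.
move=> [dg cg] ab.
have cD : continuous (fun s : R => 'D_(delta_mx 0 k) g (insert_coord k s y) : R).
  move=> s; apply: (@continuous_comp _ _ _ (fun s : R => insert_coord k s y)
    ('D_(delta_mx 0 k) g)); first exact: insert_continuous.
  exact: cg.
have cG : continuous (fun s : R => g (insert_coord k s y) : R).
  move=> s; apply: (@continuous_comp _ _ _ (fun s : R => insert_coord k s y) g).
    exact: insert_continuous.
  exact: differentiable_continuous.
have intD : mu.-integrable `[a, b]
    (EFin \o (fun s : R => 'D_(delta_mx 0 k) g (insert_coord k s y) : R)).
  apply: continuous_compact_integrable; first exact: segment_compact.
  exact: continuous_subspaceT.
rewrite Rintegral_itv_bndo_bndc; last first.
  apply: integrableS intD => //; apply: subset_itv; by rewrite bnd_simp.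
rewrite Rintegral_itv_obnd_cbnd; last first.
  apply: integrableS intD => //; apply: subset_itv; by rewrite bnd_simp.
rewrite /Rintegral (@continuous_FTC2 _ _ (fun t : R => g (insert_coord k t y) : R)) //.
- exact: continuous_subspaceT.
- split=> [s _||]; first by have [] := derive_line (dg (insert_coord k s y)).
  + by apply: cvg_at_right_filter; exact: cG.
  + by apply: cvg_at_left_filter; exact: cG.
- by move=> s _; have [] := derive_line (dg (insert_coord k s y)).
Qed.

Lemma nbhs_coord m (x : 'rV[R]_m) (U : set 'rV[R]_m) : nbhs x U ->
  exists2 e : R, 0 < e & forall z : 'rV[R]_m, (forall i, `|z 0 i - x 0 i| < e) -> U z.
Proof.
move=> /nbhs_interior xU; have oU : open (interior U) by exact: open_interior.
have [e e0 he] := open_box oU (nbhs_singleton xU).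
by exists e => // z /he /interior_subset.
Qed.

Lemma graph_at_continuous (h : 'rV[R]_n * R) : continuous (graph_at k h).
Proof.
move=> y U /nbhs_coord[e e0 he].
have : \forall z \near y, forall i, i \in enum 'I_n ->
    `|graph_at k h z 0 i - graph_at k h y 0 i| < e.
  apply: near_seq => i _.
  have ci : {for y, continuous (fun z => graph_at k h z 0 i)}.
    rewrite /graph_at; case: (unliftP k i) => [j ->|->].
      rewrite (_ : (fun z => _) = fun z : 'rV[R]_d => z 0 j); last first.
        by apply/funext => z; rewrite insert_lift.
      exact: coord_continuous.
    rewrite (_ : (fun z => _) = fun z : 'rV[R]_d =>
      (h.2 - dot (\row_j h.1 0 (lift k j)) z) / h.1 0 k); last first.
      by apply/funext => z; rewrite insert_at dot_insert mulr0 add0r.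
    apply: continuousM; last exact: cst_continuous.
    by apply: continuousB; [exact: cst_continuous|exact: dot_continuous].
  have /cvgrPdist_lt/(_ e e0) := ci; apply: filterS => z /=.
  by rewrite distrC.
apply: filterS => z hz; apply: he => i; apply: hz.
by rewrite mem_enum.
Qed.

End line_calculus.

Section divergence.
Context (R : realType) (d : nat).
Local Notation n := d.+1.
Local Notation mu := (@lebesgue_measure R).
Context (D : set 'rV[R]_n) (T : finType) (faces : T -> seq ('rV[R]_n * R))
  (hs : seq ('rV[R]_n * R)).
Hypotheses (oD : open D) (bD : bounded_set D) (meshD : mesh_of D faces)
  (hs0 : forall h, h \in hs -> h.1 != 0)
  (bdryhs : bdry D `<=` [set x | exists2 h, h \in hs & hyperplane h x]).
Implicit Types (h : 'rV[R]_n * R).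
Local Notation cl K := (cell (faces K)).

Lemma within_continuous_bounded m (A : set 'rV[R]_m) (f : 'rV[R]_m -> R) :
  bounded_set A -> closed A -> {within A, continuous f} ->
  exists M, forall x, A x -> `|f x| <= M.
Proof.
move=> bA cA cf; have := bounded_closed_compact bA cA.
move=> /(continuous_compact cf)/compact_bounded[M [_ hM]].
exists (`|M| + 1) => x Ax; apply: hM; last by exists x.
by rewrite (le_lt_trans (ler_norm _))// ltrDl.
Qed.

Lemma null_rows_seq m (I : eqType) (s : seq I) (A : I -> set 'rV[R]_m) :
  (forall i, i \in s -> null_rows (A i)) ->
  null_rows [set x | exists2 i, i \in s & A i x].
Proof.
elim: s => [|i s IHs] h.
  apply: negligibleS (negligible_set0 _) => t [i]; by rewrite in_nil.
have h1 := h i (mem_head _ _).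
have h2 := IHs (fun j js => h j (mem_behead (s := i :: s) js)).
apply: negligibleS (negligibleU h1 h2) => t [j].
by rewrite in_cons => /orP[/eqP ->|js] Aj; [left|right; exists j].
Qed.

(** A bad line lies in a plane ([A1], an affine condition on [y]) or meets two distinct planes at
    one point ([A2], handled by [null_graph_at]). *)
Lemma null_nongeneric (k : 'I_n) :
  null_rows [set y | ~ generic_line k y (mesh_planes faces hs)].
Proof.
pose H := [seq h <- mesh_planes faces hs | h.1 != 0].
pose A1 h := [set y : 'rV[R]_d | h.1 0 k = 0 /\ dot h.1 (insert_coord k 0 y) = h.2].
pose A2 (p : ('rV[R]_n * R) * ('rV[R]_n * R)) := [set y : 'rV[R]_d |
  [/\ p.1.1 0 k != 0, ~ same_plane p.1 p.2 & dot p.2.1 (graph_at k p.1 y) = p.2.2]].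
have N1 : null_rows [set y | exists2 h, h \in H & A1 h y].
  apply: null_rows_seq => h; rewrite mem_filter => /andP[h0 _].
  have [hk|hk] := eqVneq (h.1 0 k) 0; last first.
    by apply: negligibleS (negligible_set0 _) => t [/eqP]; rewrite (negbTE hk).
  have := @null_affine R d (\row_j h.1 0 (lift k j)) h.2; rewrite /null_rows => N.
  apply: negligibleS (N _) => [t [_]|].
    by rewrite dot_insert mulr0 add0r.
  apply/orP; left; apply: contra_neq h0 => r0; apply/rowP => j.
  rewrite mxE; case: (unliftP k j) => [i ->|->//].
  by have /rowP/(_ i) := r0; rewrite !mxE.
have N2 : null_rows [set y | exists2 p, p \in [seq (h, h') | h <- H, h' <- H] & A2 p y].
  apply: null_rows_seq => p /allpairsP[[h h'] /= [hH h'H ->]] /=.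
  move: h'H; rewrite mem_filter => /andP[h'0 _].
  have [hk|hk] := eqVneq (h.1 0 k) 0.
    by apply: negligibleS (negligible_set0 _) => t [/=]; rewrite hk eqxx.
  have [sp|nsp] := pselect (same_plane h h').
    by apply: negligibleS (negligible_set0 _) => t [/=].
  by apply: negligibleS (null_graph_at hk h'0 nsp) => t [/=].
apply: negligibleS (negligibleU N1 N2) => t /= ng.
apply: contrapT => /not_orP[n1 n2]; apply: ng => s h h' hH h'H h0 h'0 hs_ h's.
have hk : h.1 0 k != 0.
  apply/eqP => hk; apply: n1; exists h; first by rewrite mem_filter h0.
  by split => //; move: hs_; rewrite !dot_insert hk !mul0r.
split => //; apply: contrapT => nsp; apply: n2; exists (h, h').
  by apply/allpairsP; exists (h, h'); rewrite /= !mem_filter h0 h'0.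
by split => //=; rewrite -(hyperplane_insert hk hs_).
Qed.

Lemma outward_bdry x nu : outward_normal D x nu -> bdry D x.
Proof.
move=> [nu1 nuD]; split.
  move=> U xU; have nu0 : nu != 0.
    by apply/eqP => nu0; move: nu1; rewrite nu0 /enorm dot0r sqrtr0 => /esym/eqP; rewrite oner_eq0.
  have [e e0 /(_ (- e))] := nbhs_line nu (filterI xU nuD).
  rewrite normrN gtr0_norm// lexx => -[//|Ux DU].
  exists (x + - e *: nu); split => //; apply/DU.
  by rewrite addrAC subrr add0r dotZr; have := dot_gt0 nu0; nra.
move=> /interior_subset Dx; have := (nbhs_singleton nuD).1 Dx.
by rewrite subrr dot0r ltxx.
Qed.

(** A face is relatively open in its plane, because the half-space description of [D] at one point
    is inherited by nearby points of the plane. This makes the domain of the surface integral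
    open. *)
Lemma bdry_face_nbhs h x : bdry_face D h x ->
  \forall z \near x, hyperplane h z -> bdry_face D h z.
Proof.
move=> [_ hx [nu1 nuD]]; apply: filterS (nbhs_interior nuD) => z zU hz.
have outz : outward_normal D z h.1.
  split => //; apply: filterS zU => w ->.
  by rewrite !dotBr hx hz.
by split => //; exact: outward_bdry outz.
Qed.

Context (phi : 'rV[R]_n -> R).
Hypotheses (cphi : {within closure D, continuous phi})
  (phi_ge0 : forall x, closure D x -> 0 <= phi x)
  (phiC1 : forall K, exists2 g : 'rV[R]_n -> R^o,
     continuously_differentiable g & forall x, cl K x -> phi x = g x).

Lemma rintegrable_face (k : 'I_n) h : h.1 0 k != 0 ->
  rintegrable (fun y => (phi \_ (bdry_face D h)) (graph_at k h y)).
Proof.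
move=> hk; pose A := [set y : 'rV[R]_d | bdry_face D h (graph_at k h y)].
rewrite (_ : (fun y => _) = (phi \o graph_at k h) \_ A); last first.
  apply/funext => y; rewrite !patchE.
  by have -> : (y \in A) = (graph_at k h y \in bdry_face D h) by apply/idP/idP; rewrite !inE.
have nA y : A y -> \forall z \near y, A z.
  move=> /bdry_face_nbhs bf.
  have : \forall z \near y, hyperplane h (graph_at k h z) -> A z.
    exact: (@graph_at_continuous _ _ k h y _ bf).
  by apply: filterS => z; apply; exact: dot_graph_at.
have [M hM] := within_continuous_bounded (closure_bounded bD) (@closed_closure _ D) cphi.
apply: (@rintegrable_patch _ _ _ _ M).
- by rewrite openE => y; exact: nA.
- have [N [_ hN]] := closure_bounded bD; exists (`|N| + 2); split => // r Nr y [[cD _] _ _].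
  apply/ltW/row_norm_le; first by rewrite (lt_trans _ Nr)// ltr_wpDl.
  have gN : `|graph_at k h y| < r.
    apply: le_lt_trans (hN (`|N| + 1) _ _ cD) _; last by lra.
    by rewrite (le_lt_trans (ler_norm _))// ltrDl.
  by move=> i; have := row_norm_lt gN (lift k i); rewrite insert_lift.
- move=> y Ay U; have [[cD _] _ _] := Ay.
  move/subspace_continuousP : cphi => /(_ _ cD) + phiU => /(_ _ phiU) phU.
  have cU : \forall z \near y, closure D (graph_at k h z) -> U (phi (graph_at k h z)).
    exact: (@graph_at_continuous _ _ k h y _ phU).
  by apply: filterS2 cU (nA _ Ay) => z /= h1 [[cz _] _ _]; exact: h1.
- by move=> y [[cD _] _ _]; exact: hM.
Qed.

(** [grad] differentiates [phi] itself, which may have kinks across cells; derivatives being local,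
    it agrees inside a cell with the C^1 representative. *)
Lemma grad_interior K (g : 'rV[R]_n -> R^o) x : interior (cl K) x ->
  (forall z, cl K z -> phi z = g z) -> grad phi x = grad g x.
Proof.
move=> xK gE; apply/rowP => j; rewrite !mxE; apply: near_eq_derive.
by apply: filterS xK => z; exact: gE.
Qed.

Lemma rintegrable_grad (w : 'rV[R]_n -> R) K k : {within closure D, continuous w} ->
  rintegrable ((fun x => w x * grad phi x 0 k) \_ (interior (cl K))).
Proof.
move=> cw; have [g [dg cg] gE] := phiC1 K.
rewrite (_ : _ \_ _ = (fun x => w x * 'D_(delta_mx 0 k) g x) \_ (interior (cl K))); last first.
  apply/funext => x; rewrite !patchE; case: ifPn => //; rewrite inE => xK.
  by rewrite (grad_interior xK gE) mxE.
have cK : closed (cl K) by exact: cell_closed.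
have bK := cell_bounded bD meshD K.
have [M hM] := within_continuous_bounded (closure_bounded bD) (@closed_closure _ D) cw.
have cDg : {within cl K, continuous (fun x => 'D_(delta_mx 0 k) g x : R)}.
  by apply: continuous_subspaceT; exact: cg.
have [N hN] := within_continuous_bounded bK cK cDg.
apply: (@rintegrable_patch _ _ _ _ (M * N)).
- exact: open_interior.
- have [L [Lr hL]] := bK; exists L; split => // r Lr' x /interior_subset.
  exact: hL.
- move=> x xK; apply: continuousM; last exact: cg.
  have xD : closure D x by exact: (cell_closure meshD (interior_subset xK)).
  move/subspace_continuousP : cw => /(_ _ xD) cwx U wU.
  have cU : \forall z \near x, closure D z -> U (w z) by exact: cwx.
  have xK' : \forall z \near x, cl K z by exact: xK.
  apply: filterS2 cU xK' => z /= h zK; apply: h.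
  exact: (cell_closure meshD zK).
- move=> x /interior_subset xK; rewrite normrM ler_pM//.
    by apply: hM; exact: (cell_closure meshD xK).
  exact: hN.
Qed.

Lemma integral_grad_line K (k : 'I_n) (y : 'rV[R]_d) (ab : R * R) :
  ab.1 <= ab.2 ->
  (forall t, interior (cl K) (insert_coord k t y) <-> ab.1 < t < ab.2) ->
  (ab.1 < ab.2 -> forall t, cl K (insert_coord k t y) <-> ab.1 <= t <= ab.2) ->
  (\int[mu]_s ((fun x => grad phi x 0 k) \_ (interior (cl K)))
    (insert_coord k s y))%R =
  phi (insert_coord k ab.2 y) - phi (insert_coord k ab.1 y).
Proof.
move=> ab1 abi abc; have [g [dg cg] gE] := phiC1 K.
rewrite (_ : (fun s => _) =
  (fun s : R => 'D_(delta_mx 0 k) g (insert_coord k s y) : R) \_ `]ab.1, ab.2[%classic).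
  rewrite -Rintegral_mkcond; move: ab1; rewrite le_eqVlt => /orP[/eqP e|abl].
    by rewrite e subrr set_itvoo0 Rintegral_set0.
  rewrite (integral_line k y (conj dg cg) abl).
  by rewrite !gE//; apply/(abc abl); rewrite !lexx ltW.
apply/funext => s; rewrite !patchE.
have -> : (insert_coord k s y \in (interior (cl K) : set 'rV[R]_n)) = (s \in `]ab.1, ab.2[%classic).
  by apply/idP/idP; rewrite !inE/= in_itv/= => /abi.
case: ifPn => //; rewrite inE/= in_itv/= => /abi xK.
by rewrite (grad_interior xK gE) mxE.
Qed.

Lemma pivot_neq0 (a : 'rV[R]_n) : a != 0 -> a 0 (pivot a) != 0.
Proof.
move=> a0; rewrite /pivot; case: pickP => // na.
by move/eqP : a0; case; apply/rowP => i; rewrite mxE; apply/eqP; move: (na i) => /negbFE.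
Qed.

Lemma face_patch_ge0 h x : 0 <= (phi \_ (bdry_face D h)) x.
Proof.
by rewrite patchE; case: ifPn => //; rewrite inE => -[[cD _] _ _]; exact: phi_ge0.
Qed.

(** The definition eliminates the pivot, slices along e_k eliminate the k-th coordinate;
    nonnegativity of [phi] allows the change by Tonelli. *)
Lemma hyperplane_integralE h (k : 'I_n) : h.1 0 k != 0 ->
  hyperplane_integral h (bdry_face D h) phi =
  `|h.1 0 k|^-1 * rint (fun y => (phi \_ (bdry_face D h)) (graph_at k h y)).
Proof.
move=> hk; have h0 : h.1 != 0 by apply: contra_neq hk => ->; rewrite mxE.
have hp := pivot_neq0 h0; set p := pivot h.1 in hp.
rewrite /hyperplane_integral integral_onE -/p.
have ik := rintegrable_face hk; have ip := rintegrable_face hp.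
have E := @ge0_integral_graph_at R d p k h (fun x => ((phi \_ (bdry_face D h)) x)%:E)
  hp hk (fun x => face_patch_ge0 h x) (measurable_int _ ip) (measurable_int _ ik).
apply/EFin_inj; rewrite /rint /Rintegral !EFinM !fineK; first exact: E.
- exact: integrable_fin_num ik.
- exact: integrable_fin_num ip.
Qed.

(** Such a face is covered by the planes of [hs], none of which is the plane of [h], and is null.
    This reduces the sum over all oriented planes to the finite list [unit_planes]. *)
Lemma hyperplane_integral_face0 h : bdry_face D h !=set0 ->
  h \notin unit_planes hs -> hyperplane_integral h (bdry_face D h) phi = 0.
Proof.
move=> [x [_ _ [h1 _]]] nh.
have h0 : h.1 != 0.
  by apply/eqP => h0; move: h1; rewrite h0 /enorm dot0r sqrtr0 => /esym/eqP; rewrite oner_eq0.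
have hp := pivot_neq0 h0; set p := pivot h.1 in hp.
rewrite (hyperplane_integralE hp).
have ip := rintegrable_face hp.
have rint0 : rintegrable (fun _ : 'rV[R]_d => 0 : R).
  exact: integrable0.
rewrite (@eq_rint_ae R d _ (fun=> 0) ip rint0).
  rewrite /rint /Rintegral integral0/= mulr0//.
have : null_rows [set y | exists2 g, g \in hs & dot g.1 (graph_at p h y) = g.2].
  apply: null_rows_seq => g ghs; apply: null_graph_at hp (hs0 ghs) _ => sp.
  move/negP : nh; apply; rewrite [h]surjective_pairing.
  by apply: same_plane_unit ghs h1 _; rewrite -surjective_pairing.
apply: negligibleS => t /=; rewrite patchE; case: ifPn => //; rewrite inE.
by move=> [/bdryhs[g ghs gz] _ _] _; exists g.
Qed.

Theorem divergence (k : 'I_n) :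
  \sum_K integral_on (interior (cl K)) (fun x => grad phi x 0 k) =
  bdry_integral_normal D phi 0 k.
Proof.
pose S := [set h | bdry_face D h !=set0].
have rg K : rintegrable ((fun x => grad phi x 0 k) \_ (interior (cl K))).
  rewrite (_ : (fun x => grad phi x 0 k) = (fun x => 1 * grad phi x 0 k)).
    by apply: rintegrable_grad; apply: continuous_subspaceT; exact: cst_continuous.
  by apply/funext => x; rewrite mul1r.
(* When the k-th coordinate is eliminated, n_k ds = sg(n_k) dy. *)
pose J h y := Num.sg (h.1 0 k) * (phi \_ (bdry_face D h)) (graph_at k h y).
have rJ h : rintegrable (J h).
  have [hk|hk] := eqVneq (h.1 0 k) 0; last exact/rintegrableZ/rintegrable_face.
  rewrite (_ : J h = fun=> 0); first exact: integrable0.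
  by apply/funext => y; rewrite /J hk sgr0 mul0r.
have -> : bdry_integral_normal D phi 0 k = \sum_(h <- unit_planes hs) rint (J h).
  rewrite /bdry_integral_normal (@fsbigE _ _ _ _ _ [seq h <- unit_planes hs | h \in S]).
  - rewrite -big_filter filter_id big_filter summxE.
    rewrite [RHS](bigID (fun h => h \in S))/= [X in _ = _ + X]big1 ?addr0; last first.
      move=> h; rewrite notin_setE => hS; rewrite (_ : J h = fun=> 0).
        by rewrite /rint /Rintegral integral0.
      apply/funext => y; rewrite /J patchE memNset ?mulr0// => hy.
      by apply: hS; exists (graph_at k h y).
    apply: eq_bigr => h hS; rewrite mxE.
    have [hk|hk] := eqVneq (h.1 0 k) 0.
      rewrite hk mulr0 (_ : J h = fun=> 0); first by rewrite /rint /Rintegral integral0.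
      by apply/funext => y; rewrite /J hk sgr0 mul0r.
    rewrite (hyperplane_integralE hk) rintZ; last exact: rintegrable_face.
    rewrite mulrAC; congr (_ * _).
    by rewrite [X in _ * X]numEsg mulrCA mulVf ?mulr1// normr_eq0.
  - by rewrite filter_uniq// undup_uniq.
  - by move=> h /=; rewrite mem_filter => /andP[]; rewrite inE.
  - move=> h Sh; rewrite mem_filter mem_set//= => nh.
    by rewrite hyperplane_integral_face0// scale0r.
under eq_bigr do rewrite integral_onE.
have fub K := rint_fubini k (rg K).
under eq_bigr do rewrite (fub _).2.
rewrite -(rint_sum (index_enum T) (fun K => (fub K).1)).
rewrite -(rint_sum (unit_planes hs) rJ).
apply: eq_rint_ae.
- by apply: rintegrable_sum => K; have [] := fub K.
- exact: rintegrable_sum.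
apply: negligibleS (null_nongeneric k) => t /= nE gen; apply: nE.
have /choice[ab abP] := mesh_line bD meshD gen.
rewrite /J -(sum_mesh_ends oD bD meshD hs0 bdryhs gen abP).
apply: eq_bigr => K _; have [ab1 ab2 ab3 _] := abP K.
exact: integral_grad_line.
Qed.

End divergence.

(** * Riemann fans *)

Section real_line.
Context (R : realType).
Local Notation mu := (@lebesgue_measure R).

Lemma measurable_inv : measurable_fun [set: R] (fun s : R => s^-1).
Proof.
rewrite -(setUv [set (0 : R)]); apply/measurable_funU => //.
  exact: measurableC.
split; first exact: measurable_fun_set1.
apply: open_continuous_measurable_fun.
  exact: closed_openC (@closed_eq R 0).
by move=> x; rewrite inE/= => /eqP x0; exact: inv_continuous.
Qed.

Lemma integrable_bounded_itv (f : R -> R) (a b : R) (x y : bool) :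
  measurable_fun [set: R] f -> bounded_fun f ->
  mu.-integrable [set` Interval (BSide x a) (BSide y b)] (EFin \o f).
Proof.
move=> mf [M [Mr hM]]; apply: measurable_bounded_integrable => //.
- by rewrite /= lebesgue_measure_itv; case: ifP => // _; rewrite -EFinD ltry.
- exact: measurable_funTS.
- by exists M; split => // r Mr' s _; exact: hM.
Qed.

(** The end points are exempt because rays are evaluated at [x / s], which is 0 for [s = 0]. *)
Lemma Rintegral_cst_oo (f : R -> R) (a b c : R) : a <= b ->
  (forall s, a < s < b -> f s = c) -> (\int[mu]_(s in `[a, b]) f s)%R = c * (b - a).
Proof.
move=> ab fc.
have mf : measurable_fun `[a, b] f.
  apply: (@measurable_fun_itv_cc _ _ _ false true).
  apply: (eq_measurable_fun (cst c)) => [s|]; last exact: measurable_cst.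
  by rewrite inE/= in_itv/= => /fc.
transitivity (\int[mu]_(s in `[a, b]) (cst c s))%R; last first.
  rewrite Rintegral_cst//= lebesgue_measure_itv/= lte_fin.
  by move: ab; rewrite le_eqVlt => /orP[/eqP ->|->//]; rewrite ltxx subrr.
rewrite /Rintegral; congr fine; apply: ae_eq_integral => //.
- exact/measurable_EFinP.
- by apply/measurable_EFinP; exact: measurable_cst.
have N : mu.-negligible ([set a] `|` [set b]).
  by apply: negligibleU; [exists [set a]|exists [set b]]; split => //;
    exact: lebesgue_measure_set1.
apply: negligibleS N => s /= h; apply: contrapT => /not_orP[sa sb]; apply: h.
rewrite in_itv/= => /andP[a1 a2]; rewrite fc//.
by rewrite !lt_neqAle a1 a2 !andbT; apply/andP; split; apply/eqP => // e; apply: sa.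
Qed.

Lemma Rintegral_itv_split (f : R -> R) (a x b : R) : a <= x <= b ->
  mu.-integrable `[a, b] (EFin \o f) ->
  (\int[mu]_(s in `[a, b]) f s)%R =
  (\int[mu]_(s in `[a, x]) f s)%R + (\int[mu]_(s in `[x, b]) f s)%R.
Proof.
move=> /andP[ax xb] fi; rewrite -(Rintegral_itv_obnd_cbnd (r := x)); last first.
  by apply: integrableS fi => //; apply: subset_itv; rewrite bnd_simp.
rewrite -(Rintegral_itvB (x := x) fi); first by rewrite addrCA subrr addr0.
- by rewrite bnd_simp.
- by rewrite bnd_simp.
Qed.

End real_line.

Section linear_functional.
Context (R : realType) (m : nat).
Local Notation mu := (@lebesgue_measure R).

Lemma measurable_dot (q : R -> 'rV[R]_m) (a : 'rV[R]_m) :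
  (forall k, measurable_fun [set: R] (fun x => q x 0 k)) ->
  measurable_fun [set: R] (fun x => dot a (q x)).
Proof.
move=> mq; apply: measurable_sum => k.
by apply: measurable_funM; [exact: measurable_cst|exact: mq].
Qed.

Lemma bounded_dot (q : R -> 'rV[R]_m) (a : 'rV[R]_m) :
  bounded_fun q -> bounded_fun (fun x => dot a (q x)).
Proof.
move=> [M [Mr hM]]; pose C := \sum_i `|a 0 i| * (`|M| + 2).
exists C; split; first exact: num_real.
move=> r Cr x _; apply: le_trans (ltW Cr); rewrite /dot.
apply: le_trans (ler_norm_sum _ _ _) _; apply: ler_sum => i _.
rewrite normrM ler_wpM2l//; apply: ltW; apply: row_norm_lt.
apply: le_lt_trans (hM (`|M| + 1) _ x I) _; last by lra.
by rewrite (le_lt_trans (ler_norm _))// ltrDl.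
Qed.

Lemma dot_integral (A : set (measurableTypeR R)) (q : R -> 'rV[R]_m) (a : 'rV[R]_m) :
  measurable A -> (forall k, mu.-integrable A (EFin \o (fun x => q x 0 k))) ->
  dot a (\row_k (\int[mu]_(x in A) q x 0 k)%R) = (\int[mu]_(x in A) dot a (q x))%R.
Proof.
move=> mA qi; rewrite /dot.
have : forall s : seq 'I_m,
  mu.-integrable A (EFin \o (fun x => \sum_(i <- s) a 0 i * q x 0 i)) /\
  \sum_(i <- s) a 0 i * (\row_k (\int[mu]_(x in A) q x 0 k)%R) 0 i =
  (\int[mu]_(x in A) (\sum_(i <- s) a 0 i * q x 0 i))%R.
  elim=> [|i s [IHi IHs]].
    rewrite big_nil; split.
      rewrite (_ : _ \o _ = cst 0%E); first exact: integrable0.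
      by apply/funext => x /=; rewrite big_nil.
    under eq_Rintegral do rewrite big_nil.
    by rewrite /Rintegral integral0.
  have ai : mu.-integrable A (EFin \o (fun x => a 0 i * q x 0 i)).
    exact: (integrableZl mA (a 0 i) (qi i)).
  split.
    have := integrableD mA ai IHi; congr (_.-integrable _ _).
    by apply/funext => x /=; rewrite big_cons EFinD.
  rewrite big_cons IHs mxE -RintegralZl// -RintegralD//.
  by apply: eq_Rintegral => x _; rewrite big_cons.
by move=> /(_ (index_enum 'I_m))[].
Qed.

End linear_functional.

(** * Linear forms on states and the Euler flux *)

Section euler_states.
Context (R : realType) (n : nat).
Implicit Types (u : 'rV[R]_(1 + n + 1)) (w v : 'rV[R]_n).

Lemma dot_row_mx m1 m2 (a : 'rV[R]_m1) (b : 'rV[R]_m2) (u : 'rV[R]_(m1 + m2)) :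
  dot (row_mx a b) u = dot a (lsubmx u) + dot b (rsubmx u).
Proof.
rewrite /dot big_split_ord/=; congr (_ + _); apply: eq_bigr => i _.
  by rewrite row_mxEl mxE.
by rewrite row_mxEr mxE.
Qed.

Definition state_form (c : R) v (e : R) : 'rV[R]_(1 + n + 1) :=
  row_mx (row_mx (const_mx c) v) (const_mx e).

Lemma dot_state_form c v e u :
  dot (state_form c v e) u = c * rho u + dot v (mom u) + e * energy u.
Proof.
rewrite /state_form !dot_row_mx; congr (_ + _ + _).
  by rewrite /dot big_ord1 mxE.
by rewrite /dot big_ord1 mxE.
Qed.

Lemma internal_energyE u : rho u != 0 ->
  internal_energy u = energy u - 2^-1 * (rho u)^-1 * dot (mom u) (mom u).
Proof.
move=> r0; rewrite /internal_energy /spec_energy sqr_enorm /velocity dotZl dotZr.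
by field.
Qed.

(** Completing the square: for positive density the form equals rho (e + |v - m / rho|^2 / 2), which
    is smallest at [v = velocity u]. *)
Lemma admissibleP u : admissible u <->
  0 < rho u /\ forall v, 0 < dot (state_form (2^-1 * dot v v) (- v) 1) u.
Proof.
have key v : 0 < rho u -> dot (state_form (2^-1 * dot v v) (- v) 1) u =
    rho u * (spec_energy u + 2^-1 * dot (v - velocity u) (v - velocity u)).
  move=> r0; have rn : rho u != 0 by rewrite gt_eqF.
  rewrite mulrDr -/(internal_energy u) internal_energyE// dot_state_form.
  rewrite dotBl !dotBr /velocity !(dotZl, dotZr) -scaleN1r dotZl (dotC (mom u) v).
  by field.
split=> [[r0 e0]|[r0 h]]; split => //.
  by move=> v; rewrite key// mulr_gt0// ltr_wpDr// mulr_ge0// ?dot_ge0// invr_ge0.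
have := h (velocity u); rewrite key// subrr dot0r mulr0 addr0.
by rewrite pmulr_rgt0.
Qed.

Lemma internal_energy_le_form v u : 0 < rho u ->
  internal_energy u <= dot (state_form (2^-1 * dot v v) (- v) 1) u.
Proof.
move=> r0; have rn : rho u != 0 by rewrite gt_eqF.
have -> : dot (state_form (2^-1 * dot v v) (- v) 1) u =
    internal_energy u + rho u * (2^-1 * dot (v - velocity u) (v - velocity u)).
  rewrite internal_energyE// dot_state_form.
  rewrite dotBl !dotBr /velocity !(dotZl, dotZr) -scaleN1r dotZl (dotC (mom u) v).
  by field.
by rewrite lerDl mulr_ge0 ?(ltW r0)// mulr_ge0// ?dot_ge0// invr_ge0.
Qed.

Lemma rho_form u : rho u = dot (state_form 1 0 0) u.
Proof. by rewrite dot_state_form mul1r mul0r addr0 dotC dot0r addr0. Qed.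

Lemma energy_form u : energy u = dot (state_form 0 0 1) u.
Proof. by rewrite dot_state_form mul1r mul0r dotC dot0r addr0 add0r. Qed.

Lemma mom_form w u : dot w (mom u) = dot (state_form 0 w 0) u.
Proof. by rewrite dot_state_form !mul0r addr0 add0r. Qed.

Section flux.
Context (gamma : R).

Lemma flux_dotE u w : flux_dot gamma u w =
  row_mx (row_mx (w *m (mom u)^T)
    (w *m ((velocity u)^T *m mom u + (pressure gamma u)%:M)^T))
    (w *m ((energy u + pressure gamma u) *: velocity u)^T).
Proof. by rewrite /flux_dot /flux !tr_col_mx !mul_mx_row. Qed.

Lemma mul_dot w v : (w *m v^T) 0 0 = dot w v.
Proof. by rewrite mxE; apply: eq_bigr => i _; rewrite mxE. Qed.

Lemma rho_flux u w : rho (flux_dot gamma u w) = dot w (mom u).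
Proof. by rewrite /rho flux_dotE !row_mxKl mul_dot. Qed.

Lemma energy_flux u w :
  energy (flux_dot gamma u w) = (energy u + pressure gamma u) * dot w (velocity u).
Proof. by rewrite /energy flux_dotE row_mxKr mul_dot dotZr. Qed.

Lemma flux_dotZr u c w : flux_dot gamma u (c *: w) = c *: flux_dot gamma u w.
Proof. by rewrite /flux_dot -scalemxAl. Qed.

Lemma flux_dot0r u : flux_dot gamma u 0 = 0.
Proof. by rewrite /flux_dot mul0mx. Qed.

Lemma flux_dot_sumr (I : Type) (s : seq I) (Q : pred I) u (f : I -> 'rV[R]_n) :
  flux_dot gamma u (\sum_(i <- s | Q i) f i) = \sum_(i <- s | Q i) flux_dot gamma u (f i).
Proof. by rewrite /flux_dot mulmx_suml. Qed.

End flux.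

End euler_states.

Section riemann.
Context (R : realType) (n : nat) (gamma : R) (w : 'rV[R]_n).
Context (uL uR : 'rV[R]_(1 + n + 1)) (lam : R) (Q : R -> 'rV[R]_(1 + n + 1)).
Local Notation mu := (@lebesgue_measure R).
Local Notation f u := (flux_dot gamma u w).
Hypotheses (gamma1 : 1 < gamma) (aL : admissible uL) (aR : admissible uR)
  (lam0 : 0 <= lam) (QS : riemann_solution gamma w uL uR Q)
  (Qfan : forall xi, (xi < - lam -> Q xi = uL) /\ (lam < xi -> Q xi = uR)).

Let mQ k : measurable_fun [set: R] (fun xi => Q xi 0 k).
Proof. by case: QS => mQ _ _ _ _; exact: mQ. Qed.

Let bQ : bounded_fun Q. Proof. by case: QS. Qed.

Let Qadm xi : admissible (Q xi) \/ Q xi = 0. Proof. by case: QS. Qed.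

Lemma measurable_ray (a : 'rV[R]_(1 + n + 1)) (h : R -> R) :
  measurable_fun [set: R] h -> measurable_fun [set: R] (fun x => dot a (Q (h x))).
Proof.
by move=> mh; exact: (measurableT_comp (measurable_dot a mQ) mh).
Qed.

Lemma bounded_ray (a : 'rV[R]_(1 + n + 1)) (h : R -> R) :
  bounded_fun (fun x => dot a (Q (h x))).
Proof.
have [M [Mr hM]] := bounded_dot a bQ; exists M; split => // r Mr' x _.
exact: hM.
Qed.

Lemma measurable_divr (t : R) : measurable_fun [set: R] (fun x : R => x / t).
Proof.
by apply: measurable_funM; [exact: measurable_id|exact: measurable_cst].
Qed.

Lemma measurable_ldivr (x : R) : measurable_fun [set: R] (fun t : R => x / t).
Proof.
by apply: measurable_funM; [exact: measurable_cst|exact: measurable_inv].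
Qed.

Lemma dotE (k : 'I_(1 + n + 1)) (u : 'rV[R]_(1 + n + 1)) : u 0 k = dot (delta_mx 0 k) u.
Proof.
rewrite /dot (bigD1 k)//= mxE !eqxx mul1r big1 ?addr0// => i ik.
by rewrite mxE (negbTE ik) andbF mul0r.
Qed.

Lemma riemann_balance (a : 'rV[R]_(1 + n + 1)) (x1 x2 t : R) : x1 < x2 -> 0 < t ->
  (\int[mu]_(x in `[x1, x2]) dot a (Q (x / t)))%R
  - dot a (state_integral `[x1, x2] (riemann_data uL uR))
  + dot a (state_integral `[0, t] (fun s => f (Q (x2 / s))))
  - dot a (state_integral `[0, t] (fun s => f (Q (x1 / s)))) = 0.
Proof.
case: QS => _ _ _ + _ => /[apply] /[apply] /(congr1 (dot a)).
rewrite dotBr dotDr dotBr dot0r.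
suff -> : dot a (state_integral `[x1, x2] (fun x => Q (x / t))) =
    (\int[mu]_(x in `[x1, x2]) dot a (Q (x / t)))%R by [].
apply: dot_integral => // k.
rewrite (_ : _ \o _ = EFin \o (fun x => dot (delta_mx 0 k) (Q (x / t)))); last first.
  by apply/funext => x /=; rewrite -dotE.
apply: integrable_bounded_itv; last exact: bounded_ray.
by apply: measurable_ray; exact: measurable_divr.
Qed.

Lemma mass_balance (x1 x2 t : R) : x1 < x2 -> 0 < t ->
  (\int[mu]_(x in `[x1, x2]) dot (state_form 1 0 0) (Q (x / t)))%R
  - rho (state_integral `[x1, x2] (riemann_data uL uR))
  + rho (state_integral `[0, t] (fun s => f (Q (x2 / s))))
  - rho (state_integral `[0, t] (fun s => f (Q (x1 / s)))) = 0.
Proof.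
move=> x12 t0; have := riemann_balance (state_form 1 0 0) x12 t0.
move: (state_integral _ (riemann_data _ _)) (state_integral _ (fun s => f (Q (x2 / s))))
  (state_integral _ (fun s => f (Q (x1 / s)))) => A1 A2 A3.
by rewrite -(rho_form A1) -(rho_form A2) -(rho_form A3).
Qed.

Lemma state_integral_cst (q : R -> 'rV[R]_(1 + n + 1)) (a b : R) c : a <= b ->
  (forall s, a < s < b -> q s = c) -> state_integral `[a, b] q = (b - a) *: c.
Proof.
move=> ab qc; apply/rowP => k; rewrite !mxE (Rintegral_cst_oo (c := c 0 k))//.
  by rewrite mulrC.
by move=> s /qc ->.
Qed.

Lemma data_integral (x1 x2 : R) : x1 <= 0 <= x2 ->
  state_integral `[x1, x2] (riemann_data uL uR) = x2 *: uR - x1 *: uL.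
Proof.
move=> x12; have /andP[x10 x20] := x12; apply/rowP => k; rewrite !mxE.
have md : measurable_fun [set: R] (fun x => riemann_data uL uR x 0 k).
  rewrite (_ : (fun x => _) = fun x : R => if x < 0 then uL 0 k else uR 0 k).
    by apply: measurable_fun_ifT => //; apply: measurable_fun_ltr.
  by apply/funext => x; rewrite /riemann_data; case: ifP.
rewrite (Rintegral_itv_split x12); last first.
  apply: integrable_bounded_itv => //.
  exists (`|uL 0 k| + `|uR 0 k|); split; first exact: num_real.
  move=> r rM x _; apply: le_trans (ltW rM); rewrite /riemann_data.
  by case: ifP => _; rewrite ?lerDl ?lerDr.
rewrite (Rintegral_cst_oo (c := uL 0 k))//; last first.
  by move=> s /andP[_ s0]; rewrite /riemann_data s0.
rewrite (Rintegral_cst_oo (c := uR 0 k))//; last first.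
  by move=> s /andP[s0 _]; rewrite /riemann_data ltNge ltW.
by ring.
Qed.

(** At times [s < t] the point [X] has not been reached by the fan, as [X / s > lam]; the hypothesis
    [0 < X] covers [lam = 0]. *)
Lemma flux_right (X t : R) : 0 < t -> lam * t <= X -> 0 < X ->
  state_integral `[0, t] (fun s => f (Q (X / s))) = t *: f uR.
Proof.
move=> t0 lX X0; rewrite (@state_integral_cst _ _ _ (f uR)) ?subr0// ?ltW//.
move=> s /andP[s0 st]; have [_ ->//] := Qfan (X / s).
by rewrite ltr_pdivlMr//; nra.
Qed.

Lemma flux_left (X t : R) : 0 < t -> lam * t <= X -> 0 < X ->
  state_integral `[0, t] (fun s => f (Q (- X / s))) = t *: f uL.
Proof.
move=> t0 lX X0; rewrite (@state_integral_cst _ _ _ (f uL)) ?subr0// ?ltW//.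
move=> s /andP[s0 st]; have [->//] := Qfan (- X / s).
by rewrite ltr_pdivrMr//; nra.
Qed.

Lemma fan_balance (a : 'rV[R]_(1 + n + 1)) (X t : R) : 0 < t -> lam * t <= X -> 0 < X ->
  (\int[mu]_(x in `[- X, X]) dot a (Q (x / t)))%R =
  dot a (X *: (uL + uR) - t *: (f uR - f uL)).
Proof.
move=> t0 lX X0; have XX : - X < X by lra.
have := riemann_balance a XX t0; rewrite data_integral; last by apply/andP; lra.
rewrite flux_right// flux_left//.
rewrite !(dotBr, dotDr, dotZr, dotNr); lra.
Qed.

End riemann.

(** The solution is a single stationary jump, and the balance on [[-1, 1]] up to time 1 leaves only
    the flux difference: the Rankine-Hugoniot condition. *)
Lemma wave_speed_zero (R : realType) n (gamma : R) (w : 'rV[R]_n) uL uR :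
  wave_speed_bound gamma w uL uR 0 -> flux_dot gamma uR w = flux_dot gamma uL w.
Proof.
move=> [_ [Q QS Qfan]]; apply/rowP => k.
have l1 : (0 : R) * 1 <= 1 by rewrite mul0r.
have := fan_balance QS Qfan (delta_mx 0 k) ltr01 l1 ltr01.
rewrite (Rintegral_itv_split (x := 0)); last 2 first.
- by rewrite lerN10 ler01.
- apply: integrable_bounded_itv; last exact: (bounded_ray QS).
  by apply: (measurable_ray QS); exact: measurable_divr.
rewrite (Rintegral_cst_oo (c := dot (delta_mx 0 k) uL)); last 2 first.
- by rewrite lerN10.
- move=> s /andP[_ s0]; rewrite divr1; have [->//] := Qfan s.
  by rewrite oppr0.
rewrite (Rintegral_cst_oo (c := dot (delta_mx 0 k) uR))//; last first.
  by move=> s /andP[s0 _]; rewrite divr1; have [_ ->] := Qfan s.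
rewrite (dotE k (flux_dot _ uR w)) (dotE k (flux_dot _ uL w)).
rewrite !(dotBr, dotDr, dotZr); lra.
Qed.

(** * Admissibility of the mean of a fan *)

Section fan.
Context (R : realType) (n : nat) (gamma : R) (w : 'rV[R]_n).
Context (uL uR : 'rV[R]_(1 + n + 1)) (lam : R) (Q : R -> 'rV[R]_(1 + n + 1)).
Local Notation mu := (@lebesgue_measure R).
Local Notation f u := (flux_dot gamma u w).
Hypotheses (gamma1 : 1 < gamma) (aL : admissible uL) (aR : admissible uR)
  (lam0 : 0 < lam) (QS : riemann_solution gamma w uL uR Q)
  (Qfan : forall xi, (xi < - lam -> Q xi = uL) /\ (lam < xi -> Q xi = uR)).

Let Qadm xi : admissible (Q xi) \/ Q xi = 0. Proof. by case: QS. Qed.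

(** The balance on [- lam t, lam t] divided by its length; for lam = d_ij / |c_ij| and w = n_ij it
    is the auxiliary state. *)
Definition fan_mean : 'rV[R]_(1 + n + 1) :=
  2^-1 *: (uL + uR) - (2 * lam)^-1 *: (f uR - f uL).

Lemma fan_mean_integral (a : 'rV[R]_(1 + n + 1)) (t : R) : 0 < t ->
  (\int[mu]_(x in `[- (lam * t), lam * t]) dot a (Q (x / t)))%R =
  2 * lam * t * dot a fan_mean.
Proof.
move=> t0; rewrite (fan_balance QS Qfan a t0) ?mulr_gt0// /fan_mean.
by rewrite !(dotBr, dotDr, dotZr); field; rewrite gt_eqF.
Qed.

Lemma integrable_ray (a : 'rV[R]_(1 + n + 1)) (t x1 x2 : R) (b1 b2 : bool) :
  mu.-integrable [set` Interval (BSide b1 x1) (BSide b2 x2)]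
    (EFin \o (fun x => dot a (Q (x / t)))).
Proof.
apply: integrable_bounded_itv; last exact: (bounded_ray QS).
by apply: (measurable_ray QS); exact: measurable_divr.
Qed.

Lemma ray_integral_eq0 (b : 'rV[R]_(1 + n + 1)) (t x1 x2 : R) :
  (\int[mu]_(x in `[x1, x2]) `|(dot b (Q (x / t)))%:E| = 0)%E ->
  (\int[mu]_(x in `[x1, x2]) dot b (Q (x / t)))%R = 0.
Proof.
move=> abs0; apply/normr0_eq0/eqP; rewrite eq_le normr_ge0 andbT.
apply: le_trans (le_normr_Rintegral _ (integrable_ray b t x1 x2 _ _)) _ => //.
by rewrite /Rintegral (_ : (\int[mu]_(x in _) _)%E = 0%E)//; move: abs0.
Qed.

Section vacuum.
Context (a : 'rV[R]_(1 + n + 1)).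
Hypotheses (apos : forall u, admissible u -> 0 < dot a u)
  (amean : dot a fan_mean <= 0).

Let g_ge0 xi : 0 <= dot a (Q xi).
Proof. by case: (Qadm xi) => [/apos/ltW//|->]; rewrite dot0r. Qed.

(** A nonnegative function with integral at most 0 vanishes almost everywhere. As [a] is positive on
    admissible states, [Q] is vacuum wherever this happens, and every other form [b] vanishes
    too. *)
Lemma vacuum_ae (t : R) : 0 < t ->
  ae_eq mu (`[- (lam * t), lam * t]%classic) (fun x => (dot a (Q (x / t)))%:E) (cst 0%E).
Proof.
move=> t0.
have mg : measurable_fun [set: R] (fun x => dot a (Q (x / t))).
  by apply: (measurable_ray QS); exact: measurable_divr.
apply/ae_eq_integral_abs => //; first exact/measurable_EFinP/measurable_funTS.
have -> : (\int[mu]_(x in `[(- (lam * t))%R, (lam * t)%R]) `|(dot a (Q (x / t)))%:E| =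
    \int[mu]_(x in `[(- (lam * t))%R, (lam * t)%R]) (dot a (Q (x / t)))%:E)%E.
  by apply: eq_integral => x _; rewrite gee0_abs// lee_fin.
rewrite -[LHS]fineK; last exact: integrable_fin_num (integrable_ray _ _ _ _ _ _).
congr (_%:E); have := fan_mean_integral a t0; rewrite /Rintegral => E.
apply/eqP; rewrite eq_le [X in X <= _]E; apply/andP; split.
  by rewrite mulr_ge0_le0// ltW// !mulr_gt0.
by apply: fine_ge0; apply: integral_ge0 => x _; rewrite lee_fin.
Qed.

Lemma vacuum_abs (b : 'rV[R]_(1 + n + 1)) (t x1 x2 : R) : 0 < t ->
  - (lam * t) <= x1 -> x2 <= lam * t ->
  (\int[mu]_(x in `[x1, x2]) `|(dot b (Q (x / t)))%:E| = 0)%E.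
Proof.
move=> t0 lx1 lx2.
have mg : measurable_fun [set: R] (fun x => dot b (Q (x / t))).
  by apply: (measurable_ray QS); exact: measurable_divr.
apply/ae_eq_integral_abs => //; first exact/measurable_EFinP/measurable_funTS.
apply: filterS (vacuum_ae t0) => x h; rewrite /= in_itv/= => /andP[xa xb].
have xI : x \in `[- (lam * t), lam * t].
  by rewrite in_itv/=; apply/andP; split; lra.
have [E] := h xI.
by case: (Qadm (x / t)) => [/apos|->]; [rewrite E ltxx|rewrite dot0r].
Qed.

Lemma vacuum_integral (b : 'rV[R]_(1 + n + 1)) (t x1 x2 : R) : 0 < t ->
  - (lam * t) <= x1 -> x2 <= lam * t ->
  (\int[mu]_(x in `[x1, x2]) dot b (Q (x / t)))%R = 0.
Proof. by move=> t0 lx1 lx2; apply: ray_integral_eq0; apply: vacuum_abs. Qed.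

Lemma vacuum_mean0 : fan_mean = 0.
Proof.
apply/rowP => k; rewrite [RHS]mxE (dotE k).
have l1 : lam * 1 <= lam * 1 by [].
have := fan_mean_integral (delta_mx 0 k) ltr01.
rewrite vacuum_integral// => /esym/eqP.
rewrite mulr1 mulf_eq0 => /orP[|/eqP//].
by rewrite mulf_eq0 pnatr_eq0/= gt_eqF.
Qed.

End vacuum.

Lemma rho_integral (A : set R) (q : R -> 'rV[R]_(1 + n + 1)) :
  rho (state_integral A q) = (\int[mu]_(x in A) rho (q x))%R.
Proof.
rewrite /rho !mxE; apply: eq_Rintegral => x _.
by rewrite !mxE.
Qed.

(* If the fan is vacuum, the mass balance forces the fluid on the left to leave
   with speed exactly lam: the mass flux along the rays x = const < 0 is a
   constant, and it vanishes after integration in x, by Fubini. *)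
Section edge.
Hypothesis vac : forall (b : 'rV[R]_(1 + n + 1)) (t x1 x2 : R), 0 < t ->
  - (lam * t) <= x1 -> x2 <= lam * t ->
  (\int[mu]_(x in `[x1, x2]) `|(dot b (Q (x / t)))%:E| = 0)%E.

Let vac_int (b : 'rV[R]_(1 + n + 1)) (t x1 x2 : R) : 0 < t ->
  - (lam * t) <= x1 -> x2 <= lam * t ->
  (\int[mu]_(x in `[x1, x2]) dot b (Q (x / t)))%R = 0.
Proof. by move=> t0 lx1 lx2; apply: ray_integral_eq0; apply: vac. Qed.

(** Mass flux of the left state through the moving edge x = - lam t; it is 0 exactly when the left
    fluid travels with that edge. *)
Let C : R := lam * rho uL + dot w (mom uL).
Let qf (b : R) := dot (state_form 0 w 0) (Q b).

Let measurable_qf x : measurable_fun [set: R] (fun s => qf (x / s)).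
Proof. by apply: (measurable_ray QS); exact: measurable_ldivr. Qed.

Let integrable_qf x (t1 t2 : R) (b1 b2 : bool) :
  mu.-integrable [set` Interval (BSide b1 t1) (BSide b2 t2)] (EFin \o (fun s => qf (x / s))).
Proof.
by apply: integrable_bounded_itv; [exact: measurable_qf|exact: (bounded_ray QS)].
Qed.

(** Mass balance on [[- X, x]]: at time [t] only the part left of - lam t carries mass. The 1 in [X]
    places the left end outside the fan. *)
Lemma edge_flux x t : x < 0 -> 0 < t -> - x <= lam * t ->
  (\int[mu]_(s in `[0, t]) qf (x / s))%R = rho uL * x + t * C.
Proof.
move=> x0 t0 xt; pose X := lam * t + 1.
have X0 : 0 < X by rewrite ltr_wpDl// mulr_ge0// ltW.
have Xt : lam * t <= X by rewrite lerDl.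
have Xx : - X < x by rewrite /X; lra.
have := mass_balance QS Xx t0; rewrite (flux_left gamma w Qfan t0 Xt X0).
rewrite (@state_integral_cst _ _ _ _ _ uL) ?(ltW Xx)//; last first.
  by move=> s /andP[_ sx]; rewrite /riemann_data (lt_trans sx x0).
rewrite (Rintegral_itv_split (x := - (lam * t))); last 2 first.
- by apply/andP; split; rewrite /X; lra.
- exact: integrable_ray.
rewrite (@vac_int _ t (- (lam * t)) x)//; last by have := mulr_gt0 lam0 t0; lra.
rewrite (Rintegral_cst_oo (c := rho uL)); last 2 first.
- by rewrite /X; lra.
- move=> s /andP[_ sl]; rewrite rho_form; have [->//] := Qfan (s / t).
  by rewrite ltr_pdivrMr// mulNr.
rewrite rho_integral; under eq_Rintegral do rewrite rho_flux mom_form -/(qf _).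
rewrite (rho_form (_ *: uL)) (rho_form (_ *: _)) !dotZr -!rho_form rho_flux /C /X; lra.
Qed.

Lemma edge_speed : C = 0.
Proof.
apply/eqP/contraT => C0; exfalso.
(* From time 3 / lam on, all of [[-2, -1]] is inside the fan; subtracting the balances at the two
   times cancels the term in [x]. *)
pose t1 := 3 / lam; pose t2 := 4 / lam.
have t10 : 0 < t1 by rewrite divr_gt0.
have t12 : t1 < t2 by rewrite ltr_pM2r ?invr_gt0// ltr_nat.
have lt1 : lam * t1 = 3 by rewrite /t1 mulrC divfK// gt_eqF.
have lt2 : lam * t2 = 4 by rewrite /t2 mulrC divfK// gt_eqF.
have qfC x : -2 <= x <= -1 -> (\int[mu]_(s in `[t1, t2]) qf (x / s))%R = (t2 - t1) * C.
  move=> /andP[x2 x1].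
  have x0 : x < 0 by lra.
  have := @edge_flux x t2 x0 (lt_trans t10 t12) ltac:(rewrite lt2; lra).
  rewrite (Rintegral_itv_split (x := t1)); last 2 first.
  - by rewrite !ltW.
  - exact: integrable_qf.
  rewrite (@edge_flux x t1 x0 t10) ?lt1; last by lra.
  lra.
pose A : set R := `[(-2)%R, (-1)%R]%classic.
pose B : set R := `[t1, t2]%classic.
(* [H] is |qf| cut off to the rectangle: integrated first in [x] it gives 0 by vacuum, integrated
   first in time it gives at least (t2 - t1) |C| for each [x] in [A]. *)
pose H (p : measurableTypeR R * measurableTypeR R) : \bar R :=
  (`|qf (p.1 / p.2)| * (\1_A p.1 * \1_B p.2))%:E.
have mH : measurable_fun setT H.
  apply/measurable_EFinP; apply: measurable_funM.
    apply: measurableT_comp => //.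
    apply: (@measurableT_comp _ _ _ _ _ _ (fun xi => qf xi)).
      exact: (measurable_ray QS (state_form 0 w 0) (@measurable_id _ _ _)).
    apply: measurable_funM; first exact: measurable_fst.
    have mi : measurable_fun [set: measurableTypeR R] (fun s : R => s^-1).
      exact: measurable_inv.
    by apply: (measurableT_comp mi); exact: measurable_snd.
  have mA : measurable_fun [set: measurableTypeR R] (\1_A : R -> R).
    by apply: measurable_indic; exact: measurable_itv.
  have mB : measurable_fun [set: measurableTypeR R] (\1_B : R -> R).
    by apply: measurable_indic; exact: measurable_itv.
  by apply: measurable_funM; [exact: (measurableT_comp mA (@measurable_fst _ _ _ _))|
    exact: (measurableT_comp mB (@measurable_snd _ _ _ _))].
have H0 p : (0 <= H p)%E by rewrite lee_fin mulr_ge0// mulr_ge0.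
have := fubini_tonelli (m1 := mu) (m2 := mu) H mH H0.
rewrite [RHS]integral0_eq; last first.
  move=> s _; have [sB|sB] := pselect (B s); last first.
    apply: integral0_eq => x _; rewrite /H/= [\1_B _]indicE memNset//.
    by rewrite mulr0 mulr0.
  have := @vac (state_form 0 w 0) s (-2) (-1).
  have s0 : 0 < s by move: sB; rewrite /B/= in_itv/= => /andP[? _]; lra.
  have ls : 3 <= lam * s.
    by rewrite -lt1 ler_pM2l//; move: sB; rewrite /B/= in_itv/= => /andP[].
  move=> /(_ s0 ltac:(lra) ltac:(lra)) <-.
  rewrite [RHS]integral_mkcond; apply: eq_integral => x _.
  rewrite patchE /H/= !indicE (mem_set sB) mulr1 -/A.
  by case: ifP => h; rewrite ?h ?mulr1 ?mulr0.
apply/eqP; rewrite gt_eqF//.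
pose c := (t2 - t1) * `|C|.
have c0 : 0 < c by rewrite mulr_gt0 ?subr_gt0 ?normr_gt0.
apply: (@lt_le_trans _ _ (\int[mu]_x (c * \1_A x)%:E)%E).
  under eq_integral do rewrite EFinM.
  rewrite ge0_integralZl_EFin ?ltW//; last first.
    by apply/measurable_EFinP; apply: measurable_indic; exact: measurable_itv.
  rewrite integral_indic//=; last exact: measurable_itv.
  rewrite setIT mule_gt0//.
  rewrite /A /= lebesgue_measure_itv/= lte_fin ifT; last by lra.
  by rewrite -EFinD lte_fin; lra.
apply: ge0_le_integral => //.
- by move=> x _; rewrite lee_fin mulr_ge0// ltW.
- by apply/measurable_EFinP; apply: measurable_funM => //; apply: measurable_indic; exact: measurable_itv.
- exact: (@measurable_fun_fubini_tonelli_F _ _ _ _ _ mu H mH H0).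
move=> x _; have [xA|xA] := pselect (A x); last first.
  by rewrite indicE memNset// mulr0; apply: integral_ge0.
rewrite indicE mem_set// mulr1.
have -> : (\int[mu]_y H (x, y) = \int[mu]_(s in B) (`|qf (x / s)|)%:E)%E.
  rewrite [RHS]integral_mkcond; apply: eq_integral => s _.
  rewrite patchE /H/= !indicE (mem_set xA) mul1r.
  by case: ifP => h; rewrite ?h ?mulr1 ?mulr0.
have intq := @integrable_qf x t1 t2 true false.
rewrite -[leRHS]fineK; last first.
  have iq := integrable_abse intq.
  by apply: integrable_fin_num iq.
rewrite lee_fin /c -[t2 - t1]gtr0_norm ?subr_gt0// -normrM -(@qfC x).
  exact: (le_normr_Rintegral _ intq).
by move: xA; rewrite /A/= in_itv.
Qed.

End edge.

(* A linear form that is positive on admissible states can only fail to be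
   positive on the mean if the whole fan is vacuum; then the energy of the mean,
   which is 0, would also be - (pL + pR) / 2. *)
Theorem fan_mean_admissible : admissible fan_mean.
Proof.
have pos (a : 'rV[R]_(1 + n + 1)) : (forall u, admissible u -> 0 < dot a u) ->
    0 < dot a fan_mean.
  move=> apos; rewrite ltNge; apply/negP => amean.
  have mean0 := vacuum_mean0 apos amean.
  have C0 := edge_speed (vacuum_abs apos amean).
  have rL := aL.1; have rR := aR.1.
  have M0 : dot (state_form 1 0 0) fan_mean = 0 by rewrite mean0 dot0r.
  have E0 : dot (state_form 0 0 1) fan_mean = 0 by rewrite mean0 dot0r.
  move: M0 E0; rewrite /fan_mean !(dotBr, dotDr, dotZr) -!rho_form -!energy_form.
  rewrite !rho_flux !energy_flux /velocity !dotZr.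
  have pL : 0 < pressure gamma uL.
    by have eL := aL.2; rewrite /pressure mulr_gt0// mulr_gt0// subr_gt0.
  have pR : 0 < pressure gamma uR.
    by have eR := aR.2; rewrite /pressure mulr_gt0// mulr_gt0// subr_gt0.
  have mL : dot w (mom uL) = - lam * rho uL by lra.
  have ln : lam != 0 by rewrite gt_eqF.
  have rLn : rho uL != 0 by rewrite gt_eqF.
  have rRn : rho uR != 0 by rewrite gt_eqF.
  rewrite mL => M0.
  (* The mass of the mean is 0 as well, which settles the right edge without a second Fubini
     argument. *)
  have mR : dot w (mom uR) = lam * rho uR.
    apply: (mulfI (x := (2 * lam)^-1)); first by rewrite invr_eq0 mulf_neq0.
    have -> : (2 * lam)^-1 * (lam * rho uR) = 2^-1 * rho uR by field.
    move: M0; rewrite mulrBr.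
    have -> : (2 * lam)^-1 * (- lam * rho uL) = - (2^-1 * rho uL) by field.
    lra.
  rewrite mR => E0.
  have E1 : 2^-1 * (pressure gamma uL + pressure gamma uR) = 0.
    rewrite -[LHS]opprK -oppr0; congr (- _); rewrite -{}E0.
    by field; rewrite rLn rRn.
  lra.
apply/admissibleP; split; first by rewrite rho_form; apply: pos => u [+ _]; rewrite rho_form.
by move=> v; apply: pos => u /admissibleP[_]; apply.
Qed.

End fan.

(** * The limited forward Euler step *)

Section finmin.
Context (R : realType) (V : finType).
Implicit Types (A : {set V}) (f : V -> R).

Lemma finmin_le A f j : j \in A -> finmin A f <= f j.
Proof.
move=> jA; apply: ge_inf; last by exists j.
exists (- \sum_i `|f i|) => _ [i _ <-].
have : `|f i| <= \sum_i `|f i| by rewrite (bigD1 i)//= lerDl sumr_ge0.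
have := ler_norm (- f i); rewrite normrN; lra.
Qed.

Lemma le_finmin A f x j0 : j0 \in A -> (forall j, j \in A -> x <= f j) -> x <= finmin A f.
Proof.
move=> j0A h; apply: lb_le_inf; first by exists (f j0), j0.
by move=> _ [j jA <-]; exact: h.
Qed.

Lemma finmin_gt0 A f j0 : j0 \in A -> (forall j, j \in A -> 0 < f j) -> 0 < finmin A f.
Proof.
move=> j0A h.
have [j jA hj] : exists2 j, j \in A & forall i, i \in A -> f j <= f i.
  by case: (@arg_minP _ _ _ j0 (mem A) f j0A) => j jA hj; exists j.
by apply: lt_le_trans (h _ jA) _; exact: le_finmin jA hj.
Qed.

(** The empty set is included, since [inf] of it is 0. *)
Lemma finmin_ge0 A f : (forall j, j \in A -> 0 <= f j) -> 0 <= finmin A f.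
Proof.
move=> h; have [->|[j jA]] := set_0Vmem A; last exact: le_finmin jA h.
rewrite /finmin (_ : [set f j | j in _] = set0) ?inf0//.
by apply/seteqP; split => // t [j]; rewrite /= finset.in_set0.
Qed.

End finmin.

Section admissible_convex.
Context (R : realType) (n : nat).
Implicit Types (u W P : 'rV[R]_(1 + n + 1)).

Lemma dot_sumr m (I : Type) (s : seq I) (Q : pred I) (a : 'rV[R]_m) (f : I -> 'rV[R]_m) :
  dot a (\sum_(i <- s | Q i) f i) = \sum_(i <- s | Q i) dot a (f i).
Proof.
by apply: (big_morph (dot a)) => [x y|]; [exact: dotDr|exact: dot0r].
Qed.

(* Admissibility is positivity of a family of linear forms. *)
Lemma admissible_forms u :
  (forall a : 'rV[R]_(1 + n + 1),
    (forall u', admissible u' -> 0 < dot a u') -> 0 < dot a u) -> admissible u.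
Proof.
move=> h; apply/admissibleP; split.
  by rewrite rho_form; apply: h => u' [+ _]; rewrite rho_form.
by move=> v; apply: h => u' /admissibleP[_]; apply.
Qed.

(** If a positive form vanished on the sum, all weights would be 0, against their sum being 1.
    Points of weight 0 are exempt, which accommodates auxiliary states with d_ij = 0. *)
Lemma admissible_conv (V : finType) (A : {set V}) (om : V -> R) (x : V -> 'rV[R]_(1 + n + 1)) :
  (forall j, j \in A -> 0 <= om j) -> \sum_(j in A) om j = 1 ->
  (forall j, j \in A -> 0 < om j -> admissible (x j)) ->
  admissible (\sum_(j in A) om j *: x j).
Proof.
move=> om0 om1 ax; apply: admissible_forms => a apos.
rewrite dot_sumr; under eq_bigr do rewrite dotZr.
have t0 j : j \in A -> 0 <= om j * dot a (x j).
  move=> jA; have := om0 j jA; rewrite le_eqVlt => /orP[/eqP <-|o]; first by rewrite mul0r.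
  by rewrite mulr_ge0 ?ltW// apos//; exact: ax.
rewrite lt_neqAle sumr_ge0// andbT eq_sym psumr_eq0//.
apply/negP => /allP h; have : \sum_(j in A) om j = 0.
  apply: big1 => j jA; have := h j (mem_index_enum _); rewrite jA/= => /eqP oj.
  have := om0 j jA; rewrite le_eqVlt => /orP[/eqP <-//|o].
  have := apos _ (ax j jA o) => dj.
  by move: oj; have := mulr_gt0 o dj => + oj; rewrite oj ltxx.
by rewrite om1 => /eqP; rewrite oner_eq0.
Qed.

Lemma admissible_segment W P (s th : R) : admissible W -> admissible (W + s *: P) ->
  0 <= th <= s -> admissible (W + th *: P).
Proof.
move=> aW aP /andP[t0 ts]; apply: admissible_forms => a apos.
have := apos _ aW; have := apos _ aP; rewrite !dotDr !dotZr.
by have [p0|p0] := leP 0 (dot a P); nra.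
Qed.

Context (gamma : R).

Lemma Phi_gt0 u : admissible u -> 0 < Phi gamma u.
Proof.
move=> [r0 e0]; rewrite /Phi mulr_gt0 ?powR_gt0//.
by rewrite /internal_energy mulr_gt0.
Qed.

(* The supremum of the parameters satisfying the bounds yields an admissible
   state: on this set the forms defining admissibility have a positive lower
   bound, which passes to the supremum because they are affine. *)
Lemma admissible_sup W P (r0 r1 p0 : R) : 1 < gamma -> admissible W -> 0 < r0 -> 0 < p0 ->
  let S := [set l | let u := W + l *: P in
    [/\ 0 <= l <= 1, r0 <= rho u, r1 <= - rho u & p0 <= Phi gamma u]] in
  0 <= sup S /\ forall th, 0 <= th <= sup S -> admissible (W + th *: P).
Proof.
move=> g1 aW rp pp S.
(* If no parameter satisfies the bounds, the supremum is 0 and only [W] itself is concerned. *)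
have [[l0 Sl0]|nS] := pselect (exists l, S l); last first.
  have -> : S = set0 by apply/seteqP; split => // l Sl; apply: nS; exists l.
  rewrite sup0; split=> // th /andP[t0 t1].
  have -> : th = 0 by apply/eqP; rewrite eq_le t1.
  by rewrite scale0r addr0.
have uS : has_ubound S by exists 1 => l [/andP[]].
have S0 : S !=set0 by exists l0.
split.
  by have [/andP[l00 _] _ _ _] := Sl0; apply: le_trans l00 _; exact: ub_le_sup.
suff aS : admissible (W + sup S *: P) by move=> th; exact: admissible_segment.
have aff (a : 'rV[R]_(1 + n + 1)) (k : R) :
    (forall l, S l -> k <= dot a (W + l *: P)) -> k <= dot a (W + sup S *: P).
  move=> h; rewrite -lerN2 dotDr dotZr.
  have -> : - (dot a W + sup S * dot a P) = - dot a P * sup S + - dot a W by ring.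
  by apply: affine_sup_le => // l /h; rewrite dotDr dotZr; lra.
apply/admissibleP; split.
  apply: lt_le_trans rp _; rewrite rho_form; apply: aff => l [_ + _ _].
  by rewrite rho_form.
(* The form dominates the internal energy Phi rho^gamma, which is at least p0 r0^gamma on [S]. *)
move=> v; pose k := p0 * r0 `^ gamma.
have k0 : 0 < k by rewrite mulr_gt0// powR_gt0.
apply: lt_le_trans k0 _; apply: aff => l [_ hr _ hp].
set u := W + l *: P in hr hp *.
have ru : 0 < rho u by exact: lt_le_trans rp hr.
apply: le_trans _ (internal_energy_le_form v ru).
have -> : internal_energy u = Phi gamma u * rho u `^ gamma.
  by rewrite /Phi powRN mulfVK// gt_eqF// powR_gt0.
rewrite /k ler_pM ?powR_ge0//; first exact: ltW.
by rewrite ge0_ler_powR// ?nnegrE ?ltW//; lra.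
Qed.

End admissible_convex.

(** * The limited step on an abstract stencil *)

Section scheme_step.
Context (R : realType) (n : nat) (gamma : R).
Context (lmax : 'rV[R]_(1 + n + 1) -> 'rV[R]_(1 + n + 1) -> 'rV[R]_n -> R).
Context (V : finType) (N : V -> {set V}).
Context (m : V -> R) (mm : V -> V -> R) (c : V -> V -> 'rV[R]_n).
Context (alpha : V -> R) (U : V -> 'rV[R]_(1 + n + 1)) (cfl : R).
Local Notation state := 'rV[R]_(1 + n + 1).
Local Notation f u w := (flux_dot gamma u w).
Hypotheses (gamma1 : 1 < gamma)
  (lmaxP : forall uL uR w, admissible uL -> admissible uR -> enorm w = 1 ->
     wave_speed_bound gamma w uL uR (lmax uL uR w))
  (Uadm : forall i, admissible (U i)) (cfl01 : 0 < cfl <= 1).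
Hypotheses (Nsym : forall i j, (j \in N i) = (i \in N j))
  (Nrefl : forall i, i \in N i) (Ncard : forall i, (1 < #|N i|)%N)
  (c0 : forall i j, j \in Nstar N i -> c i j != 0)
  (m_ge0 : forall i, 0 <= m i)
  (c_sum : forall i, \sum_(j in N i) c i j = 0).

Let tau := time_step lmax N m c U cfl.
Local Notation d := (dL lmax N c U).
Local Notation od := (dL_offdiag lmax c U).
Local Notation lam := (lambda R N).

Lemma NstarE i j : (j \in Nstar N i) = (j != i) && (j \in N i).
Proof. by rewrite /Nstar finset.in_setD1. Qed.

Lemma Nstar_sym i j : (j \in Nstar N i) = (i \in Nstar N j).
Proof. by rewrite !NstarE eq_sym Nsym. Qed.

Lemma lambda_gt0 i : 0 < lam i.
Proof. by rewrite /lambda invr_gt0 subr_gt0 ltr1n. Qed.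

Lemma sum_lambda i : \sum_(j in Nstar N i) lam i = 1.
Proof.
rewrite sumr_const -[LHS]mulr_natl /lambda.
have -> : #|Nstar N i|%:R = #|N i|%:R - 1 :> R.
  by rewrite (cardsD1 i (N i)) Nrefl natrD addrC addKr.
by rewrite divff// gt_eqF// subr_gt0 ltr1n.
Qed.

Lemma odC i j : od i j = od j i.
Proof. by rewrite /dL_offdiag maxC. Qed.

Lemma dC i j : i != j -> d i j = d j i.
Proof. by move=> ij; rewrite /dL (negbTE ij) eq_sym (negbTE ij) odC. Qed.

Lemma d_offdiag i j : j \in Nstar N i -> d i j = od i j.
Proof. by rewrite NstarE => /andP[ji _]; rewrite /dL eq_sym (negbTE ji). Qed.

Lemma lmax_bound i j : j \in Nstar N i ->
  wave_speed_bound gamma (unit_cvec c i j) (U i) (U j)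
    (lmax (U i) (U j) (unit_cvec c i j)).
Proof. by move=> ij; apply: lmaxP => //; apply: enorm_normalize; exact: c0. Qed.

Lemma od_ge i j : j \in Nstar N i ->
  lmax (U i) (U j) (unit_cvec c i j) * enorm (c i j) <= od i j.
Proof. by move=> ij; rewrite /dL_offdiag le_max lexx. Qed.

Lemma od_ge0 i j : j \in Nstar N i -> 0 <= od i j.
Proof.
move=> ij; apply: le_trans (od_ge ij); rewrite mulr_ge0 ?enorm_ge0//.
by case: (lmax_bound ij).
Qed.

Lemma flux_unit i j (u : state) : j \in Nstar N i ->
  f u (c i j) = enorm (c i j) *: f u (unit_cvec c i j).
Proof.
move=> ij; rewrite /unit_cvec flux_dotZr scalerA divff ?scale1r//.
by rewrite gt_eqF// enorm_gt0// c0.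
Qed.

Lemma bar_state_diag i : bar_state gamma lmax N c U i i = U i.
Proof.
by rewrite /bar_state subrr scaler0 subr0 scalerDr -scalerDl -[X in X + X]mul1r -splitr scale1r.
Qed.

Lemma bar_state_admissible i j : j \in Nstar N i -> 0 < od i j ->
  admissible (bar_state gamma lmax N c U i j).
Proof.
move=> ij oij; have e0 : 0 < enorm (c i j) by rewrite enorm_gt0// c0.
have [l0 [Q QS Qfan]] := lmax_bound ij.
have L0 : 0 < od i j / enorm (c i j) by rewrite divr_gt0.
have lL : lmax (U i) (U j) (unit_cvec c i j) <= od i j / enorm (c i j).
  by rewrite ler_pdivlMr// od_ge.
have := @fan_mean_admissible R n gamma _ _ _ _ Q gamma1 (Uadm i) (Uadm j) L0 QS.
rewrite /fan_mean /bar_state d_offdiag// !(flux_unit _ ij) -scalerBr scalerA.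
have -> : (2 * (od i j / enorm (c i j)))^-1 = (2 * od i j)^-1 * enorm (c i j).
  by field; rewrite !gt_eqF.
apply=> xi; have [h1 h2] := Qfan xi; split => h; [apply: h1|apply: h2]; lra.
Qed.

(** For d_ij = 0 the state is the average of [U i] and [U j], the inverse of 0 being 0. Its density
    is still positive, which keeps the lower density bound of the limiter positive. *)
Lemma rho_bar_state_gt0 i j : j \in N i -> 0 < rho (bar_state gamma lmax N c U i j).
Proof.
move=> jN; have [->|ji] := eqVneq j i; first by rewrite bar_state_diag; case: (Uadm i).
have ij : j \in Nstar N i by rewrite NstarE ji.
have := od_ge0 ij; rewrite le_eqVlt => /orP[/eqP o0|o0]; last first.
  by case: (bar_state_admissible ij o0).
rewrite /bar_state d_offdiag// -o0 mulr0 invr0 scale0r subr0.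
have [ri _] := Uadm i; have [rj _] := Uadm j.
rewrite rho_form dotZr dotDr -!rho_form; lra.
Qed.

Lemma rho_min_gt0 i : 0 < rho_min gamma lmax N c U i.
Proof. by apply: (finmin_gt0 (Nrefl i)) => j; exact: rho_bar_state_gt0. Qed.

Lemma Phi_min_gt0 i : 0 < Phi_min gamma N U i.
Proof. by apply: (finmin_gt0 (Nrefl i)) => j _; exact: Phi_gt0. Qed.

Lemma d_diag i : d i i = - \sum_(k in Nstar N i) od i k.
Proof. by rewrite /dL eqxx. Qed.

Lemma sum_od_ge0 i : 0 <= \sum_(k in Nstar N i) od i k.
Proof. by apply: sumr_ge0 => k; exact: od_ge0. Qed.

Lemma tau_ge0 : 0 <= tau.
Proof.
have /andP[cf0 _] := cfl01; rewrite mulr_ge0 ?(ltW cf0)//.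
apply: finmin_ge0 => j _; rewrite d_diag mulrN invrN mulrN opprK.
by rewrite divr_ge0// mulr_ge0// sum_od_ge0.
Qed.

Lemma tau_le i : tau <= m i / (2 * \sum_(k in Nstar N i) od i k).
Proof.
have /andP[cf0 cf1] := cfl01.
have := @finmin_le R V [set: V]%SET (fun i => - (m i / (2 * d i i))) i (finset.in_setT _).
rewrite d_diag mulrN invrN mulrN opprK => h.
have q0 : 0 <= m i / (2 * \sum_(k in Nstar N i) od i k).
  by rewrite divr_ge0// mulr_ge0// sum_od_ge0.
rewrite /tau /time_step; apply: le_trans (ler_wpM2l (ltW cf0) h) _.
by rewrite -[leRHS]mul1r ler_wpM2r.
Qed.

(** With m_i = 0 the i-th quotient is 0 and bounds the time step; a vanishing sum of d_ij does the
    same in [tau_gt0_sum] through division by 0. *)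
Lemma tau_gt0_m i : 0 < tau -> 0 < m i.
Proof.
move=> t0; rewrite lt_neqAle m_ge0 andbT eq_sym; apply/eqP => mi.
by have := tau_le i; rewrite mi mul0r leNgt t0.
Qed.

Lemma tau_gt0_sum i : 0 < tau -> 0 < \sum_(k in Nstar N i) od i k.
Proof.
move=> t0; rewrite lt_neqAle sum_od_ge0 andbT eq_sym; apply/eqP => si.
by have := tau_le i; rewrite si mulr0 invr0 mulr0 leNgt t0.
Qed.

(* When d_ij = 0 the state bar_ij is a junk value, but its weight is 0 and the
   flux difference vanishes because the maximal wave speed is 0. *)
Lemma low_orderE i : 0 < tau -> low_order gamma lmax N m c U tau i =
  \sum_(j in N i)
    (if j == i then 1 - \sum_(k in Nstar N i) 2 * tau / m i * od i k
     else 2 * tau / m i * od i j) *: bar_state gamma lmax N c U i j.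
Proof.
move=> t0; have mi := tau_gt0_m i t0; rewrite /low_order.
have -> : \sum_(j in N i) (- f (U j) (c i j) + d i j *: (U j - U i)) =
    \sum_(j in Nstar N i) (2 * od i j) *: (bar_state gamma lmax N c U i j - U i).
  (* The rows of [c] sum to 0, so f(U_i) c_ij may be subtracted under the sum. *)
  have -> : \sum_(j in N i) (- f (U j) (c i j) + d i j *: (U j - U i)) =
      \sum_(j in N i) (- (f (U j) (c i j) - f (U i) (c i j)) + d i j *: (U j - U i)).
    have z : \sum_(j in N i) f (U i) (c i j) = 0.
      by rewrite -flux_dot_sumr c_sum flux_dot0r.
    transitivity (\sum_(j in N i) (- f (U j) (c i j) + d i j *: (U j - U i)) +
        \sum_(j in N i) f (U i) (c i j)); first by rewrite z addr0.
    rewrite -big_split/=; apply: eq_bigr => j _.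
    by rewrite [LHS]addrAC opprB; congr (_ + _); rewrite addrC.
  rewrite (bigD1 i)//= !subrr scaler0 addr0 oppr0 add0r.
  apply: eq_big => [j|j /andP[jN ji]]; first by rewrite NstarE andbC.
  have ij : j \in Nstar N i by rewrite NstarE ji.
  have := od_ge0 ij; rewrite le_eqVlt => /orP[/eqP o0|o0].
    rewrite d_offdiag// -o0 mulr0 !scale0r addr0.
    have lz : lmax (U i) (U j) (unit_cvec c i j) = 0.
      have e0 : 0 < enorm (c i j) by rewrite enorm_gt0// c0.
      have := od_ge ij; rewrite -o0 pmulr_lle0// => h.
      by apply/eqP; rewrite eq_le h; case: (lmax_bound ij).
    have := lmax_bound ij; rewrite lz => /wave_speed_zero E.
    by rewrite !(flux_unit _ ij) E subrr oppr0.
  rewrite /bar_state d_offdiag//; apply/rowP => k; rewrite !mxE.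
  by field; rewrite gt_eqF.
rewrite [RHS](bigD1 i)//= eqxx bar_state_diag scalerBl scale1r -addrA; congr (_ + _).
rewrite scaler_suml -sumrN scaler_sumr.
have -> : \sum_(j in N i | j != i) (if j == i
     then 1 - \sum_(k in Nstar N i) 2 * tau / m i * od i k
     else 2 * tau / m i * od i j) *: bar_state gamma lmax N c U i j =
    \sum_(j in Nstar N i) (2 * tau / m i * od i j) *: bar_state gamma lmax N c U i j.
  apply: eq_big => [j|j /andP[_ /negbTE ->]//]; by rewrite NstarE andbC.
rewrite -big_split/=; apply: eq_bigr => j _.
rewrite scalerA scalerBr addrC; have -> : tau / m i * (2 * od i j) = 2 * tau / m i * od i j by ring.
by [].
Qed.

Lemma low_order_admissible i : 0 < tau -> admissible (low_order gamma lmax N m c U tau i).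
Proof.
move=> t0; have mi := tau_gt0_m i t0; rewrite low_orderE//.
have q0 : 0 < 2 * tau / m i by rewrite divr_gt0// mulr_gt0.
(* This is where [cfl <= 1] enters: the weight left for [U i] is nonnegative, and the 2 of the time
   step matches that of the auxiliary states. *)
have s1 : \sum_(k in Nstar N i) 2 * tau / m i * od i k <= 1.
  have := tau_le i; have sp := tau_gt0_sum i t0.
  rewrite ler_pdivlMr ?mulr_gt0// => h; rewrite -mulr_sumr.
  set S := \sum_(k in _) _ in h *.
  have -> : 2 * tau / m i * S = tau * (2 * S) / m i by ring.
  by rewrite ler_pdivrMr// mul1r.
apply: admissible_conv.
- move=> j jN; case: eqVneq => [_|ji]; first by rewrite subr_ge0.
  by rewrite mulr_ge0// ?(ltW q0)// od_ge0// NstarE ji.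
- rewrite (bigD1 i)//= eqxx -[RHS](subrK (\sum_(k in Nstar N i) 2 * tau / m i * od i k)).
  congr (_ + _); apply: eq_big => [j|j /andP[_ /negbTE ->]//]; by rewrite NstarE andbC.
- move=> j jN; case: eqVneq => [->|ji]; first by rewrite bar_state_diag.
  by rewrite pmulr_rgt0// => oj; apply: bar_state_admissible => //; rewrite NstarE ji.
Qed.

Section limiting.
Implicit Types (W : V -> state) (P : V -> V -> state).
Local Notation osl := (one_sided_limiter gamma lmax N c U).
Local Notation lim := (limiter gamma lmax N c U).

Lemma one_sided_limiterP W P i j : admissible (W i) ->
  0 <= osl W P i j /\
  forall th, 0 <= th <= osl W P i j -> admissible (W i + th *: P i j).
Proof.
move=> aW; have := @admissible_sup R n gamma (W i) (P i j)
  (rho_min gamma lmax N c U i) (neg_rho_min gamma lmax N c U i)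
  (Phi_min gamma N U i) gamma1 aW.
by rewrite /one_sided_limiter => /(_ (rho_min_gt0 i) (Phi_min_gt0 i)).
Qed.

Lemma limiterC W P i j : lim W P i j = lim W P j i.
Proof. by rewrite /limiter; apply: minC. Qed.

Lemma limiter_admissible W P i j : (forall i, admissible (W i)) ->
  admissible (W i + lim W P i j *: P i j).
Proof.
move=> aW; have [s1 h1] := one_sided_limiterP P j (aW i).
have [s2 _] := one_sided_limiterP P i (aW j).
have minP (x y : R) : 0 <= x -> 0 <= y -> 0 <= Num.min x y <= x.
  by move=> x0 y0; rewrite le_min x0 y0 ge_min lexx.
by apply: h1; exact: minP s1 s2.
Qed.

(** Since the weights sum to 1, a repetition of the limiting starts exactly from the previous
    limited update, with its admissibility and its mass. *)
Lemma relimit_baseE W P i :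
  relimit_base gamma lmax N c U W P i = limited gamma lmax N c U W P i.
Proof.
rewrite /relimit_base /limited; under eq_bigr do rewrite scalerDr scalerA.
by rewrite big_split/= -scaler_suml sum_lambda scale1r.
Qed.

Lemma limited_admissible W P : (forall i, admissible (W i)) ->
  forall i, admissible (limited gamma lmax N c U W P i).
Proof.
move=> aW i; rewrite -relimit_baseE /relimit_base; apply: admissible_conv.
- by move=> j _; exact/ltW/lambda_gt0.
- exact: sum_lambda.
- by move=> j _ _; exact: limiter_admissible.
Qed.

(** m_i lambda_i P_ij is the mass-weighted exchange between i and j. Symmetric factors such as the
    limiter preserve its antisymmetry, which is the invariant of the repetitions. *)
Definition antisym_correction P : Prop := forall i j, j \in Nstar N i ->
  (m i * lam i) *: P i j = - ((m j * lam j) *: P j i).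

Lemma limited_mass W P : antisym_correction P ->
  \sum_i m i *: limited gamma lmax N c U W P i = \sum_i m i *: W i.
Proof.
move=> aP; rewrite /limited; move: (limiterC W P); move: (lim W P) => L LC.
under eq_bigr do rewrite scalerDr.
rewrite big_split/= -[RHS]addr0; congr (_ + _).
set X := \sum_i _.
have XE : X = \sum_i \sum_(j in Nstar N i) L i j *: ((m i * lam i) *: P i j).
  apply: eq_bigr => i _; rewrite scaler_sumr; apply: eq_bigr => j _.
  by rewrite !scalerA; congr (_ *: _); ring.
(* Exchanging the roles of the two indices changes the sign of the exchange and keeps the
   limiter. *)
have XN : X = - X.
  rewrite {1}XE (exchange_big_dep xpredT)//= XE -sumrN; apply: eq_bigr => j _.
  rewrite -sumrN; apply: eq_big => [i|i ij]; first by rewrite Nstar_sym.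
  by rewrite (aP i j ij) scalerN LC.
apply/rowP => k; have := congr1 (fun z : state => z 0 k) XN.
rewrite !mxE; lra.
Qed.

Lemma relimit_antisym W P : antisym_correction P ->
  antisym_correction (relimit_correction gamma lmax N c U W P).
Proof.
move=> aP i j ij; rewrite /relimit_correction.
move: (limiterC W P i j); move: (lim W P i j) (lim W P j i) => L _ <-.
transitivity ((1 - L) *: ((m i * lam i) *: P i j)); first by rewrite !scalerA [in RHS]mulrC.
by rewrite (aP i j ij) scalerN !scalerA [in LHS]mulrC.
Qed.

Lemma limited_after_spec r W P : (forall i, admissible (W i)) -> antisym_correction P ->
  (forall i, admissible (limited_after gamma lmax N c U r W P i)) /\
  \sum_i m i *: limited_after gamma lmax N c U r W P i = \sum_i m i *: W i.
Proof.
elim: r W P => [|r IHr] W P aW aP /=.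
  by split; [exact: limited_admissible|exact: limited_mass].
have E : relimit_base gamma lmax N c U W P = limited gamma lmax N c U W P.
  by apply/funext => i; exact: relimit_baseE.
have [h1 h2] := IHr _ _ (limited_admissible P aW) (relimit_antisym W aP).
by rewrite E; split => //; rewrite h2; exact: limited_mass.
Qed.

End limiting.

Lemma P0_antisym : 0 < tau ->
  antisym_correction (P0 gamma lmax N m mm c alpha U tau).
Proof.
move=> t0 i j ij; have mi := tau_gt0_m i t0; have mj := tau_gt0_m j t0.
have li := lambda_gt0 i; have lj := lambda_gt0 j.
have ji : i != j by move: ij; rewrite NstarE eq_sym => /andP[].
have w0 k : 0 < m k -> 0 < lam k -> m k * lam k * (tau / (m k * lam k)) = tau.
  by move=> mk lk; field; rewrite !gt_eqF.
rewrite /P0 !scalerA !w0// -[RHS]scalerN; congr (_ *: _).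
have -> : dH lmax N c alpha U j i = dH lmax N c alpha U i j.
  by rewrite /dH (dC ji) (addrC (alpha j)).
rewrite (dC ji) opprD opprB; congr (_ + _).
by rewrite -scalerN opprB.
Qed.

(** Summed over [i], the viscous terms cancel by symmetry of d_ij, and each f(U_j) collects the
    column sum of [c]. *)
Lemma low_order_mass (B : V -> 'rV[R]_n) : 0 < tau ->
  (forall j, \sum_(i in N j) c i j = B j) ->
  \sum_i m i *: low_order gamma lmax N m c U tau i
  + tau *: \sum_j f (U j) (B j) = \sum_i m i *: U i.
Proof.
move=> t0 cB; rewrite /low_order.
have -> : \sum_i m i *: (U i + (tau / m i) *: \sum_(j in N i)
      (- f (U j) (c i j) + d i j *: (U j - U i))) =
    \sum_i m i *: U i + tau *: \sum_i \sum_(j in N i)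
      (- f (U j) (c i j) + d i j *: (U j - U i)).
  rewrite scaler_sumr -big_split/=; apply: eq_bigr => i _.
  rewrite scalerDr scalerA; congr (_ + _ *: _).
  by have := tau_gt0_m i t0 => mi; field; rewrite gt_eqF.
rewrite -addrA -scalerDr -[RHS]addr0; congr (_ + _).
suff -> : \sum_i \sum_(j in N i) (- f (U j) (c i j) + d i j *: (U j - U i)) =
    - \sum_j f (U j) (B j) by rewrite addNr scaler0.
under eq_bigr do rewrite big_split/=.
rewrite big_split/=; set Y := (X in _ + X = _).
have Y0 : Y = 0.
  have YN : Y = - Y.
    rewrite {1}/Y (exchange_big_dep xpredT)//= /Y -sumrN; apply: eq_bigr => j _.
    rewrite -sumrN; apply: eq_big => [i|i ij]; first by rewrite Nsym.
    have [->|ne] := eqVneq i j; first by rewrite !subrr !scaler0 oppr0.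
    by rewrite (dC ne) -scalerN opprB.
  apply/rowP => k; have := congr1 (fun z : state => z 0 k) YN.
  rewrite !mxE; lra.
rewrite Y0 addr0 (exchange_big_dep xpredT)//= -sumrN; apply: eq_bigr => j _.
rewrite sumrN -cB flux_dot_sumr; congr (- _).
by apply: eq_bigl => i; rewrite Nsym.
Qed.

Theorem euler_step_spec (B : V -> 'rV[R]_n) (r : nat) :
  (forall j, \sum_(i in N j) c i j = B j) ->
  let U' := euler_step gamma lmax N m mm c alpha U tau r in
  (forall i, admissible (U' i)) /\
  \sum_i m i *: U' i + tau *: \sum_j f (U j) (B j) = \sum_i m i *: U i.
Proof.
move=> cB U'; have := tau_ge0; rewrite le_eqVlt => /orP[/eqP t0|t0].
  (* For [tau = 0] the low-order update is [U] and all corrections vanish. *)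
  have [h1 h2] : (forall i, admissible (U' i)) /\
      \sum_i m i *: U' i = \sum_i m i *: low_order gamma lmax N m c U tau i.
    apply: limited_after_spec.
      by move=> i; rewrite /low_order -t0 mul0r scale0r addr0.
    by move=> i j ij; rewrite /P0 -t0 !mul0r !scale0r !scaler0 oppr0.
  split => //; rewrite h2 -t0 scale0r addr0.
  by apply: eq_bigr => i _; rewrite /low_order mul0r scale0r addr0.
have [h1 h2] := @limited_after_spec r _ _ (fun i => low_order_admissible i t0) (P0_antisym t0).
by split => //; rewrite h2 low_order_mass.
Qed.

End scheme_step.

(** * Lagrange elements *)

Section finite_elements.
Context (R : realType) (d : nat) (D : set 'rV[R]_d.+1)
    (T : finType) (faces : T -> seq ('rV[R]_d.+1 * R))
    (V : finType) (node : V -> 'rV[R]_d.+1)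
    (P : T -> set ('rV[R]_d.+1 -> R)) (phi : V -> 'rV[R]_d.+1 -> R).
Hypotheses (hD : polyhedral_domain D) (hT : mesh_of D faces)
    (hphi : lagrange_basis D faces node P phi)
    (phi_ge0 : forall i x, closure D x -> 0 <= phi i x)
    (phi_sum1 : forall x, closure D x -> \sum_i phi i x = 1).
Local Notation n := d.+1.
Local Notation cl K := (cell (faces K)).
Local Notation c := (cvec faces phi).
Local Notation N := (stencil D phi).

Let oD : open D. Proof. by case: hD. Qed.
Let bD : bounded_set D. Proof. by case: hD. Qed.

Lemma basis_continuous i : {within closure D, continuous (phi i)}.
Proof. by case: hphi => _ /(_ i)[[]]. Qed.

Lemma basis_C1 i K : exists2 g : 'rV[R]_n -> R^o,
  continuously_differentiable g & forall x, cl K x -> phi i x = g x.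
Proof.
case: hphi => [[_ _ PC1 _ _]] /(_ i)[[_ /(_ K)[f Pf fE]] _].
by have [g g1 gE] := PC1 K f Pf; exists g => // x xK; rewrite fE// gE.
Qed.

Lemma basis_bounded i : exists M, forall x, closure D x -> `|phi i x| <= M.
Proof.
apply: within_continuous_bounded; [exact: (closure_bounded bD)|exact: closed_closure|].
exact: basis_continuous.
Qed.

Lemma rintegrable_basis i : rintegrable (phi i \_ D).
Proof.
have [M hM] := basis_bounded i.
apply: (@rintegrable_patch _ _ _ _ M) => // x Dx; last exact/hM/subset_closure.
move/subspace_continuousP : (@basis_continuous i) => /(_ _ (subset_closure Dx)) cx U xU.
have cU : \forall z \near x, closure D z -> U (phi i z) by exact: cx.
have xD : \forall z \near x, D z by exact: open_nbhs_nbhs.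
by apply: filterS2 cU xD => z /= h /subset_closure.
Qed.

Lemma fe_integral (U : V -> 'rV[R]_(1 + n + 1)) (uh : 'rV[R]_n -> 'rV[R]_(1 + n + 1)) :
  (forall x, closure D x -> uh x = \sum_i phi i x *: U i) ->
  \row_k integral_on D (fun x => uh x 0 k) = \sum_i mass D phi i *: U i.
Proof.
move=> uhE; apply/rowP => k; rewrite mxE integral_onE summxE.
transitivity (rint (fun x => \sum_i U i 0 k * (phi i \_ D) x)).
  apply: eq_rint => x; rewrite patchE; case: ifPn => [|xD].
    rewrite inE => Dx; rewrite uhE; last exact: subset_closure.
    rewrite summxE; apply: eq_bigr => i _.
    by rewrite patchE mem_set// mxE mulrC.
  by rewrite big1// => i _; rewrite patchE (negbTE xD) mulr0.
rewrite rint_sum; last by move=> i; exact/rintegrableZ/rintegrable_basis.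
apply: eq_bigr => i _; rewrite rintZ; last exact: rintegrable_basis.
by rewrite /mass integral_onE mxE mulrC.
Qed.

Lemma mass_ge0 i : 0 <= mass D phi i.
Proof. by apply: Rintegral_ge0 => t Dt; exact/phi_ge0/subset_closure. Qed.

Lemma cvecE i j k : c i j 0 k =
  \sum_K rint ((fun x => phi i x * grad (phi j) x 0 k) \_ (interior (cl K))).
Proof. by rewrite mxE; apply: eq_bigr => K _; rewrite integral_onE. Qed.

Lemma rintegrable_cvec i j k K :
  rintegrable ((fun x => phi i x * grad (phi j) x 0 k) \_ (interior (cl K))).
Proof.
exact: (rintegrable_grad bD hT (@basis_C1 j) K k (@basis_continuous i)).
Qed.

Lemma interior_closure K x : interior (cl K) x -> closure D x.
Proof. by move=> /interior_subset; exact: cell_closure hT _ _. Qed.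

(** The partition of unity removes [phi i] and leaves the integral of the gradient of [phi j]. *)
Lemma cvec_col_sum j : \sum_i c i j = bdry_integral_normal D (phi j).
Proof.
case: hD => _ _ _ _ [hs [hs0 bdryhs]].
apply/rowP => k.
rewrite -(divergence oD bD hT hs0 bdryhs (@basis_continuous j) (@phi_ge0 j) (@basis_C1 j)).
rewrite summxE; under eq_bigr do rewrite cvecE.
rewrite exchange_big/=; apply: eq_bigr => K _.
rewrite integral_onE -rint_sum; last by move=> i; exact: rintegrable_cvec.
apply: eq_rint => x; rewrite patchE; case: ifPn => xK.
  transitivity (\sum_i phi i x * grad (phi j) x 0 k).
    by apply: eq_bigr => i _; rewrite patchE xK.
  rewrite -mulr_suml phi_sum1 ?mul1r//.
  by move: xK; rewrite inE; exact: interior_closure.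
by rewrite big1// => i _; rewrite patchE (negbTE xK).
Qed.

(** Differentiates the partition of unity through the C^1 representatives on the cell. *)
Lemma sum_grad_basis K x : interior (cl K) x -> \sum_j grad (phi j) x = 0.
Proof.
move=> xK; have gP j := cid2 (basis_C1 j K).
apply/rowP => k; rewrite summxE mxE.
pose g j := projT1 (gP j).
have gC j : continuously_differentiable (g j) by rewrite /g; case: (gP j).
have gE j z : cl K z -> phi j z = g j z by rewrite /g; case: (gP j) => g' ? h; exact: h.
transitivity (\sum_j 'D_(delta_mx 0 k) (g j) x).
  apply: eq_bigr => j _; rewrite (grad_interior xK (gE j)) mxE//.
have dg j : derivable (g j) x (delta_mx 0 k) by apply: diff_derivable; have [] := gC j.
have -> : \sum_j 'D_(delta_mx 0 k) (g j) x = 'D_(delta_mx 0 k) (\sum_j g j) x.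
  suff H (s : seq V) : derivable (\sum_(j <- s) g j) x (delta_mx 0 k) /\
    'D_(delta_mx 0 k) (\sum_(j <- s) g j) x = \sum_(j <- s) 'D_(delta_mx 0 k) (g j) x.
    by have [_ ->] := H (index_enum V).
  elim: s => [|j s [IH1 IH2]].
    by rewrite !big_nil; split; [exact: derivable_cst|exact: derive_cst].
  rewrite !big_cons -IH2; split; first exact: derivableD (dg j) IH1.
  exact: deriveD (dg j) IH1.
rewrite (@near_eq_derive _ _ _ _ (cst (1 : R^o))) ?derive_cst//.
apply: filterS xK => z zK; rewrite fct_sumE.
rewrite -[RHS](phi_sum1 (cell_closure hT zK)).
by apply: eq_bigr => j _; rewrite gE.
Qed.

Lemma cvec_row_sum i : \sum_j c i j = 0.
Proof.
apply/rowP => k; rewrite summxE mxE; under eq_bigr do rewrite cvecE.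
rewrite exchange_big/=; apply: big1 => K _.
rewrite -rint_sum; last by move=> j; exact: rintegrable_cvec.
rewrite (@eq_rint _ _ _ (fun=> 0)); first by rewrite /rint /Rintegral integral0.
move=> x; have [xK|xK] := boolP (x \in (interior (cl K) : set 'rV[R]_n)).
  transitivity (\sum_j phi i x * grad (phi j) x 0 k).
    by apply: eq_bigr => j _; rewrite patchE xK.
  rewrite -mulr_sumr -summxE (@sum_grad_basis K) ?mxE ?mulr0//.
  by move: xK; rewrite inE.
by rewrite big1// => j _; rewrite patchE (negbTE xK).
Qed.

Lemma closed_measurable_row m (A : set 'rV[R]_m) : closed A ->
  measurable [set t : m.-tuple R | A (rowt t)].
Proof.
move=> cA; rewrite -[X in measurable X]setCK; apply: measurableC.
by apply: (@open_measurable_row R m (~` A)); exact: closed_openC.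
Qed.

Lemma near_basis_neq0 i x : closure D x -> phi i x != 0 ->
  \forall z \near x, closure D z -> phi i z != 0.
Proof.
move=> xD x0; move/subspace_continuousP : (@basis_continuous i) => /(_ _ xD) cx.
have h : nbhs (phi i x) [set r : R | r != 0].
  by apply: open_nbhs_nbhs; split => //; exact: open_neq.
exact: cx _ h.
Qed.

(** [supp] closes a subset of the open set [D], while [x] may lie on the boundary; continuity on the
    closure provides nearby points of [D]. *)
Lemma basis_supp i x : closure D x -> phi i x != 0 -> supp D phi i x.
Proof.
move=> xD x0 B xB; have [z [Dz [/= h Bz]]] := xD _ (filterI (near_basis_neq0 xD x0) xB).
by exists z; split => //; split => //; apply: h; exact: subset_closure.
Qed.

Lemma stencil_sym i j : (j \in N i) = (i \in N j).
Proof. by rewrite !finset.inE setIC. Qed.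

(** [phi i] is 1 at its node, which lies in the closure of [D], so it is nonzero on a nonempty open
    part of [D], of positive volume. *)
Lemma stencil_refl i : i \in N i.
Proof.
rewrite finset.inE; apply/asboolP; rewrite setIid.
case: hphi => [[_ nodeD _ _ _] /(_ i)[_ phiN]].
have n0 : phi i (node i) != 0 by rewrite phiN eqxx oner_eq0.
have O := near_basis_neq0 (nodeD i) n0.
pose A := interior [set z | closure D z -> phi i z != 0] `&` D.
have oA : open A by apply: openI => //; exact: open_interior.
have [z [Dz Oz]] := nodeD i _ (nbhs_interior O).
have A0 : A !=set0 by exists z; split => //; exact: nbhs_singleton Oz.
have := open_vol_gt0 oA A0; apply: contraPP => /contrapT v0.
apply/negP; rewrite -leNgt -v0 /vol; apply: le_measure; rewrite ?inE.
- exact: open_measurable_row.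
- by apply: closed_measurable_row; exact: closed_closure.
- move=> t [At Dt]; apply: subset_closure; split => //.
  by apply: (interior_subset At); exact: subset_closure.
Qed.

(** The integrand vanishes off the overlap of the supports, because the gradient is 0 outside the
    closed support; outside the stencil this overlap is null. *)
Lemma cvec_out i j : j \notin N i -> c i j = 0.
Proof.
rewrite finset.inE => /asboolP/contrapT v0.
have nS : null_rows (supp D phi i `&` supp D phi j).
  exists [set t | (supp D phi i `&` supp D phi j) (rowt t)]; split => //.
  by apply: closed_measurable_row; apply: closedI; exact: closed_closure.
apply/rowP => k; rewrite cvecE mxE; apply: big1 => K _.
have z0 : rintegrable (fun _ : 'rV[R]_n => 0 : R) by exact: integrable0.
rewrite (@eq_rint_ae R n _ (fun=> 0) (@rintegrable_cvec i j k K) z0).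
  by rewrite /rint /Rintegral integral0.
apply: negligibleS nS => t /=; rewrite patchE; case: ifPn => //; rewrite inE => xK h.
have xD := interior_closure xK; split; apply: contrapT => ns; apply: h.
  suff -> : phi i (rowt t) = 0 by rewrite mul0r.
  by apply/eqP/contraT => /(basis_supp xD).
rewrite mxE (@near_eq_derive _ _ _ _ (cst (0 : R^o))) ?derive_cst ?mulr0//.
have ns' : nbhs (rowt t) (~` supp D phi j).
  by apply: open_nbhs_nbhs; split => //; apply/closed_openC/closed_closure.
apply: filterS2 ns' (nbhs_interior xK) => z /= nz zK.
by apply/eqP/contraT => z0'; exfalso; apply: nz; apply: basis_supp => //; exact: interior_closure zK.
Qed.

Lemma cvec_sum_stencil i : \sum_(j in N i) c i j = 0.
Proof.
rewrite -[RHS](cvec_row_sum i) [RHS](bigID (fun j => j \in N i))/=.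
by rewrite [X in _ + X]big1 ?addr0// => j; exact: cvec_out.
Qed.

Lemma cvec_sum_bdry j : \sum_(i in N j) c i j = bdry_integral_normal D (phi j).
Proof.
rewrite -cvec_col_sum [RHS](bigID (fun i => i \in N j))/=.
by rewrite [X in _ + X]big1 ?addr0// => i; rewrite stencil_sym; exact: cvec_out.
Qed.

Lemma bdry_integral_eq0 i : i \notin bdry_dofs D phi ->
  bdry_integral_normal D (phi i) = 0.
Proof.
rewrite finset.inE => /asboolP nb; apply: fsbig1 => h _.
rewrite /hyperplane_integral /integral_on (@eq_Rintegral _ _ _ _ _ (fun=> 0)).
  by rewrite /Rintegral integral0 mulr0 scale0r.
move=> t; rewrite inE => -[bt _ _]; apply: contrapT => /eqP p0.
by apply: nb; exists (graph_point h (\row_i tnth t i)).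
Qed.

(** The normalisation cancels; if the boundary integral is 0, so is [bdry_normal], and both sides
    vanish. *)
Lemma bdry_flux (gamma : R) i (u : 'rV[R]_(1 + n + 1)) :
  bdry_mass D phi i *: flux_dot gamma u (bdry_normal D phi i) =
  flux_dot gamma u (bdry_integral_normal D (phi i)).
Proof.
rewrite -flux_dotZr /bdry_normal scalerA; congr flux_dot.
have [->|b0] := eqVneq (bdry_integral_normal D (phi i)) 0; first by rewrite scaler0.
by rewrite divff ?scale1r// gt_eqF// /bdry_mass enorm_gt0.
Qed.

End finite_elements.

Theorem lemma3p2 (R : realType) (d : nat) (D : set 'rV[R]_d.+1)
    (T : finType) (faces : T -> seq ('rV[R]_d.+1 * R))
    (V : finType) (node : V -> 'rV[R]_d.+1)
    (P : T -> set ('rV[R]_d.+1 -> R)) (phi : V -> 'rV[R]_d.+1 -> R)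
    (hD : polyhedral_domain D)
    (hT : mesh_of D faces)
    (hphi : lagrange_basis D faces node P phi)
    (phi_ge0 : forall i x, closure D x -> 0 <= phi i x)
    (phi_sum1 : forall x, closure D x -> \sum_i phi i x = 1) :
  let N := stencil D phi in
  let m := mass D phi in
  let mm := mass2 D phi in
  let c := cvec faces phi in
  (forall (U : V -> 'rV[R]_(1 + d.+1 + 1))
      (uh : 'rV[R]_d.+1 -> 'rV[R]_(1 + d.+1 + 1)),
    (forall x, closure D x -> uh x = \sum_i phi i x *: U i) ->
    \row_k integral_on D (fun x => uh x 0 k) = \sum_i m i *: U i)
  /\
  ((forall i, (1 < #|N i|)%N) ->
   (forall i j, j \in Nstar N i -> c i j != 0) ->
   forall (gamma : R)
     (lmax : 'rV[R]_(1 + d.+1 + 1) -> 'rV[R]_(1 + d.+1 + 1) ->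
             'rV[R]_d.+1 -> R)
     (alpha : V -> R) (U : V -> 'rV[R]_(1 + d.+1 + 1)) (cfl : R) (r : nat),
   1 < gamma ->
   (forall uL uR w, admissible uL -> admissible uR -> enorm w = 1 ->
      wave_speed_bound gamma w uL uR (lmax uL uR w)) ->
   (forall i, 0 <= alpha i <= 1) ->
   (forall i, admissible (U i)) ->
   0 < cfl <= 1 ->
   let tau := time_step lmax N m c U cfl in
   let U' := euler_step gamma lmax N m mm c alpha U tau r in
   (forall i, admissible (U' i)) /\
   \sum_i m i *: U' i
     + tau *: \sum_(i in bdry_dofs D phi)
         bdry_mass D phi i *: flux_dot gamma (U i) (bdry_normal D phi i)
     = \sum_i m i *: U i).
Proof.
move=> N m mm c; split; first by move=> U uh; exact: (fe_integral hD hphi).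
move=> Ncard c0 gamma lmax alpha U cfl r gamma1 lmaxP _ Uadm cfl01 tau U'.
(* Indices outside [bdry_dofs] have zero boundary integral, so the sum may run over all of [V]. *)
have -> : \sum_(i in bdry_dofs D phi)
      bdry_mass D phi i *: flux_dot gamma (U i) (bdry_normal D phi i) =
    \sum_i flux_dot gamma (U i) (bdry_integral_normal D (phi i)).
  rewrite [RHS](bigID (fun i => i \in bdry_dofs D phi))/= [X in _ = _ + X]big1 ?addr0.
    by apply: eq_bigr => i _; exact: bdry_flux.
  by move=> i ib; rewrite bdry_integral_eq0// flux_dot0r.
apply: (euler_step_spec mm alpha gamma1 lmaxP Uadm cfl01 _ _ Ncard c0).
- exact: stencil_sym.
- exact: (stencil_refl hD hphi).
- exact: (mass_ge0 phi_ge0).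
- exact: (cvec_sum_stencil hD hT hphi phi_sum1).
- exact: (cvec_sum_bdry hD hT hphi phi_ge0 phi_sum1).
Qed.
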